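(* Let $X:\mathbb{R}^N\to\mathbb{R}^d$, $X=(X_1,\dots,X_d)$, be a Gaussian random field with continuous sample paths, where $X_1,\dots,X_d$ are independent copies of a mean zero Gaussian process $X_0:\mathbb{R}^N\to\mathbb{R}$ with $X_0(0)=0$ a.s. Assume that $X_0$ satisfies Condition (C) (given in the context) for some function $\psi$, and let $\alpha_*\le\alpha^*$ be the lower and upper indices of $\psi$ at $0$. Let $q>1$ and let $\mu$ be a Borel probability measure on $\mathbb{R}^N$ with compact support. (i) If $0<\alpha_*=\alpha^*=\alpha<1$, then $$\underline{D}_q(\mu_X)=\min\Big\{d,\ \frac1\alpha\,\underline{D}_q(\mu)\Big\}\quad\text{a.s.}$$ (ii) If the generalized $q$-dimension $D_q(\mu)$ of $\mu$ exists and $0<\alpha_*\le\alpha^*<1$, then $$\min\Big\{d,\ \frac1{\alpha^*}D_q(\mu)\Big\}=\underline{D}_q(\mu_X)\le\overline{D}_q(\mu_X)\le\min\Big\{d,\ \frac1{\alpha_*}D_q(\mu)\Big\}\quad\text{a.s.}$$ (iii) If the generalized $q$-dimension $D_q(\mu)$ of $\mu$ exists and $0<\alpha_*=\alpha^*=\alpha<1$, then the generalized $q$-dimension $D_q(\mu_X)$ of $\mu_X$ exists almost surely, and $$D_q(\mu_X)=\min\Big\{d,\ \frac1\alpha D_q(\mu)\Big\}\quad\text{a.s.}$$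
   Context: Generalized dimensions. For a nonzero finite Borel measure $\nu$ of bounded support on $\mathbb{R}^n$ and $r>0$, let $\mathcal{M}_r$ be the family of $r$-mesh cubes $[i_1r,(i_1+1)r)\times\cdots\times[i_nr,(i_n+1)r)$, $i_1,\dots,i_n\in\mathbb{Z}$, and let $M_r(q)=\sum_{C\in\mathcal{M}_r}\nu(C)^q$. For $q>0$, $q\ne1$, $$\underline{D}_q(\nu)=\liminf_{r\to0}\frac{\log M_r(q)}{(q-1)\log r},\qquad \overline{D}_q(\nu)=\limsup_{r\to0}\frac{\log M_r(q)}{(q-1)\log r}.$$ If these are equal, the common value $D_q(\nu)$ is called the generalized $q$-dimension, and it is said to exist. Image measure. $\mu_X$ is the random Borel measure on $\mathbb{R}^d$ given by $\mu_X(A)=\mu\{x: X(x)\in A\}$ for Borel $A\subseteq\mathbb{R}^d$. Condition (C) for $X_0$ and $\psi$. For some $\delta_0>0$, $\psi:[0,\delta_0)\to[0,\infty)$ is a non-decreasing, right continuous function with $\psi(0)=0$ and, for some constant $C_1>0$, $\psi(2r)/\psi(r)\le C_1$ for all $r\in(0,\delta_0/2)$. Moreover: (C1) there is a constant $C_2>0$ such that $\mathsf{E}[(X_0(x+h)-X_0(x))^2]\le C_2\,\psi(|h|)$ for all $x,h\in\mathbb{R}^N$ with $|h|<\delta_0$; (C2) for all $T>0$, $X_0$ is strongly locally $\psi$-nondeterministic on $[-T,T]^N$, that is, there exist positive constants $C_3$ and $r_0$ (with $r_0<\delta_0$) such that for all $x\in[-T,T]^N$ and all $0<r\le\min\{|x|,r_0\}$,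 $$\mathrm{Var}\big(X_0(x)\,\big|\,X_0(y):\ y\in[-T,T]^N,\ r\le|x-y|\le r_0\big)\ge C_3\,\psi(r).$$ Indices. The upper and lower indices of $\psi$ at $0$ are $$\alpha^*=\inf\Big\{\beta\ge0:\lim_{r\to0}\frac{\psi(r)}{r^{2\beta}}=\infty\Big\}\ (\inf\emptyset=\infty),\qquad \alpha_*=\sup\Big\{\beta\ge0:\lim_{r\to0}\frac{\psi(r)}{r^{2\beta}}=0\Big\}.$$ *)

(* Defs.v *)
From HB Require Import structures.
From mathcomp Require Import all_boot all_order all_algebra.
From mathcomp Require Import all_classical all_reals all_analysis.

Set Implicit Arguments.
Unset Strict Implicit.
Unset Printing Implicit Defensive.

Import Order.TTheory GRing.Theory Num.Theory.
Import numFieldNormedType.Exports.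

Local Open Scope classical_set_scope.
Local Open Scope ring_scope.

(* R^n with its Borel sigma-algebra. *)
Definition borel_rV (R : realType) (n : nat) :=
  g_sigma_algebraType (@open 'rV[R]_n).

(* The library's norm on row vectors is the sup norm, hence this definition. *)
Definition enorm (R : realType) (n : nat) (x : 'rV[R]_n) : R :=
  Num.sqrt (\sum_(j < n) x 0 j ^+ 2).

Definition closed_cube (R : realType) (n : nat) (t : R) : set 'rV[R]_n :=
  [set x | forall j, - t <= x 0 j <= t].

Definition msupport (R : realType) (n : nat)
    (nu : set (borel_rV R n) -> \bar R) : set 'rV[R]_n :=
  [set x | forall U : set 'rV[R]_n, open U -> U x -> (0 < nu U)%E].

Section GeneralizedDimension.
Variables (R : realType) (n : nat).
Implicit Types (nu : set (borel_rV R n) -> \bar R) (r q : R).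

Definition mesh_cube r (i : 'rV[int]_n) : set 'rV[R]_n :=
  [set x | forall j, (i 0 j)%:~R * r <= x 0 j < ((i 0 j)%:~R + 1) * r].

Definition mesh_sum nu r q : \bar R :=
  \esum_(i in [set: 'rV[int]_n]) (nu (mesh_cube r i) `^ q)%E.

(* For a nonzero finite measure of bounded support, q > 0 and r > 0, mesh_sum
   is a positive real number, so that fine and ln are used at proper values. *)
Definition dim_quotient nu q r : \bar R :=
  (ln (fine (mesh_sum nu r q)) / ((q - 1) * ln r))%:E.

Definition lower_gen_dim nu q : \bar R := limf_einf (dim_quotient nu q) 0^'+.

Definition upper_gen_dim nu q : \bar R := limf_esup (dim_quotient nu q) 0^'+.

(* The generalized q-dimension of nu exists and equals D. *)
Definition has_gen_dim nu q (D : \bar R) : Prop :=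
  lower_gen_dim nu q = D /\ upper_gen_dim nu q = D.

End GeneralizedDimension.

Section Indices.
Variable R : realType.
Implicit Type psi : R -> R.

Definition upper_index psi : \bar R :=
  ereal_inf [set b%:E | b in
    [set b : R | 0 <= b /\ psi r / r `^ (2 * b) @[r --> 0^'+] --> +oo]].

Definition lower_index psi : \bar R :=
  ereal_sup [set b%:E | b in
    [set b : R | 0 <= b /\ psi r / r `^ (2 * b) @[r --> 0^'+] --> (0 : R)]].

End Indices.

Section Processes.
Context (R : realType) (dd : measure_display) (Omega : measurableType dd)
  (P : probability Omega R).

(* The law N(m, s^2) for s >= 0.  The degenerate case must be singled out since
   normal_prob m 0 is a junk value of the library. *)
Definition gaussian_law (m s : R) (B : set R) : \bar R :=
  if s == 0 then \d_m B else normal_prob m s B.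

Definition gaussian_rv (Z : Omega -> R) : Prop :=
  exists m s : R, 0 <= s /\
    forall B : set R, measurable B -> P (Z @^-1` B) = gaussian_law m s B.

(* A family is Gaussian if its finite linear combinations are. *)
Definition gaussian_process (I : Type) (Y : I -> {RV P >-> R}) : Prop :=
  forall (k : nat) (t : 'I_k -> I) (a : 'I_k -> R),
    gaussian_rv (fun w => \sum_(j < k) a j * Y (t j) w).

Definition sigma_gen (I : Type) (S : set I) (Y : I -> {RV P >-> R}) :
    set (set Omega) :=
  <<s [set A | exists (y : I) (B : set R),
        [/\ S y, measurable B & A = Y y @^-1` B]] >>.

(* Independence of the sigma-algebras generated by finitely many processes. *)
Definition independent_processes (I : Type) (k : nat)
    (Y : 'I_k -> I -> {RV P >-> R}) : Prop :=
  forall (J : {set 'I_k}) (A : 'I_k -> set Omega),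
    (forall i, i \in J -> sigma_gen setT (Y i) (A i)) ->
    P (\bigcap_(i in [set` J]) A i) = (\prod_(i in J) P (A i))%E.

(* W is a version of E[Z | G]. *)
Definition cond_exp_version (G : set (set Omega)) (Z W : Omega -> R) : Prop :=
  [/\ P.-integrable setT (EFin \o Z),
      P.-integrable setT (EFin \o W),
      forall B : set R, measurable B -> G (W @^-1` B)
    & forall A, G A ->
        (\int[P]_(w in A) (W w)%:E = \int[P]_(w in A) (Z w)%:E)%E].

(* V is a version of Var(Z | G) = E[(Z - E[Z | G])^2 | G]. *)
Definition cond_var_version (G : set (set Omega)) (Z V : Omega -> R) : Prop :=
  exists W : Omega -> R, cond_exp_version G Z W /\
    cond_exp_version G (fun w => (Z w - W w) ^+ 2) V.

Variable N : nat.

(* Since conditional variances are unique up to null sets, the inequality in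
   the nondeterminism condition is asserted a.s. for one version. *)
Definition strongly_locally_nondeterministic (X0 : 'rV[R]_N -> {RV P >-> R})
    (psi : R -> R) (delta0 t : R) : Prop :=
  exists C3 r0 : R, [/\ 0 < C3, 0 < r0, r0 < delta0 &
    forall (x : 'rV[R]_N) (r : R), closed_cube t x ->
      0 < r -> r <= Num.min (enorm x) r0 ->
      exists V : Omega -> R,
        cond_var_version
          (sigma_gen
            [set y | closed_cube t y /\ r <= enorm (x - y) <= r0] X0)
          (X0 x) V
        /\ {ae P, forall w, C3 * psi r <= V w}].

(* Only the values of psi on [0, delta0[ matter.  The positivity of psi r in
   the doubling clause makes the quotient meaningful. *)
Definition condition_C (X0 : 'rV[R]_N -> {RV P >-> R}) (psi : R -> R) : Prop :=
  exists2 delta0 : R, 0 < delta0 &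
  [/\ [/\ forall r, 0 <= r < delta0 -> 0 <= psi r,
          forall r s, 0 <= r -> r <= s -> s < delta0 -> psi r <= psi s,
          forall r, 0 <= r < delta0 -> psi s @[s --> r^'+] --> psi r,
          psi 0 = 0
        & exists2 C1 : R, 0 < C1 & forall r, 0 < r < delta0 / 2 ->
            0 < psi r /\ psi (2 * r) / psi r <= C1],
      exists2 C2 : R, 0 < C2 & forall x h : 'rV[R]_N, enorm h < delta0 ->
        ('E_P[fun w => ((X0 (x + h) w - X0 x w) ^+ 2)%R]
          <= (C2 * psi (enorm h))%R%:E)%E
    & forall t : R, 0 < t ->
        strongly_locally_nondeterministic X0 psi delta0 t].

End Processes.

(* Equality of the finite-dimensional distributions of two processes, possibly
   living on different probability spaces. *)
Definition same_law (R : realType) (d1 d2 : measure_display)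
    (O1 : measurableType d1) (O2 : measurableType d2)
    (P1 : probability O1 R) (P2 : probability O2 R) (I : Type)
    (Y1 : I -> {RV P1 >-> R}) (Y2 : I -> {RV P2 >-> R}) : Prop :=
  forall (k : nat) (t : 'I_k -> I) (B : set (borel_rV R k)), measurable B ->
    P1 [set w | B (\row_j Y1 (t j) w)] = P2 [set w | B (\row_j Y2 (t j) w)].

Definition sample_path (R : realType) (dd : measure_display)
    (Omega : measurableType dd) (P : probability Omega R) (N d : nat)
    (X : 'I_d -> 'rV[R]_N -> {RV P >-> R}) (w : Omega) :
    'rV[R]_N -> 'rV[R]_d :=
  fun x => \row_i X i x w.

(* The set function mu_X(w); a Borel measure when the path of w is continuous. *)
Definition image_measure (R : realType) (dd : measure_display)
    (Omega : measurableType dd) (P : probability Omega R) (N d : nat)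
    (X : 'I_d -> 'rV[R]_N -> {RV P >-> R})
    (mu : probability (borel_rV R N) R) (w : Omega) :
    set (borel_rV R d) -> \bar R :=
  pushforward mu (sample_path X w : borel_rV R N -> borel_rV R d).

(* Main.v *)
(* For a measure nu write B(nu, r) for the integral of nu(B(x, r))^(q-1) against nu,
   with balls in the sup norm; B(nu, r) is comparable to the mesh sum M_r(q).

   Upper bounds.  If psi(r) <= r^(2b) at the scale r and b' < b, then by Gaussian tails
   and Fubini the mass of the pairs (x, y) with |x - y| < r and |X(x) - X(y)| >= r^b'
   is almost surely smaller than any power of r along dyadic scales.  Hence
   B(mu_X, r^b') >= c B(mu, r); no modulus of continuity is needed.  This holds at all
   small scales for b < alpha_*, and at arbitrarily small scales for b < alpha^*.

   Lower bounds.  For a > alpha^*, nondeterminism bounds the distance in L^2 of X_0(y)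
   from the span of finitely many X_0(z) by c |y - z|^a, for the nearest z.  Orthogonalizing,
   the probability that X(y_1), ..., X(y_k) all lie within r of X(x) is at most
   C^k times the product over j of the sum of phi(y_j, z) over the z preceding y_j,
   where phi(y, z) = min(1, r / (c |y - z|^a))^d.  Integrating over the y_j, the k-th
   moment of mu{y : |X(y) - X(x)| < r} is at most C_k G^k wherever the potential of phi
   is at most G.  Cutting R^N into Whitney cells around the origin and into level sets of
   the potential, O(log(1/r)^2) pieces, one gets E B(mu_X, r) <= r^((q-1)t) up to
   logarithms for t < min(d, D/a), and one sums over dyadic r. *)

Require Import Defs.
From HB Require Import structures.
From mathcomp Require Import all_boot all_order all_algebra.
From mathcomp Require Import all_classical all_reals all_analysis.
From mathcomp Require Import measurable_realfun.
From mathcomp Require Import ring lra zify.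

Set Implicit Arguments.
Unset Strict Implicit.
Unset Printing Implicit Defensive.

Import Order.TTheory GRing.Theory Num.Theory.
Import numFieldNormedType.Exports.

Local Open Scope classical_set_scope.
Local Open Scope ring_scope.

(** Gaussian densities are avoided, since covariances may be degenerate: small ball events are
    compared with Gaussian weights, whose means need only characteristic functions and the algebra
    of Gram-Schmidt. The conditional variance comes with a conditional expectation that is merely
    integrable, and its lower bound has to be converted into a distance in L^2 from linear spans.
    The moment bounds need the potential to be bounded at every point of the set that is integrated
    over, because a new point of a chain may be attached to any earlier one; in general the
    potential has no useful uniform bound, which forces the level sets. For the upper bounds, good
    scales of psi and good scales of mu can be used together only when one of the two families
    contains all small scales: equality of the indices provides this on the side of psi in (i),
    existence of D on the side of mu in (ii). The exceptional null sets depend on the exponents, so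
    that these run through sequences before a limit is taken. *)

Section LevelSets.
Context (R : realType) (d : measure_display) (T : measurableType d) (f : T -> R).
Hypothesis mf : measurable_fun setT f.

Lemma measurable_lt_cst r : measurable [set x | f x < r].
Proof.
rewrite (_ : [set x | _] = f @^-1` `]-oo, r[%classic).
  by rewrite -[X in measurable X]setTI; exact: mf.
by apply/seteqP; split => x /=; rewrite in_itv.
Qed.

Lemma measurable_le_cst r : measurable [set x | f x <= r].
Proof.
rewrite (_ : [set x | _] = f @^-1` `]-oo, r]%classic).
  by rewrite -[X in measurable X]setTI; exact: mf.
by apply/seteqP; split => x /=; rewrite in_itv.
Qed.

Lemma measurable_gt_cst r : measurable [set x | r < f x].
Proof.
rewrite (_ : [set x | _] = f @^-1` `]r, +oo[%classic).
  by rewrite -[X in measurable X]setTI; exact: mf.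
by apply/seteqP; split => x /=; rewrite in_itv/= andbT.
Qed.

End LevelSets.

(** * Normal laws *)

Section NormalFacts.
Context (R : realType).
Notation leb := (@lebesgue_measure R).

Lemma ge0_integral_normal_prob (m s : R) (f : R -> \bar R) :
  (forall x, 0 <= f x)%E -> measurable_fun [set: R] f ->
  (\int[normal_prob m s]_x f x = \int[leb]_x (f x * (normal_pdf m s x)%:E))%E.
Proof.
move=> f0 mf.
have dom := normal_prob_dominates m s.
rewrite -(Radon_Nikodym_SigmaFinite.change_of_variables dom)//.
apply: ae_eq_integral => //.
- apply: emeasurable_funM => //.
  exact: measurable_int (Radon_Nikodym_SigmaFinite.f_integrable dom).
- apply: emeasurable_funM => //; apply/measurable_EFinP.
  exact: measurable_normal_pdf.
- apply: ae_eqe_mul2l; apply: integral_ae_eq => //.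
  + exact: Radon_Nikodym_SigmaFinite.f_integrable.
  + by apply/measurable_EFinP; exact: measurable_normal_pdf.
  + move=> A _ mA.
    by rewrite -(Radon_Nikodym_SigmaFinite.f_integral dom).
Qed.

Lemma cvg_inv_nat (C : R) : C / n.+1%:R @[n --> \oo] --> (0 : R).
Proof.
rewrite -[X in _ --> X](mulr0 C); apply: cvgM; first exact: cvg_cst.
exact: cvg_harmonic.
Qed.

(** The integral over [m - n, m + n] is F (m + n) - F (m - n), which the last hypothesis bounds by 2
    C / n. In this form the lemma serves as integration by parts against the normal density. *)
Lemma integral_derive_eq0 (F f : R -> R) (m C : R) :
  (forall x, is_derive x (1 : R) F (f x)) -> continuous f ->
  leb.-integrable setT (EFin \o f) ->
  (forall x, `|(x - m) * F x| <= C) ->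
  (\int[leb]_x (f x)%:E = 0)%E.
Proof.
move=> dF cf intf FC.
pose I n := `[m - n.+1%:R, m + n.+1%:R]%classic : set R.
have FTC n : (\int[leb]_(x in I n) (f x)%:E = (F (m + n.+1%:R))%:E - (F (m - n.+1%:R))%:E)%E.
  have n0 : 0 < n.+1%:R :> R by rewrite ltr0n.
  apply: continuous_FTC2.
  - lra.
  - exact: continuous_subspaceT.
  - split => [x _||]; first exact: (@ex_derive _ _ _ _ _ _ _ (dF x)).
    + apply: cvg_at_right_filter.
      by apply/differentiable_continuous/derivable1_diffP; exact: (@ex_derive _ _ _ _ _ _ _ (dF _)).
    + apply: cvg_at_left_filter.
      by apply/differentiable_continuous/derivable1_diffP; exact: (@ex_derive _ _ _ _ _ _ _ (dF _)).
  - by move=> x _; rewrite derive1E; exact: (@derive_val _ _ _ _ _ _ _ (dF x)).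
have mf : measurable_fun setT (EFin \o f) by exact: measurable_int intf.
have lim1 : (\int[leb]_(x in I n) (f x)%:E)%E @[n --> \oo] --> (\int[leb]_x (f x)%:E)%E.
  under eq_fun do rewrite integral_mkcond.
  apply: (@dominated_cvg _ _ _ leb setT measurableT _ (EFin \o f) (fun x => `|(f x)%:E|%E)) => //.
  - move=> n; apply/(measurable_restrictT _ _).1 => //.
      exact: measurable_itv.
    exact: measurable_funTS.
  - move=> x _ /=; apply: cvg_near_cst.
    near=> n.
    rewrite patchE ifT// inE /I/= in_itv/=.
    have : `|x - m| <= n.+1%:R.
      have : `|x - m| <= n%:R by near: n; exact: nbhs_infty_ger.
      by move=> /le_trans; apply; rewrite ler_nat.
    rewrite ler_norml => /andP[? ?]; apply/andP; split; lra.
  - exact: integrable_abse.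
  - move=> n x _; rewrite patchE; case: ifP => //=.
    by rewrite normr0 lee_fin.
have lim2 : (\int[leb]_(x in I n) (f x)%:E)%E @[n --> \oo] --> 0%E.
  under eq_fun do rewrite FTC -EFinB.
  apply: cvg_EFin; first exact: nearW.
  have -> : (fine \o (fun n => (F (m + n.+1%:R) - F (m - n.+1%:R))%:E)) =
     (fun n => (F (m + n.+1%:R) - F (m - n.+1%:R))) by [].
  apply: norm_cvg0.
  apply: (@squeeze_cvgr _ _ _ _ (cst 0) (fun n => (2 * C) / n.+1%:R)).
  - apply: nearW => n; rewrite normr_ge0/= ler_pdivlMr ?ltr0n//.
    have h1 := FC (m + n.+1%:R); have h2 := FC (m - n.+1%:R).
    rewrite addrAC subrr add0r normrM (ger0_norm (ler0n R n.+1)) in h1.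
    rewrite addrAC subrr add0r normrM normrN (ger0_norm (ler0n R n.+1)) in h2.
    have := ler_normB (F (m + n.+1%:R)) (F (m - n.+1%:R)).
    move/(ler_wpM2l (ler0n R n.+1)); lra.
  - exact: cvg_cst.
  - exact: cvg_inv_nat.
exact: (cvg_unique _ lim1 lim2).
Unshelve. all: by end_near. Qed.

End NormalFacts.

Section NormalMoments.
Context (R : realType).
Notation leb := (@lebesgue_measure R).

Lemma integral_normal_prob (m s : R) (f : R -> R) :
  measurable_fun [set: R] f ->
  leb.-integrable setT (fun x => (f x * normal_pdf m s x)%:E) ->
  (normal_prob m s).-integrable setT (EFin \o f) /\
  (\int[normal_prob m s]_x (f x)%:E = \int[leb]_x (f x * normal_pdf m s x)%:E)%E.
Proof.
move=> mf intf.
have mef : measurable_fun [set: R] (EFin \o f) by exact/measurable_EFinP.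
have p0 x : 0 <= normal_pdf m s x by exact: normal_pdf_ge0.
split.
  apply/integrableP; split => //.
  rewrite ge0_integral_normal_prob//; last exact: measurableT_comp.
  move/integrableP : intf => [_]; apply: le_lt_trans.
  rewrite le_eqVlt; apply/orP; left; apply/eqP; apply: eq_integral => x _.
  by rewrite /= normrM (ger0_norm (p0 x)).
rewrite integralE [in RHS]integralE; congr (_ - _)%E.
  rewrite ge0_integral_normal_prob//; last exact: measurable_funepos.
  by apply: eq_integral => x _; rewrite !funeposE -!EFin_max -EFinM maxr_pMl ?p0// mul0r.
rewrite ge0_integral_normal_prob//; last exact: measurable_funeneg.
by apply: eq_integral => x _; rewrite !funenegE -!EFinN -!EFin_max -EFinM maxr_pMl ?p0// mul0r mulNr.
Qed.

Lemma normal_pdf_gt0E (m s x : R) : 0 < s ->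
  normal_pdf m s x = normal_peak s * normal_fun m s x.
Proof. by move=> s0; rewrite normal_pdfE ?gt_eqF. Qed.

Lemma normal_peak_sqrt2 (s : R) : 0 < s ->
  normal_peak s = Num.sqrt 2 * normal_peak (Num.sqrt 2 * s).
Proof.
move=> s0; rewrite /normal_peak.
have -> : (Num.sqrt 2 * s) ^+ 2 * pi *+ 2 = 2 * (s ^+ 2 * pi *+ 2).
  by rewrite exprMn sqr_sqrtr//; ring.
rewrite (sqrtrM _ (ler0n _ 2)).
by rewrite invfM mulrA divff ?mul1r// gt_eqF// sqrtr_gt0.
Qed.

Lemma normal_fun_sqrt2 (m s x : R) : 0 < s ->
  normal_fun m s x = expR (- ((x - m) ^+ 2 / (4 * s ^+ 2))) * normal_fun m (Num.sqrt 2 * s) x.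
Proof.
move=> s0; rewrite /normal_fun -expRD exprMn sqr_sqrtr//; congr expR.
by field; rewrite gt_eqF.
Qed.

(** Half of the exponent is split off, and the other half is a normal density of variance 2 s^2.
    Second moments and tails then follow by bounding the split factor pointwise, the remaining
    density having mass one. *)
Lemma normal_pdf_sqrt2 (m s x : R) : 0 < s ->
  normal_pdf m s x = Num.sqrt 2 * expR (- ((x - m) ^+ 2 / (4 * s ^+ 2))) * normal_pdf m (Num.sqrt 2 * s) x.
Proof.
move=> s0; have s20 : 0 < Num.sqrt 2 * s by rewrite mulr_gt0.
rewrite !normal_pdf_gt0E// normal_fun_sqrt2// (normal_peak_sqrt2 s0); ring.
Qed.

(** This is u exp(- u) <= 1 for u = (x - m)^2 / (4 s^2), with exp(- u) the half of the exponent that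
    was split off. *)
Lemma sqr_normal_pdf_le (m s x : R) : 0 < s ->
  (x - m) ^+ 2 * normal_pdf m s x <= 4 * s ^+ 2 * Num.sqrt 2 * normal_pdf m (Num.sqrt 2 * s) x.
Proof.
move=> s0; rewrite normal_pdf_sqrt2//.
have -> : (x - m) ^+ 2 * (Num.sqrt 2 * expR (- ((x - m) ^+ 2 / (4 * s ^+ 2))) *
   normal_pdf m (Num.sqrt 2 * s) x) =
  ((x - m) ^+ 2 * expR (- ((x - m) ^+ 2 / (4 * s ^+ 2)))) * (Num.sqrt 2 * normal_pdf m (Num.sqrt 2 * s) x) by ring.
rewrite -(mulrA (4 * _)); apply: ler_wpM2r.
  by rewrite mulr_ge0// normal_pdf_ge0.
have s2 : 0 < 4 * s ^+ 2 by rewrite mulr_gt0 ?exprn_gt0.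
rewrite expRN ler_pdivrMr ?expR_gt0//.
have := expR_ge1Dx ((x - m) ^+ 2 / (4 * s ^+ 2)).
move=> /(ler_wpM2l (ltW s2)).
rewrite mulrDr mulr1 (mulrC (4 * s ^+ 2) (_ / _)) divfK ?gt_eqF// => h.
by apply: le_trans h; rewrite lerDr ltW.
Qed.

Lemma integrable_sqr_normal_pdf (m s : R) : 0 < s ->
  leb.-integrable setT (fun x => ((x - m) ^+ 2 * normal_pdf m s x)%:E).
Proof.
move=> s0.
have ig : leb.-integrable setT (fun x => (4 * s ^+ 2 * Num.sqrt 2 * normal_pdf m (Num.sqrt 2 * s) x)%:E).
  under eq_fun do rewrite EFinM.
  by apply: integrableZl => //; exact: integrable_normal_pdf.
apply: le_integrable ig => //.
- apply/measurable_EFinP; apply: measurable_funM.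
    by apply: measurable_funX; exact: measurable_funB.
  exact: measurable_normal_pdf.
- move=> x _; rewrite /= lee_fin !ger0_norm//.
  + exact: sqr_normal_pdf_le.
  + apply: mulr_ge0; last exact: normal_pdf_ge0.
    by apply: mulr_ge0 (sqrtr_ge0 _); rewrite mulr_ge0 ?sqr_ge0.
  + by rewrite mulr_ge0 ?sqr_ge0 ?normal_pdf_ge0.
Qed.

Lemma norm_mul_le_1_sqr (a p : R) : 0 <= p -> `|a * p| <= `|p + a ^+ 2 * p|.
Proof.
move=> p0; rewrite normrM (ger0_norm p0) [leRHS]ger0_norm; last first.
  by apply: addr_ge0 => //; apply: mulr_ge0 => //; exact: sqr_ge0.
rewrite -[X in X + _]mul1r -mulrDl; apply: ler_wpM2r => //.
rewrite -real_normK ?num_real//; have := normr_ge0 a; nra.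
Qed.

Lemma integrable_sub_normal_pdf (m s : R) : 0 < s ->
  leb.-integrable setT (fun x => ((x - m) * normal_pdf m s x)%:E).
Proof.
move=> s0.
have ig : leb.-integrable setT (fun x => (normal_pdf m s x + (x - m) ^+ 2 * normal_pdf m s x)%:E).
  under eq_fun do rewrite EFinD.
  apply: integrableD => //; [exact: integrable_normal_pdf|exact: integrable_sqr_normal_pdf].
apply: le_integrable ig => //.
- apply/measurable_EFinP; apply: measurable_funM.
    exact: measurable_funB.
  exact: measurable_normal_pdf.
- by move=> x _; rewrite /= lee_fin; apply: norm_mul_le_1_sqr; exact: normal_pdf_ge0.
Qed.

Lemma is_derive_normal_pdf (m s x : R) : 0 < s ->
  is_derive x (1 : R) (normal_pdf m s) (- ((x - m) / s ^+ 2) * normal_pdf m s x).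
Proof.
move=> s0.
have -> : normal_pdf m s = (fun x => normal_peak s * expR (- (x - m) ^+ 2 / (s ^+ 2 *+ 2))).
  by apply/funext => y; rewrite normal_pdf_gt0E.
apply: is_derive_eq; rewrite /GRing.scale/=; field.
by rewrite gt_eqF.
Qed.

Lemma cont_normal_pdf (m s : R) : 0 < s -> continuous (normal_pdf m s).
Proof. by move=> s0; apply: continuous_normal_pdf; rewrite gt_eqF. Qed.

Lemma normal_pdf_sqr_ub (m s x : R) : 0 < s ->
  (x - m) ^+ 2 * normal_pdf m s x <= 4 * s ^+ 2 * Num.sqrt 2 * normal_peak (Num.sqrt 2 * s).
Proof.
move=> s0; apply: (le_trans (sqr_normal_pdf_le _ _ s0)).
apply: ler_wpM2l; first by apply: mulr_ge0 (sqrtr_ge0 _); rewrite mulr_ge0 ?sqr_ge0.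
by apply: normal_pdf_ub; rewrite gt_eqF// mulr_gt0.
Qed.

End NormalMoments.

Section NormalTransforms.
Context (R : realType).
Notation leb := (@lebesgue_measure R).

Lemma mul_bound_of_sqr (a p A B : R) : 0 <= p -> p <= A -> a ^+ 2 * p <= B -> `|a * p| <= A + B.
Proof.
move=> p0 pA apB; apply: (le_trans (norm_mul_le_1_sqr a p0)).
rewrite ger0_norm; first exact: lerD.
by apply: addr_ge0 => //; apply: mulr_ge0 => //; exact: sqr_ge0.
Qed.

Lemma mean_normal_prob (m s : R) : 0 < s ->
  (normal_prob m s).-integrable setT (fun x => x%:E) /\
  (\int[normal_prob m s]_x x%:E = m%:E)%E.
Proof.
move=> s0.
have mid : measurable_fun [set: R] (fun x : R => x) by exact: measurable_id.
have i1 := integrable_sub_normal_pdf m s0.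
have i0 := integrable_normal_pdf m s.
have i2 : leb.-integrable setT (fun x => ((m * normal_pdf m s x))%:E).
  by under eq_fun do rewrite EFinM; apply: integrableZl.
have E0 : (\int[leb]_x ((x - m) * normal_pdf m s x)%:E = 0)%E.
  have dF x : is_derive x (1 : R) (fun x => - s ^+ 2 * normal_pdf m s x) ((x - m) * normal_pdf m s x).
    have h := is_derive_normal_pdf m x s0.
    apply: is_derive_eq; rewrite /GRing.scale/=; field.
    by rewrite gt_eqF.
  apply: (integral_derive_eq0 dF _ i1 (m := m)).
    move=> x; apply: cvgM; last exact: cont_normal_pdf.
    by apply: cvgB; [exact: cvg_id|exact: cvg_cst].
  move=> x; rewrite mulrCA normrM.
  apply: ler_wpM2l => //; apply: mul_bound_of_sqr.
  - exact: normal_pdf_ge0.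
  - by apply: normal_pdf_ub; rewrite gt_eqF.
  - exact: normal_pdf_sqr_ub.
have i3 : leb.-integrable setT (fun x => (x * normal_pdf m s x)%:E).
  have -> : (fun x : R => (x * normal_pdf m s x)%:E) =
    (fun x => ((x - m) * normal_pdf m s x)%:E + (m * normal_pdf m s x)%:E)%E.
    by apply/funext => x; rewrite -EFinD; congr EFin; ring.
  exact: integrableD.
have [ii ->] := integral_normal_prob mid i3.
split => //.
have -> : (\int[leb]_x (x * normal_pdf m s x)%:E)%E =
    (\int[leb]_x (((x - m) * normal_pdf m s x)%:E + (m * normal_pdf m s x)%:E))%E.
  by apply: eq_integral => x _; rewrite -EFinD; congr EFin; ring.
rewrite integralD// E0 add0e.
under eq_integral do rewrite EFinM.
by rewrite integralZl// integral_normal_pdf mule1.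
Qed.

Lemma second_moment_normal_prob (s : R) : 0 < s ->
  (\int[normal_prob 0 s]_x (x ^+ 2)%:E = (s ^+ 2)%:E)%E.
Proof.
move=> s0.
have i0 := integrable_normal_pdf 0 s.
have i2 := integrable_sqr_normal_pdf 0 s0.
have i2' : leb.-integrable setT (fun x => (x ^+ 2 * normal_pdf 0 s x)%:E).
  by under eq_fun => x do rewrite -[X in X ^+ 2]subr0.
have i3 : leb.-integrable setT (fun x => ((s ^+ 2 * normal_pdf 0 s x))%:E).
  by under eq_fun do rewrite EFinM; apply: integrableZl.
have iD : leb.-integrable setT (fun x => (s ^+ 2 * normal_pdf 0 s x - x ^+ 2 * normal_pdf 0 s x)%:E).
  by under eq_fun do rewrite EFinB; apply: integrableB.
have mX : measurable_fun [set: R] (fun x : R => x ^+ 2) by apply: measurable_funX.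
have [_ ->] := integral_normal_prob mX i2'.
have dF x : is_derive x (1 : R) (fun x => s ^+ 2 * (x * normal_pdf 0 s x))
   (s ^+ 2 * normal_pdf 0 s x - x ^+ 2 * normal_pdf 0 s x).
  have h := is_derive_normal_pdf 0 x s0.
  apply: is_derive_eq; rewrite /GRing.scale/=; field.
  by rewrite gt_eqF.
have E0 : (\int[leb]_x (s ^+ 2 * normal_pdf 0 s x - x ^+ 2 * normal_pdf 0 s x)%:E = 0)%E.
  apply: (integral_derive_eq0 dF _ iD (m := 0) (C := s ^+ 2 * (4 * s ^+ 2 * Num.sqrt 2 * normal_peak (Num.sqrt 2 * s)))).
    move=> x; apply: cvgB; apply: cvgM; try exact: cont_normal_pdf.
      exact: cvg_cst.
    exact: exprn_continuous.
  move=> x; rewrite mulrCA normrM ger0_norm ?sqr_ge0//.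
  apply: ler_wpM2l; first exact: sqr_ge0.
  have -> : (x - 0) * (x * normal_pdf 0 s x) = (x - 0) ^+ 2 * normal_pdf 0 s x.
    by rewrite subr0; ring.
  rewrite ger0_norm; first exact: normal_pdf_sqr_ub.
  by apply: mulr_ge0; [exact: sqr_ge0|exact: normal_pdf_ge0].
move: E0; under eq_integral do rewrite EFinB.
rewrite integralB//.
under eq_integral do rewrite EFinM.
rewrite integralZl// integral_normal_pdf mule1.
have := integrable_fin_num measurableT i2'.
by case: (\int[leb]_x _)%E => // v _ [] /eqP; rewrite subr_eq0 => /eqP ->.
Qed.

Lemma tail_normal_prob (s r : R) : 0 < s ->
  0 <= r ->
  (normal_prob 0 s [set x : R | (r < `|x|)%R] <= (Num.sqrt 2 * expR (- (r ^+ 2 / (4 * s ^+ 2))))%:E)%E.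
Proof.
move=> s0 r0.
have mS : measurable ([set x : R | (r < `|x|)%R] : set R).
  rewrite (_ : [set x : R | (r < `|x|)%R] = (fun x : R => `|x|) @^-1` `]r, +oo[%classic); last first.
    by apply/seteqP; split => x /=; rewrite in_itv/= andbT.
  rewrite -[X in measurable X]setTI; exact: (@normr_measurable R setT).
rewrite /normal_prob.
apply: (@le_trans _ _ (\int[leb]_(x in [set x : R | (r < `|x|)%R]) ((Num.sqrt 2 * expR (- (r ^+ 2 / (4 * s ^+ 2))))%:E * (normal_pdf 0 (Num.sqrt 2 * s) x)%:E))%E).
  apply: ge0_le_integral => //=.
  - by move=> x _; rewrite lee_fin normal_pdf_ge0.
  - by apply/measurable_EFinP/measurable_funTS; exact: measurable_normal_pdf.
  - apply/measurable_EFinP/measurable_funTS/measurable_funM => //.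
    exact: measurable_normal_pdf.
  - move=> x rx; rewrite -EFinM lee_fin normal_pdf_sqrt2//.
    apply: ler_wpM2r; first exact: normal_pdf_ge0.
    apply: ler_wpM2l => //; rewrite ler_expR lerN2.
    apply: ler_wpM2r; first by rewrite invr_ge0 mulr_ge0 ?sqr_ge0.
    by rewrite subr0 -(real_normK (num_real x)) lerXn2r ?nnegrE// ltW.
rewrite ge0_integralZl//; first last.
- by move=> x _; rewrite lee_fin normal_pdf_ge0.
- by apply/measurable_EFinP/measurable_funTS; exact: measurable_normal_pdf.
rewrite -[leRHS]mule1; apply: lee_wpmul2l; first by rewrite lee_fin mulr_ge0// expR_ge0.
rewrite -(integral_normal_pdf 0 (Num.sqrt 2 * s)).
apply: ge0_subset_integral => //.
- by apply/measurable_EFinP; exact: measurable_normal_pdf.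
- by move=> x _; rewrite lee_fin normal_pdf_ge0.
Qed.
End NormalTransforms.

Section NormalCos.
Context (R : realType) (s : R) (s0 : 0 < s).
Notation leb := (@lebesgue_measure R).
Notation p := (normal_pdf 0 s).

Lemma integrable_bounded_normal_pdf (g : R -> R) (f : R -> R) :
  leb.-integrable setT (fun x => (f x)%:E) ->
  measurable_fun [set: R] g -> (forall x, `|g x| <= 1) ->
  leb.-integrable setT (fun x => (g x * f x)%:E).
Proof.
move=> iF mg g1.
have mf : measurable_fun [set: R] f.
  by apply/measurable_EFinP; exact: measurable_int iF.
apply: le_integrable iF => //.
  by apply/measurable_EFinP/measurable_funM.
move=> x _; rewrite /= lee_fin normrM -[leRHS]mul1r.
by apply: ler_wpM2r.
Qed.

Lemma measurable_cos_mul (t : R) : measurable_fun [set: R] (fun x => cos (t * x)).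
Proof.
apply: continuous_measurable_fun => x; apply: continuous_comp; last exact: continuous_cos.
by apply: cvgM; [exact: cvg_cst|exact: cvg_id].
Qed.

Lemma measurable_sin_mul (t : R) : measurable_fun [set: R] (fun x => sin (t * x)).
Proof.
apply: continuous_measurable_fun => x; apply: continuous_comp; last exact: continuous_sin.
by apply: cvgM; [exact: cvg_cst|exact: cvg_id].
Qed.

Lemma integrable_cos_pdf (t : R) : leb.-integrable setT (fun x => (cos (t * x) * p x)%:E).
Proof.
apply: integrable_bounded_normal_pdf; first exact: integrable_normal_pdf.
  exact: measurable_cos_mul.
by move=> x; rewrite ler_norml cos_geN1 cos_le1.
Qed.

Lemma integrable_id_pdf : leb.-integrable setT (fun x => (x * p x)%:E).
Proof.
have := integrable_sub_normal_pdf 0 s0.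
by under eq_fun => x do rewrite subr0.
Qed.

Lemma integrable_sin_pdf (t : R) : leb.-integrable setT (fun x => (sin (t * x) * (x * p x))%:E).
Proof.
apply: integrable_bounded_normal_pdf; first exact: integrable_id_pdf.
  exact: measurable_sin_mul.
by move=> x; rewrite ler_norml sin_geN1 sin_le1.
Qed.

(** The characteristic function of N(0, s^2), real because the law is symmetric. *)
Let c t := (\int[leb]_x (cos (t * x) * p x))%R.

Lemma is_derive_cos_pdf_t (t x : R) :
  is_derive t (1 : R) (fun t => cos (t * x) * p x) (- (sin (t * x) * (x * p x))).
Proof. by apply: is_derive_eq; rewrite /GRing.scale/=; ring. Qed.

(** Differentiation under the integral gives minus the integral of sin (t x) x p(x). Since x p(x) is
    the derivative of - s^2 p, an integration by parts, with primitive s^2 sin (t x) p(x), turns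
    this into - s^2 t c(t). *)
Lemma is_derive_c (t : R) : is_derive t (1 : R) c (- (s ^+ 2 * t * c t)).
Proof.
have d1 u x : partial1of2 (fun t x => cos (t * x) * p x) u x = - (sin (u * x) * (x * p x)).
  by rewrite partial1of2E; have := is_derive_cos_pdf_t u x => h; rewrite derive_val.
have It : `]t - 1, t + 1[%classic t by rewrite /= in_itv/=; apply/andP; split; lra.
have intf u : `]t - 1, t + 1[%classic u -> leb.-integrable setT (EFin \o (fun x => cos (u * x) * p x)).
  by move=> _; exact: integrable_cos_pdf.
have derf u y : `]t - 1, t + 1[%classic u -> [set: R] y -> derivable ((fun t x => cos (t * x) * p x)^~ y) u 1.
  by move=> _ _; exact: (@ex_derive _ _ _ _ _ _ _ (is_derive_cos_pdf_t u y)).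
have G0 y : 0 <= `|y * p y| by [].
have iG : leb.-integrable setT (EFin \o (fun y => `|y * p y|)).
  by have := integrable_abse integrable_id_pdf.
have Gub u y : `]t - 1, t + 1[%classic u -> [set: R] y -> `|partial1of2 (fun t x => cos (t * x) * p x) u y| <= `|y * p y|.
  move=> _ _; rewrite d1 normrN normrM -[leRHS]mul1r; apply: ler_wpM2r => //.
  by rewrite ler_norml sin_geN1 sin_le1.
have dc := derivable_under_integral measurableT It intf derf G0 iG Gub.
have ec := differentiation_under_integral measurableT It intf derf G0 iG Gub.
apply: DeriveDef => //.
rewrite -derive1E [LHS]ec.
rewrite (_ : (\int[leb]_(y in setT) _)%R = (\int[leb]_y (- (sin (t * y) * (y * p y))))%R); last first.
  by apply: eq_Rintegral => y _; rewrite d1.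
have i1 := integrable_sin_pdf t.
have i2 : leb.-integrable setT (fun x => (s ^+ 2 * t * (cos (t * x) * p x))%:E).
  by under eq_fun do rewrite EFinM; apply: integrableZl => //; exact: integrable_cos_pdf.
have iD : leb.-integrable setT (fun x => (s ^+ 2 * t * (cos (t * x) * p x) - sin (t * x) * (x * p x))%:E).
  by under eq_fun do rewrite EFinB; apply: integrableB.
have dF x : is_derive x (1 : R) (fun x => s ^+ 2 * (sin (t * x) * p x))
    (s ^+ 2 * t * (cos (t * x) * p x) - sin (t * x) * (x * p x)).
  have h := is_derive_normal_pdf 0 x s0.
  apply: is_derive_eq; rewrite /GRing.scale/=; field.
  by rewrite gt_eqF.
have E0 : (\int[leb]_x (s ^+ 2 * t * (cos (t * x) * p x) - sin (t * x) * (x * p x))%:E = 0)%E.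
  have cp := cont_normal_pdf (m := 0) s0.
  have ct : continuous (fun x : R => t * x).
    by move=> x; apply: cvgM; [exact: cvg_cst|exact: cvg_id].
  have ccos : continuous (fun x : R => cos (t * x)).
    by move=> x; apply: continuous_comp; [exact: ct|exact: continuous_cos].
  have csin : continuous (fun x : R => sin (t * x)).
    by move=> x; apply: continuous_comp; [exact: ct|exact: continuous_sin].
  apply: (integral_derive_eq0 dF _ iD (m := 0)
    (C := s ^+ 2 * (normal_peak s + 4 * s ^+ 2 * Num.sqrt 2 * normal_peak (Num.sqrt 2 * s)))).
    move=> x; apply: cvgB.
      apply: cvgM; first exact: cvg_cst.
      by apply: cvgM; [exact: ccos|exact: cp].
    apply: cvgM; first exact: csin.
    by apply: cvgM; [exact: cvg_id|exact: cp].
  move=> x; rewrite mulrCA normrM ger0_norm ?sqr_ge0//.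
  apply: ler_wpM2l; first exact: sqr_ge0.
  rewrite mulrCA normrM -[leRHS]mul1r; apply: ler_pM => //.
    by rewrite ler_norml sin_geN1 sin_le1.
  apply: mul_bound_of_sqr.
  - exact: normal_pdf_ge0.
  - by apply: normal_pdf_ub; rewrite gt_eqF.
  - exact: normal_pdf_sqr_ub.
have : (\int[leb]_x (s ^+ 2 * t * (cos (t * x) * p x) - sin (t * x) * (x * p x)) = 0)%R.
  by rewrite /Rintegral E0.
rewrite RintegralB// RintegralZl//; last exact: integrable_cos_pdf.
move=> /eqP; rewrite subr_eq0 => /eqP e.
rewrite -/(c t) in e; rewrite e.
rewrite -mulN1r -RintegralZl//.
by apply: eq_Rintegral => y _; rewrite mulN1r.
Qed.

Lemma cos_normal_pdf (t : R) : c t = expR (- (s ^+ 2 * t ^+ 2 / 2)).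
Proof.
pose h t := c t * expR (s ^+ 2 * t ^+ 2 / 2).
have dh x : is_derive x (1 : R) h 0.
  have dc := is_derive_c x.
  by apply: is_derive_eq; rewrite /GRing.scale/=; field.
have := is_derive_0_is_cst t 0 dh.
rewrite /h expr0n/= mulr0 mul0r expR0 mulr1 expRN => e.
have -> : c t = c 0 / expR (s ^+ 2 * t ^+ 2 / 2) by rewrite -e mulfK// gt_eqF// expR_gt0.
suff -> : c 0 = 1 by rewrite mul1r.
rewrite /c /Rintegral (_ : (\int[leb]_x _)%E = 1%E)//.
rewrite -(integral_normal_pdf 0 s); apply: eq_integral => x _.
by rewrite mul0r cos0 mul1r.
Qed.

Lemma integral_cos_normal_prob (t : R) :
  (\int[normal_prob 0 s]_x (cos (t * x))%:E = (expR (- (s ^+ 2 * t ^+ 2 / 2)))%:E)%E.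
Proof.
have [_ ->] := integral_normal_prob (measurable_cos_mul t) (integrable_cos_pdf t).
have := cos_normal_pdf t; rewrite /c /Rintegral => <-.
by rewrite fineK//; apply: integrable_fin_num => //; exact: integrable_cos_pdf.
Qed.

End NormalCos.

Section GaussianRV.
Context (R : realType) (dd : measure_display) (Omega : measurableType dd)
  (P : probability Omega R).
Implicit Types Z : Omega -> R.

Lemma integral_law Z (Q : {measure set (measurableTypeR R) -> \bar R}) (f : R -> \bar R) :
  measurable_fun setT Z ->
  (forall B : set R, measurable B -> P (Z @^-1` B) = Q B) ->
  measurable_fun [set: R] f ->
  (\int[P]_w f (Z w) = \int[Q]_x f x)%E.
Proof.
move=> mZ lawZ mf.
have ge0 (g : R -> \bar R) : measurable_fun [set: R] g -> (forall x, 0 <= g x)%E ->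
    (\int[P]_w g (Z w) = \int[Q]_x g x)%E.
  move=> mg g0.
  have mZ' : measurable_fun setT (Z : Omega -> measurableTypeR R) by exact: mZ.
  pose mix := isMeasurableFun.Build _ _ _ _ (Z : Omega -> measurableTypeR R) mZ'.
  pose Zm : {mfun Omega >-> measurableTypeR R} := HB.pack (Z : Omega -> measurableTypeR R) mix.
  transitivity (\int[pushforward P Zm]_x g x)%E.
    by rewrite ge0_integral_pushforward.
  by apply: eq_measure_integral => A mA _; rewrite -lawZ.
rewrite integralE [RHS]integralE; congr (_ - _)%E.
  by rewrite -ge0//; [under eq_integral do rewrite (funepos_comp f Z)|exact: measurable_funepos].
by rewrite -ge0//; [under eq_integral do rewrite (funeneg_comp f Z)|exact: measurable_funeneg].
Qed.

(** All that is used later about a single centered Gaussian variable. The tail is stated for any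
    positive v above the variance, which covers the Dirac mass s = 0 and matches the upper bounds
    that are available for increments. *)
Lemma gaussian_rv_centered Z : measurable_fun setT Z -> gaussian_rv P Z ->
  (\int[P]_w (Z w)%:E = 0)%E ->
  exists s, [/\ 0 <= s, (\int[P]_w (Z w ^+ 2)%:E = (s ^+ 2)%:E)%E,
    (forall t : R, \int[P]_w (cos (t * Z w))%:E = (expR (- (s ^+ 2 * t ^+ 2 / 2)))%:E)%E &
    forall r v : R, 0 <= r -> 0 < v -> s ^+ 2 <= v ->
      (P [set w | (r < `|Z w|)%R] <= (Num.sqrt 2 * expR (- (r ^+ 2 / (4 * v))))%:E)%E].
Proof.
move=> mZ [m [s [s0 law]]] mean0.
have mid : measurable_fun [set: R] (fun x : R => x%:E).
  by apply/measurable_EFinP; exact: measurable_id.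
have msq : measurable_fun [set: R] (fun x : R => (x ^+ 2)%:E).
  by apply/measurable_EFinP; apply: measurable_funX.
have mcos t : measurable_fun [set: R] (fun x : R => (cos (t * x))%:E).
  by apply/measurable_EFinP; exact: measurable_cos_mul.
have mS (r : R) : measurable ([set x : R | r < `|x|] : set R).
  rewrite (_ : [set x : R | r < `|x|] = (fun x : R => `|x|) @^-1` `]r, +oo[%classic); last first.
    by apply/seteqP; split => x /=; rewrite in_itv/= andbT.
  rewrite -[X in measurable X]setTI; exact: (@normr_measurable R setT).
exists s; rewrite /gaussian_law in law; have [se0|sn0] := eqVneq s 0.
  rewrite se0 eqxx in law.
  pose D : {measure set (measurableTypeR R) -> \bar R} := dirac (m : measurableTypeR R).
  have dir (f : measurableTypeR R -> \bar R) : measurable_fun setT f -> (\int[D]_x f x = f m)%E.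
    by move=> mf; rewrite /D integral_dirac// diracT mul1e.
  have lawD (B : set R) : measurable B -> P (Z @^-1` B) = D B by exact: law.
  have m0 : m = 0.
    move: mean0; rewrite (@integral_law Z D (fun x => x%:E))//.
    by rewrite (dir _ mid) => -[].
  split => //.
  - rewrite (@integral_law Z D (fun x => (x ^+ 2)%:E))//.
    by rewrite (dir _ msq) m0 se0.
  - move=> t; rewrite (@integral_law Z D (fun x => (cos (t * x))%:E))//.
    by rewrite (dir _ (mcos t)) m0 se0 mulr0 cos0 expr0n/= !mul0r oppr0 expR0.
  - move=> r v r0 v0 _; rewrite (law _ (mS r)) m0 diracE memNset/=; last by rewrite normr0; apply/negP; rewrite -leNgt.
    by rewrite lee_fin mulr_ge0// expR_ge0.
rewrite (negbTE sn0) in law.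
have sp : 0 < s by rewrite lt_neqAle eq_sym sn0.
have m0 : m = 0.
  move: mean0; rewrite (@integral_law Z (normal_prob m s) (fun x => x%:E))//.
  by have [_ ->] := mean_normal_prob m sp => -[].
rewrite m0 in law.
split => //.
- rewrite (@integral_law Z (normal_prob 0 s) (fun x => (x ^+ 2)%:E))//.
  exact: second_moment_normal_prob.
- move=> t; rewrite (@integral_law Z (normal_prob 0 s) (fun x => (cos (t * x))%:E))//.
  exact: integral_cos_normal_prob.
- move=> r v r0 v0 sv; rewrite (law _ (mS r)); apply: le_trans (tail_normal_prob sp r0) _.
  rewrite lee_fin; apply: ler_wpM2l => //; rewrite ler_expR lerN2.
  apply: ler_wpM2l; first exact: sqr_ge0.
  by rewrite lef_pV2 ?posrE ?mulr_gt0 ?exprn_gt0// ler_wpM2l.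
Qed.

End GaussianRV.

(** * Small balls for Gaussian spaces *)

Section GaussianFactor.
Context (R : realType).
Notation leb := (@lebesgue_measure R).

(* min(1, v^(-1/2)) bounds E exp(- Z^2 / 2) for Z Gaussian of variance v, whatever
   its mean. *)
Definition gfac (v : R) : R := if v <= 1 then 1 else (Num.sqrt v)^-1.

Lemma gfac_ge0 v : 0 <= gfac v.
Proof. by rewrite /gfac; case: ifP => // _; rewrite invr_ge0. Qed.

Lemma gfac_le1 v : gfac v <= 1.
Proof.
rewrite /gfac; case: (leP v 1) => // v1; rewrite invf_le1 ?sqrtr_gt0; last by apply: lt_trans v1.
by rewrite -sqrtr1 ler_sqrt ?ltW// (lt_trans _ v1).
Qed.

Lemma gfac_le v v' : v <= v' -> gfac v' <= gfac v.
Proof.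
move=> vv'; rewrite {2}/gfac; case: (leP v 1) => v1; first exact: gfac_le1.
rewrite /gfac; case: (leP v' 1) => v'1; first lra.
by rewrite lef_pV2 ?posrE ?sqrtr_gt0 ?ler_sqrt//; lra.
Qed.

Lemma integrable_bounded d (T : measurableType d) (P : {finite_measure set T -> \bar R}) (f : T -> R) (M : R) :
  measurable_fun setT f -> (forall x, `|f x| <= M) ->
  P.-integrable setT (fun x => (f x)%:E).
Proof.
move=> mf fM.
have M0 (x : T) : 0 <= M by apply: le_trans (fM x).
have ic : P.-integrable setT (EFin \o cst M) by exact: finite_measure_integrable_cst.
apply: le_integrable ic => //.
  exact/measurable_EFinP.
by move=> x _; rewrite /= lee_fin [leRHS]ger0_norm// (M0 x).
Qed.

(** For E > 1, bounding the factor exp(- x^2 / 2) of the standard density by 1 leaves E^(-1/2) times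
    the density of N(- c, 1 / E), of mass one; for E <= 1 the integrand is at most 1. The shift c
    does not enter the bound, which makes it usable conditionally on other variables. *)
Lemma gauss_factor_le (E c : R) : 0 < E ->
  (\int[normal_prob 0 1]_x (expR (- (E * (x + c) ^+ 2 / 2)))%:E <= (gfac E)%:E)%E.
Proof.
move=> E0; pose f x : R := expR (- (E * (x + c) ^+ 2 / 2)).
have mf : measurable_fun [set: R] f.
  apply: measurableT_comp => //; apply: measurableT_comp => //.
  apply: measurable_funM => //; apply: measurable_funM => //.
  by apply: measurable_funX; exact: measurable_funD.
have f0 x : 0 <= f x by exact: expR_ge0.
rewrite /gfac; case: (leP E 1) => E1.
  rewrite -(@probability_setT _ _ R (normal_prob 0 1)) -[leRHS]mul1e -integral_cst//.
  apply: ge0_le_integral => //; first by apply/measurable_EFinP; exact: mf.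
  move=> x _; rewrite lee_fin -[leRHS]expR0 ler_expR oppr_le0.
  by apply: mulr_ge0 => //; apply: mulr_ge0; [exact: ltW|exact: sqr_ge0].
rewrite ge0_integral_normal_prob//; last exact/measurable_EFinP.
have sE : 0 < (Num.sqrt E)^-1 by rewrite invr_gt0 sqrtr_gt0.
apply: (@le_trans _ _ (\int[leb]_x (((Num.sqrt E)^-1)%:E * (normal_pdf (- c) (Num.sqrt E)^-1 x)%:E))%E).
  apply: ge0_le_integral => //.
  - by move=> x _; rewrite mule_ge0// lee_fin// normal_pdf_ge0.
  - apply: emeasurable_funM; apply/measurable_EFinP => //; exact: measurable_normal_pdf.
  - apply: emeasurable_funM; apply/measurable_EFinP => //; exact: measurable_normal_pdf.
  - move=> x _; rewrite -!EFinM lee_fin !normal_pdf_gt0E//.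
    have -> : normal_fun (- c) (Num.sqrt E)^-1 x = f x.
      rewrite /normal_fun /f exprVn sqr_sqrtr ?ltW//; congr expR.
      by field; rewrite gt_eqF.
    have -> : normal_peak (Num.sqrt E)^-1 = Num.sqrt E * normal_peak 1.
      rewrite /normal_peak exprVn sqr_sqrtr ?ltW// expr1n -!mulrnAr sqrtrM ?invr_ge0 ?ltW//.
      by rewrite mul1r sqrtrV ?ltW// invfM invrK.
    have -> : (Num.sqrt E)^-1 * (Num.sqrt E * normal_peak 1 * f x) = f x * normal_peak 1.
      by field; rewrite gt_eqF// sqrtr_gt0.
    apply: ler_wpM2l; first exact: f0.
    rewrite -[leRHS]mulr1; apply: ler_wpM2l; first exact: normal_peak_ge0.
    rewrite /normal_fun -[leRHS]expR0 ler_expR mulNr oppr_le0.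
    by apply: mulr_ge0; [exact: sqr_ge0|rewrite invr_ge0 mulrn_wge0// sqr_ge0].
rewrite ge0_integralZl//; last 2 first.
- by apply/measurable_EFinP; exact: measurable_normal_pdf.
- by move=> x _; rewrite lee_fin normal_pdf_ge0.
by rewrite integral_normal_pdf mule1.
Qed.
End GaussianFactor.

Section GaussianSpace.
Context (R : realType) (dd : measure_display) (Omega : measurableType dd)
  (P : probability Omega R).
Implicit Types (f g e W : Omega -> R) (us : seq (Omega -> R)).

Definition ip f g : R := fine (\int[P]_w (f w * g w)%:E).

(** Joint normality is encoded by the real part of the characteristic function at the argument 1,
    asked of every element of a linear space; other arguments are reached by scaling inside the
    space. No covariance matrix appears. *)
Record gaussian_space (H : set (Omega -> R)) : Prop := GaussianSpace {
  gs_lin : forall f g (c : R), H f -> H g -> H (fun w => f w + c * g w);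
  gs_meas : forall f, H f -> measurable_fun setT f;
  gs_sqr : forall f, H f -> P.-integrable setT (fun w => (f w ^+ 2)%:E);
  gs_cos : forall f, H f -> (\int[P]_w (cos (f w))%:E = (expR (- (ip f f / 2)))%:E)%E
}.

Definition linear_set (G : set (Omega -> R)) : Prop :=
  G (fun=> 0) /\ forall f g (c : R), G f -> G g -> G (fun w => f w + c * g w).

(* Gram-Schmidt: f minus its projection on the span of us.  A null residual gives
   the coefficient x / 0 = 0, which is right by ip_eq0. *)
Fixpoint residual us f : Omega -> R :=
  if us is u :: us' then
    fun w => residual us' f w
      + - (ip (residual us' f) (residual us' u) / ip (residual us' u) (residual us' u)) * residual us' u w
  else f.

Context (H : set (Omega -> R)) (gH : gaussian_space H).

Lemma integrable_mul_gs f g : H f -> H g -> P.-integrable setT (fun w => (f w * g w)%:E).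
Proof.
move=> Hf Hg.
have iS : P.-integrable setT (fun w => (f w ^+ 2 + g w ^+ 2)%:E).
  by under eq_fun do rewrite EFinD; apply: integrableD => //; exact: (gs_sqr gH).
apply: le_integrable iS => //.
  by apply/measurable_EFinP/measurable_funM; exact: (gs_meas gH).
move=> w _; rewrite /= lee_fin normrM [leRHS]ger0_norm; last by rewrite addr_ge0 ?sqr_ge0.
rewrite -(real_normK (num_real (f w))) -(real_normK (num_real (g w))).
have := normr_ge0 (f w); have := normr_ge0 (g w); nra.
Qed.

Lemma ipE f g : H f -> H g -> (\int[P]_w (f w * g w)%:E = (ip f g)%:E)%E.
Proof.
move=> Hf Hg; rewrite /ip fineK//.
by apply: integrable_fin_num => //; exact: integrable_mul_gs.
Qed.

Lemma ipC f g : ip f g = ip g f.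
Proof. by rewrite /ip; congr fine; apply: eq_integral => w _; rewrite mulrC. Qed.

Lemma ip_linl f g h (c : R) : H f -> H g -> H h ->
  ip (fun w => f w + c * g w) h = ip f h + c * ip g h.
Proof.
move=> Hf Hg Hh; apply: EFin_inj.
rewrite -ipE//; last exact: (gs_lin gH).
rewrite EFinD EFinM -!ipE// -integralZl//; last exact: integrable_mul_gs.
rewrite -integralD//; last 2 first.
- exact: integrable_mul_gs.
- by apply: integrableZl => //; exact: integrable_mul_gs.
by apply: eq_integral => w _; rewrite -EFinM -EFinD; congr EFin; ring.
Qed.

Lemma ip_linr f g h (c : R) : H f -> H g -> H h ->
  ip h (fun w => f w + c * g w) = ip h f + c * ip h g.
Proof. by move=> Hf Hg Hh; rewrite ipC ip_linl// !(ipC h). Qed.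

Lemma ip_ge0 f : 0 <= ip f f.
Proof. by rewrite /ip fine_ge0// integral_ge0// => w _; rewrite lee_fin -expr2 sqr_ge0. Qed.

Lemma ip_lin2 f g (c : R) : H f -> H g ->
  ip (fun w => f w + c * g w) (fun w => f w + c * g w) = ip f f + 2 * c * ip f g + c ^+ 2 * ip g g.
Proof.
move=> Hf Hg; rewrite ip_linl//; last exact: (gs_lin gH).
by rewrite !ip_linr// (ipC g f); ring.
Qed.

Lemma ip_eq0 f g : H f -> H g -> ip g g = 0 -> ip f g = 0.
Proof.
move=> Hf Hg g0; apply/eqP; rewrite -[_ == 0]negbK; apply/negP => n0.
(* With [ip g g = 0] the square norm of f + c g is affine in c; this c gives it the value - 1. *)
have := ip_ge0 (fun w => f w + (- ((ip f f + 1) / (2 * ip f g))) * g w).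
rewrite ip_lin2// g0 mulr0 addr0.
have -> : 2 * - ((ip f f + 1) / (2 * ip f g)) * ip f g = - (ip f f + 1) by field.
lra.
Qed.

Lemma residual_gs us f : {in us, forall u, H u} -> H f -> H (residual us f).
Proof.
elim: us f => [|u us IH] f //= Hus Hf.
have Hu : H u by apply: Hus; rewrite inE eqxx.
have Hus' : {in us, forall u, H u} by move=> v vus; apply: Hus; rewrite inE vus orbT.
by apply: (gs_lin gH); exact: IH.
Qed.

Lemma residual_lin us f g (c : R) : {in us, forall u, H u} -> H f -> H g ->
  residual us (fun w => f w + c * g w) = (fun w => residual us f w + c * residual us g w).
Proof.
elim: us => [|u us IH] //= Hus Hf Hg.
have Hu : H u by apply: Hus; rewrite inE eqxx.
have Hus' : {in us, forall u, H u} by move=> v vus; apply: Hus; rewrite inE vus orbT.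
apply/funext => w; rewrite IH// ip_linl; [ring|exact: residual_gs..].
Qed.

(** The square norm of a residual becomes that of f minus one element of the span, to which a lower
    bound on the distance from the span applies. *)
Lemma residual_sub us f (G : set (Omega -> R)) : linear_set G ->
  {in us, forall u, G u} ->
  exists2 p, G p & residual us f = (fun w => f w + -1 * p w).
Proof.
move=> [G0 Glin]; elim: us f => [|u us IH] f /= Gus.
  by exists (fun=> 0) => //; apply/funext => w; rewrite mulr0 addr0.
have Gu : G u by apply: Gus; rewrite inE eqxx.
have Gus' : {in us, forall u, G u} by move=> v vus; apply: Gus; rewrite inE vus orbT.
have [p Gp pE] := IH f Gus'; have [p' Gp' pE'] := IH u Gus'.
set c := ip _ _ / _.
exists (fun w => p w + c * (u w + -1 * p' w)).
  by apply: (Glin) => //; exact: Glin.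
by apply/funext => w; rewrite pE pE'; ring.
Qed.

(** One factor per Gram-Schmidt step: in a Gaussian space the square norm of the residual is the
    conditional variance of [u] given the variables of [us']. *)
Fixpoint gfac_prod us : R :=
  if us is u :: us' then gfac (ip (residual us' u) (residual us' u)) * gfac_prod us' else 1.

Lemma gfac_prod_ge0 us : 0 <= gfac_prod us.
Proof. by elim: us => //= u us IH; rewrite mulr_ge0// gfac_ge0. Qed.

Definition gauss_weight us (w : Omega) : R := \prod_(u <- us) expR (- (u w ^+ 2 / 2)).

Lemma gauss_weight_cons u us w : gauss_weight (u :: us) w = expR (- (u w ^+ 2 / 2)) * gauss_weight us w.
Proof. by rewrite /gauss_weight big_cons. Qed.

Lemma gauss_weight_ge0 us w : 0 <= gauss_weight us w.
Proof. by apply: prodr_ge0 => u _; exact: expR_ge0. Qed.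

Lemma gauss_weight_le1 us w : gauss_weight us w <= 1.
Proof.
elim: us => [|u us IH]; first by rewrite /gauss_weight big_nil.
rewrite gauss_weight_cons; apply: mulr_ile1 => //; first exact: gauss_weight_ge0.
rewrite -[leRHS]expR0 ler_expR oppr_le0.
by apply: mulr_ge0 => //; exact: sqr_ge0.
Qed.

Lemma measurable_gauss_weight us : {in us, forall u, H u} -> measurable_fun setT (gauss_weight us).
Proof.
elim: us => [|u us IH] Hus.
  rewrite (_ : gauss_weight _ = cst 1) //.
  by apply/funext => w; rewrite /gauss_weight big_nil.
rewrite (_ : gauss_weight _ = fun w => expR (- (u w ^+ 2 / 2)) * gauss_weight us w); last first.
  by apply/funext => w; exact: gauss_weight_cons.
apply: measurable_funM; last by apply: IH => v vus; apply: Hus; rewrite inE vus orbT.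
apply: measurableT_comp => //; apply: measurableT_comp => //.
apply: measurable_funM => //; apply: measurable_funX.
by apply: (gs_meas gH); apply: Hus; rewrite inE eqxx.
Qed.

End GaussianSpace.

Lemma integrable_bounded_prod (R : realType) d1 d2 (T1 : measurableType d1) (T2 : measurableType d2)
  (P1 : probability T1 R) (P2 : probability T2 R) (f : T1 * T2 -> R) (M : R) :
  measurable_fun setT f -> (forall x, `|f x| <= M) ->
  (P1 \x P2)%E.-integrable setT (fun x => (f x)%:E).
Proof.
move=> mf fM; apply/integrable12ltyP; first exact/measurable_EFinP.
apply: (@le_lt_trans _ _ (\int[P1]_x \int[P2]_y (cst M%:E y))%E).
  have mn : measurable_fun setT (fun z : T1 * T2 => `|(f z)%:E|%E).
    by apply: measurableT_comp => //; exact/measurable_EFinP.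
  apply: ge0_le_integral => //.
  - by move=> x _; apply: integral_ge0.
  - by apply: (measurable_fun_fubini_tonelli_F _ mn).
  - move=> x _; apply: ge0_le_integral => //.
      exact: (measurableT_comp mn (measurable_pair1 x)).
    by move=> y _; rewrite lee_fin.
under eq_integral do rewrite integral_cst//= probability_setT mule1.
by rewrite integral_cst//= probability_setT mule1 ltry.
Qed.

Section GaussianVectorBound.
Context (R : realType) (dd : measure_display) (Omega : measurableType dd)
  (P : probability Omega R) (H : set (Omega -> R)) (gH : gaussian_space P H).
Implicit Types (f g e W : Omega -> R) (us : seq (Omega -> R)).
Notation gam := (normal_prob (0 : R) 1).
Notation ip := (ip P).
Notation residual := (residual P).

(** Completing the square, A + 2 x B + x^2 E = E (x + B / E)^2 + A - B^2 / E; the square contributes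
    [gfac E] whatever the shift B / E. *)
Lemma gauss_step_ge0 (A B E C : R) : 0 < E -> 0 <= C ->
  (\int[gam]_x (C * expR (- ((A + 2 * x * B + x ^+ 2 * E) / 2)))%:E
   <= (gfac E * C * expR (- ((A - B ^+ 2 / E) / 2)))%:E)%E.
Proof.
move=> E0 C0.
have mf : measurable_fun [set: R] (fun x : R => expR (- (E * (x + B / E) ^+ 2 / 2))).
  apply: measurableT_comp => //; apply: measurableT_comp => //.
  apply: measurable_funM => //; apply: measurable_funM => //.
  by apply: measurable_funX; exact: measurable_funD.
rewrite (_ : (\int[gam]_x _)%E = (\int[gam]_x ((C * expR (- ((A - B ^+ 2 / E) / 2)))%:E *
   (expR (- (E * (x + B / E) ^+ 2 / 2)))%:E))%E); last first.
  apply: eq_integral => x _; rewrite -EFinM; congr EFin.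
  rewrite -[RHS]mulrA -expRD; congr (_ * expR _).
  by field; rewrite gt_eqF.
have CE : 0 <= C * expR (- ((A - B ^+ 2 / E) / 2)) by rewrite mulr_ge0// expR_ge0.
rewrite ge0_integralZl//; last by apply/measurable_EFinP; exact: mf.
have -> : gfac E * C * expR (- ((A - B ^+ 2 / E) / 2)) =
  C * expR (- ((A - B ^+ 2 / E) / 2)) * gfac E by rewrite -[LHS]mulrA mulrC.
rewrite [leRHS]EFinM; apply: lee_wpmul2l; first by rewrite lee_fin.
exact: gauss_factor_le.
Qed.

Lemma measurable_quadexp (A B E C : R) :
  measurable_fun [set: R] (fun x : R => C * expR (- ((A + 2 * x * B + x ^+ 2 * E) / 2))).
Proof.
apply: measurable_funM => //; apply: measurableT_comp => //; apply: measurableT_comp => //.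
apply: measurable_funM => //; apply: measurable_funD.
  by apply: measurable_funD => //; do 2 apply: measurable_funM => //.
by apply: measurable_funM => //; apply: measurable_funX.
Qed.

(** By linearity of the residual, the square norm of that of W + c x u is a quadratic polynomial in
    x. Its minimum A - B^2 / E is the square norm of the residual of W after u has also been
    projected out, so that integrating over x performs one Gram-Schmidt step. *)
Lemma gauss_step us u W (C : R) (c : R) : {in us, forall v, H v} -> H u -> H W -> 0 <= C -> c ^+ 2 = 1 ->
  (\int[gam]_x (C * expR (- (ip (residual us (fun w => (W w + (c * x) * u w)%R)) (residual us (fun w => (W w + (c * x) * u w)%R)) / 2)))%:E
   <= (gfac (ip (residual us u) (residual us u)) * C *
       expR (- (ip (residual (u :: us) W) (residual (u :: us) W) / 2)))%:E)%E.
Proof.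
move=> Hus Hu HW C0 c1.
have Ha := residual_gs gH Hus HW; have He := residual_gs gH Hus Hu.
set A := ip (residual us W) (residual us W); set B := ip (residual us W) (residual us u).
set E := ip (residual us u) (residual us u).
have E0 : 0 <= E by exact: ip_ge0.
rewrite (_ : (\int[gam]_x _)%E = (\int[gam]_x (C * expR (- ((A + 2 * x * (c * B) + x ^+ 2 * E) / 2)))%:E)%E); last first.
  apply: eq_integral => x _; rewrite (residual_lin gH)// (ip_lin2 gH)// -/A -/B -/E exprMn c1 mul1r.
  by have -> : 2 * (c * x) * B = 2 * x * (c * B) by ring.
have -> : ip (residual (u :: us) W) (residual (u :: us) W) = A - B ^+ 2 / E.
  rewrite /= (ip_lin2 gH)// -/A -/B -/E.
  have [E00|En0] := eqVneq E 0; last by field.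
  by rewrite E00 invr0 !mulr0 oppr0 mulr0 !mul0r !addr0.
have [E00|En0] := eqVneq E 0.
  (* A null residual of [u] makes the exponent constant in x, and [gfac 0] is 1. *)
  have B0 : B = 0 by apply: (ip_eq0 gH).
  rewrite E00 B0 /gfac ler01 mul1r expr0n/= mul0r subr0.
  rewrite (_ : (\int[gam]_x _)%E = (\int[gam]_(x in setT) (C * expR (- (A / 2)))%:E)%E); last first.
    by apply: eq_integral => x _; rewrite !mulr0 !addr0.
  by rewrite -[leRHS]mule1 -(@probability_setT _ _ R (normal_prob 0 1)) -integral_cst.
have := @gauss_step_ge0 A (c * B) E C.
rewrite exprMn c1 mul1r; apply => //.
by rewrite lt_neqAle eq_sym En0.
Qed.

Lemma integral_cos_gam (b : R) : (\int[gam]_x (cos (b * x))%:E = (expR (- (b ^+ 2 / 2)))%:E)%E.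
Proof. by rewrite (integral_cos_normal_prob (ltr01 : (0 : R) < 1)) expr1n mul1r. Qed.

Lemma measurable_cos_gs f : measurable_fun setT f -> measurable_fun setT (fun w : Omega => cos (f w)).
Proof. by move=> mf; apply: measurableT_comp mf; exact: continuous_measurable_fun (@continuous_cos R). Qed.

(* exp(- u^2 / 2) is the mean of cos(u xi) for a standard normal xi, so that the
   induction step replaces W by W + xi u and W - xi u and integrates over xi. *)
Lemma cos_gauss_weight_le us W : {in us, forall v, H v} -> H W ->
  (\int[P]_w (cos (W w) * gauss_weight us w)%:E <=
    (gfac_prod P us * expR (- (ip (residual us W) (residual us W) / 2)))%:E)%E.
Proof.
elim: us W => [|u us IH] W Hus HW.
  rewrite /= mul1r -(gs_cos gH)// le_eqVlt; apply/orP; left; apply/eqP.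
  by apply: eq_integral => w _; rewrite /gauss_weight big_nil mulr1.
have Hu : H u by apply: Hus; rewrite inE eqxx.
have Hus' : {in us, forall u, H u} by move=> v vus; apply: Hus; rewrite inE vus orbT.
have mW := gs_meas gH HW; have mu := gs_meas gH Hu.
have mG := measurable_gauss_weight gH Hus'.
pose F (z : Omega * measurableTypeR R) : R := cos (W z.1) * cos (u z.1 * z.2) * gauss_weight us z.1.
have cos1 (x : R) : `|cos x| <= 1 by rewrite ler_norml cos_geN1 cos_le1.
have G1 w : `|gauss_weight us w| <= 1 by rewrite ger0_norm ?gauss_weight_le1 ?gauss_weight_ge0.
have mcos := continuous_measurable_fun (@continuous_cos R).
have mF : measurable_fun setT F.
  apply: measurable_funM; last exact: measurableT_comp mG measurable_fst.
  apply: measurable_funM.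
    exact: measurableT_comp (measurable_cos_gs mW) measurable_fst.
  apply: (measurableT_comp mcos); apply: measurable_funM.
    exact: measurableT_comp mu measurable_fst.
  exact: measurable_snd.
have F1 z : `|F z| <= 1.
  by rewrite !normrM; apply: mulr_ile1 => //; apply: mulr_ile1.
have iF : (P \x gam)%E.-integrable setT (fun z => (F z)%:E).
  exact: integrable_bounded_prod mF F1.
have -> : (\int[P]_w (cos (W w) * gauss_weight (u :: us) w)%:E = \int[P]_w \int[gam]_x (F (w, x))%:E)%E.
  apply: eq_integral => w _; rewrite gauss_weight_cons.
  rewrite (_ : (\int[gam]_x _)%E = (\int[gam]_x ((cos (W w) * gauss_weight us w)%:E * (cos (u w * x))%:E))%E); last first.
    by apply: eq_integral => x _; rewrite -EFinM /F/=; congr EFin; ring.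
  rewrite integralZl//; last first.
    by apply: (integrable_bounded _ (M := 1)) => //; exact: measurable_cos_mul.
  by rewrite integral_cos_gam -EFinM; congr EFin; ring.
rewrite (Fubini iF).
have Hc x c : H (fun w => W w + (c * x) * u w) by exact: (gs_lin gH).
pose K c x : R := gfac_prod P us * expR (- (ip (residual us (fun w => (W w + (c * x) * u w)%R)) (residual us (fun w => (W w + (c * x) * u w)%R)) / 2)).
have mK c : measurable_fun [set: R] (K c).
  rewrite (_ : K c = fun x => gfac_prod P us * expR (- ((ip (residual us W) (residual us W) + 2 * x * (c * ip (residual us W) (residual us u))
     + x ^+ 2 * (c ^+ 2 * ip (residual us u) (residual us u))) / 2))).
    exact: measurable_quadexp.
  apply/funext => x; rewrite /K (residual_lin gH)// (ip_lin2 gH)//; try exact: residual_gs.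
  set B := ip (residual us W) (residual us u); set E := ip (residual us u) _.
  have -> : 2 * (c * x) * B = 2 * x * (c * B) by ring.
  by have -> : (c * x) ^+ 2 * E = x ^+ 2 * (c ^+ 2 * E) by ring.
have K0 c x : 0 <= K c x by rewrite mulr_ge0 ?gfac_prod_ge0 ?expR_ge0.
have iK c : gam.-integrable setT (fun x => (K c x)%:E).
  have mK' : measurable_fun setT (K c : measurableTypeR R -> R) by exact: mK.
  apply: (integrable_bounded _ mK' (M := gfac_prod P us)) => x.
  rewrite ger0_norm// /K -[leRHS]mulr1; apply: ler_wpM2l; first exact: gfac_prod_ge0.
  rewrite -[leRHS]expR0 ler_expR oppr_le0.
  by apply: mulr_ge0 => //; exact: ip_ge0.
have iG : gam.-integrable setT (fun x => \int[P]_w (F (w, x))%:E)%E.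
  have mG' : measurable_fun setT (fun x : measurableTypeR R => \int[P]_w (F (w, x))%:E)%E.
    exact: measurable_fubini_G iF.
  have i1 : gam.-integrable setT (EFin \o cst 1) by exact: finite_measure_integrable_cst.
  apply: le_integrable i1 => // x _ /=.
  rewrite normr1.
  apply: (le_trans (le_abse_integral _ _ _)) => //.
    apply/measurable_EFinP; apply: measurable_funM => //.
    apply: measurable_funM; first exact: measurable_cos_gs.
    by apply: measurable_cos_gs; apply: measurable_funM.
  rewrite -(@probability_setT _ _ _ P) -[leRHS]mul1e -integral_cst//.
  apply: ge0_le_integral => //.
    apply: measurableT_comp => //.
    apply/measurable_EFinP; apply: measurable_funM => //.
    apply: measurable_funM; first exact: measurable_cos_gs.
    by apply: measurable_cos_gs; apply: measurable_funM.
  by move=> w _; rewrite lee_fin.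
apply: (@le_trans _ _ (\int[gam]_x ((2^-1)%:E * ((K 1 x)%:E + (K (-1) x)%:E)))%E).
  apply: le_integral => //.
    by apply: integrableZl => //; apply: integrableD.
  move=> x _.
  have HFc c : H (fun w => W w + c * x * u w) by exact: (gs_lin gH).
  have mc c : measurable_fun setT (fun w => cos (W w + c * x * u w) * gauss_weight us w).
    by apply: measurable_funM => //; apply: measurable_cos_gs; exact: (gs_meas gH).
  have ic c : P.-integrable setT (fun w => (cos (W w + c * x * u w) * gauss_weight us w)%:E).
    apply: (integrable_bounded _ (mc c) (M := 1)) => w.
    by rewrite normrM; apply: mulr_ile1.
  rewrite (_ : (\int[P]_w (F (w, x))%:E)%E = ((2^-1)%:E *
     (\int[P]_w (cos (W w + 1 * x * u w) * gauss_weight us w)%:E +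
      \int[P]_w (cos (W w + -1 * x * u w) * gauss_weight us w)%:E))%E); last first.
    rewrite -integralD// -integralZl//; last exact: integrableD.
    apply: eq_integral => w _; rewrite -EFinD -EFinM /F/=; congr EFin.
    rewrite mulN1r mul1r !mulNr cosB cosD (mulrC (u w)); by field.
  apply: lee_wpmul2l => //.
  by apply: leeD; exact: IH.
rewrite integralZl//; last exact: integrableD.
rewrite integralD//.
rewrite /= -/(ip _ _).
set T := (X in (_ <= X%:E)%E).
have hK c : c ^+ 2 = 1 -> (\int[gam]_x (K c x)%:E <= T%:E)%E.
  by move=> c1; apply: gauss_step => //; exact: gfac_prod_ge0.
have h1 : (\int[gam]_x (K 1 x)%:E <= T%:E)%E by apply: hK; rewrite expr1n.
have h2 : (\int[gam]_x (K (-1) x)%:E <= T%:E)%E by apply: hK; rewrite sqrrN expr1n.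
have -> : T%:E = ((2^-1)%:E * (T%:E + T%:E))%E by rewrite -EFinD -EFinM; congr EFin; field.
clearbody T; apply: lee_wpmul2l; first by rewrite lee_fin.
exact: (leeD h1 h2).
Qed.
Lemma gauss_weight_ge us (w : Omega) : (forall u, u \in us -> `|u w| <= 1) ->
  expR (- ((size us)%:R / 2)) <= gauss_weight us w.
Proof.
elim: us => [|u us IH] h; first by rewrite /gauss_weight big_nil mul0r oppr0 expR0.
rewrite gauss_weight_cons /= -natr1 mulrDl opprD addrC expRD.
apply: ler_pM; rewrite ?expR_ge0//.
  rewrite ler_expR lerN2 ler_pM2r// -(real_normK (num_real _)).
  by rewrite expr_le1//; apply: h; rewrite inE eqxx.
by apply: IH => v vus; apply: h; rewrite inE vus orbT.
Qed.

(** Markov's inequality for the weight: on the event it is at least exp(- k / 2) for k variables,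
    and its mean is bounded by [cos_gauss_weight_le] with W = 0. *)
Lemma gauss_small_ball us : {in us, forall v, H v} ->
  (P [set w | forall u, u \in us -> (`|u w| <= 1)%R] <=
    (expR ((size us)%:R / 2) * gfac_prod P us)%:E)%E.
Proof.
move=> Hus.
have mS : measurable [set w | forall u, u \in us -> (`|u w| <= 1)%R].
  rewrite (_ : [set w | _] = \big[setI/setT]_(u <- us) [set w | `|u w| <= 1]); last first.
    apply/seteqP; split => w.
      by move=> h; rewrite -bigcap_seq => u /= /h.
    by rewrite -bigcap_seq => h u uus; exact: h.
  elim: us Hus => [|u us IH] Hus; first by rewrite big_nil; exact: measurableT.
  rewrite big_cons; apply: measurableI.
    have mu : measurable_fun setT u by apply: (gs_meas gH); apply: Hus; rewrite inE eqxx.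
    rewrite (_ : [set w | _] = (fun w => `|u w|) @^-1` `]-oo, 1]%classic); last first.
      by apply/seteqP; split => w /=; rewrite in_itv.
    by rewrite -[X in measurable X]setTI; apply: (measurableT_comp (@normr_measurable R setT) mu).
  by apply: IH => v vus; apply: Hus; rewrite inE vus orbT.
have [us0|us0] := eqVneq us [::].
  by rewrite us0 /= mul0r expR0 mulr1; apply: probability_le1; rewrite us0 in mS.
have H0 : H (fun=> 0).
  case: us us0 Hus {mS} => // u us _ Hus.
  have Hu : H u by apply: Hus; rewrite inE eqxx.
  have := gs_lin gH (-1) Hu Hu.
  by rewrite (_ : (fun w => u w + -1 * u w) = fun=> 0)//; apply/funext => w; ring.
have mG := measurable_gauss_weight gH Hus.
have := cos_gauss_weight_le Hus H0.
have r0 : ip (residual us (fun=> 0)) (residual us (fun=> 0)) = 0.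
  rewrite (_ : residual us (fun=> 0) = fun=> 0); last first.
    have := residual_lin gH (-1) Hus H0 H0.
    rewrite (_ : (fun w => 0 + -1 * 0) = (fun=> 0 : R)); last by apply/funext => w; rewrite mulr0 addr0.
    by move=> ->; apply/funext => w; ring.
  by rewrite /ip integral0_eq// => w _; rewrite mulr0.
rewrite r0 mul0r oppr0 expR0 mulr1 => h.
rewrite EFinM; apply: le_trans (lee_wpmul2l _ h); last by rewrite lee_fin expR_ge0.
rewrite -ge0_integralZl//; last 2 first.
- by apply/measurable_EFinP; apply: measurable_funM.
- by move=> w _; rewrite lee_fin cos0 mul1r gauss_weight_ge0.
rewrite -[X in P X]setIT -integral_indic//.
apply: ge0_le_integral => //.
- exact/measurable_EFinP/measurable_indic.
- by apply/measurable_EFinP; do 2 apply: measurable_funM => //.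
move=> w _; rewrite -EFinM lee_fin cos0 mul1r indicE.
case: (boolP (_ \in _)) => [|_]; last by rewrite mulr_ge0 ?expR_ge0 ?gauss_weight_ge0.
rewrite inE /= => uw; rewrite -(ler_pdivrMl _ _ (expR_gt0 _)) mulr1 -expRN.
exact: gauss_weight_ge.
Qed.

End GaussianVectorBound.

(** * Nondeterminism and linear spans *)

Section LinearSpan.
Context (R : realType) (dd : measure_display) (Omega : measurableType dd)
  (P : probability Omega R) (I : eqType) (Y : I -> {RV P >-> R}).

Definition lin_comb (s : seq (R * I)) : Omega -> R :=
  fun w => \sum_(p <- s) p.1 * Y p.2 w.

Definition lin_span (S : set I) : set (Omega -> R) :=
  [set f | exists2 s, (forall p, p \in s -> S p.2) & f = lin_comb s].

Lemma lin_span_linear (S : set I) : linear_set (lin_span S).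
Proof.
split; first by exists [::] => //; apply/funext => w; rewrite /lin_comb big_nil.
move=> _ _ c [s Ss ->] [s' Ss' ->].
exists (s ++ [seq (c * p.1, p.2) | p <- s']).
  by move=> p; rewrite mem_cat => /orP[/Ss|/mapP[p' ps' ->]] //=; exact: (Ss' p').
apply/funext => w; rewrite /lin_comb big_cat big_map/= mulr_sumr.
by congr (_ + _); apply: eq_bigr => p _; rewrite mulrA.
Qed.

Lemma lin_span_gen (S : set I) t : S t -> lin_span S (Y t).
Proof.
move=> St; exists [:: (1, t)]; first by move=> p; rewrite inE => /eqP ->.
by apply/funext => w; rewrite /lin_comb big_seq1 mul1r.
Qed.

Lemma lin_span_sub (S S' : set I) : S `<=` S' -> lin_span S `<=` lin_span S'.
Proof. by move=> SS' f [s Ss ->]; exists s => // p /Ss/SS'. Qed.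

Lemma measurable_lin_comb s : measurable_fun setT (lin_comb s).
Proof.
elim: s => [|p s IH].
  by rewrite (_ : lin_comb _ = cst 0)//; apply/funext => w; rewrite /lin_comb big_nil.
rewrite (_ : lin_comb _ = fun w => p.1 * Y p.2 w + lin_comb s w); last first.
  by apply/funext => w; rewrite /lin_comb big_cons.
by apply: measurable_funD => //; apply: measurable_funM.
Qed.

Context (gY : gaussian_process Y) (cY : forall x, ('E_P[Y x] = 0)%E).

Lemma gaussian_lin_comb s : gaussian_rv P (lin_comb s).
Proof.
have := gY (fun j : 'I_(size s) => (tnth (in_tuple s) j).2) (fun j => (tnth (in_tuple s) j).1).
rewrite (_ : (fun w => _) = lin_comb s)//.
by apply/funext => w; rewrite /lin_comb [RHS]big_tnth.
Qed.

Lemma integrable_of_sqr (f : Omega -> R) : measurable_fun setT f ->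
  (\int[P]_w (f w ^+ 2)%:E < +oo)%E ->
  P.-integrable setT (fun w => (f w ^+ 2)%:E) /\ P.-integrable setT (fun w => (f w)%:E).
Proof.
move=> mf f2.
have i2 : P.-integrable setT (fun w => (f w ^+ 2)%:E).
  apply/integrableP; split; first by apply/measurable_EFinP; apply: measurable_funX.
  by under eq_integral do rewrite /= ger0_norm ?sqr_ge0//.
split => //.
have i1 : P.-integrable setT (fun w => (1 + f w ^+ 2)%:E).
  under eq_fun do rewrite EFinD; apply: integrableD => //.
  exact: (finite_measure_integrable_cst P 1).
apply: le_integrable i1 => //; first exact/measurable_EFinP.
move=> w _; rewrite lee_fin.
have := @norm_mul_le_1_sqr R (f w) 1 ler01; by rewrite !mulr1.
Qed.

Lemma integrable_process t : P.-integrable setT (fun w => (Y t w)%:E).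
Proof.
have mY : measurable_fun setT (Y t) by [].
have gYt : gaussian_rv P (Y t).
  have := gaussian_lin_comb [:: (1, t)].
  by rewrite (_ : lin_comb _ = Y t)//; apply/funext => w; rewrite /lin_comb big_seq1 mul1r.
have m0 : (\int[P]_w (Y t w)%:E = 0)%E by have := cY t; rewrite unlock.
have [s [_ s2 _ _]] := gaussian_rv_centered mY gYt m0.
by have [] := integrable_of_sqr mY; rewrite ?s2 ?ltry.
Qed.

Lemma integral_lin_comb s : P.-integrable setT (fun w => (lin_comb s w)%:E) /\
  (\int[P]_w (lin_comb s w)%:E = 0)%E.
Proof.
elim: s => [|p s [IHi IH]].
  rewrite (_ : lin_comb _ = cst 0); last by apply/funext => w; rewrite /lin_comb big_nil.
  by split; [exact: integrable0|exact: integral0].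
have i1 : P.-integrable setT (fun w => (p.1 * Y p.2 w)%:E).
  by under eq_fun do rewrite EFinM; apply: integrableZl => //; exact: integrable_process.
rewrite (_ : lin_comb _ = fun w => p.1 * Y p.2 w + lin_comb s w); last first.
  by apply/funext => w; rewrite /lin_comb big_cons.
split; first by under eq_fun do rewrite EFinD; apply: integrableD.
under eq_integral do rewrite EFinD.
rewrite integralD// IH adde0.
under eq_integral do rewrite EFinM.
rewrite integralZl//; last exact: integrable_process.
by have := cY p.2; rewrite unlock => ->; rewrite mule0.
Qed.

Lemma lin_span_centered f : lin_span setT f ->
  [/\ measurable_fun setT f, gaussian_rv P f & (\int[P]_w (f w)%:E = 0)%E].
Proof.
move=> [s _ ->]; split; [exact: measurable_lin_comb|exact: gaussian_lin_comb|].
by have [] := integral_lin_comb s.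
Qed.

Lemma lin_span_gaussian_space : gaussian_space P (lin_span setT).
Proof.
have [l0 ll] := lin_span_linear setT.
split.
- by move=> f g c Hf Hg; exact: ll.
- by move=> f /lin_span_centered[].
- move=> f /lin_span_centered[mf gf f0].
  have [s [_ s2 _ _]] := gaussian_rv_centered mf gf f0.
  by have [] := integrable_of_sqr mf; rewrite ?s2 ?ltry.
- move=> f /lin_span_centered[mf gf f0].
  have [s [_ s2 sc _]] := gaussian_rv_centered mf gf f0.
  have := sc 1; under eq_integral do rewrite mul1r.
  move=> ->; congr (expR (- (_ / 2)))%:E.
  rewrite expr1n mulr1 /ip; under eq_integral do rewrite -expr2.
  by rewrite s2.
Qed.

End LinearSpan.

(** * Conditional variances and distances from linear spans *)

Section ConditionalVariance.
Context (R : realType) (dd : measure_display) (Omega : measurableType dd)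
  (P : probability Omega R) (I : eqType) (Y : I -> {RV P >-> R}) (S : set I).
Notation G := (sigma_gen S Y).

(** The generating class of [sigma_gen S Y], named so that measurability with respect to this
    sigma-algebra can be expressed through [g_sigma_algebraType]. *)
Definition cylinders : set (set Omega) := [set A | exists (y : I) (B : set R),
        [/\ S y, measurable B & A = Y y @^-1` B]].

Lemma sigma_gen_measurable A : G A -> measurable A.
Proof.
move: A; apply: smallest_sub; first exact: sigma_algebra_measurable.
move=> _ [y [B [_ mB ->]]]; rewrite -[X in measurable X]setTI.
exact: (measurable_funPT (Y y)).
Qed.

Lemma lin_span_sigma_gen f : lin_span Y S f -> measurable_fun setT (f : g_sigma_algebraType cylinders -> R).
Proof.
move=> [s Ss ->]; elim: s Ss => [|p s IH] Ss.
  by rewrite (_ : lin_comb _ _ = cst 0)//; apply/funext => w; rewrite /lin_comb big_nil.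
rewrite (_ : lin_comb _ _ = fun w => p.1 * Y p.2 w + lin_comb Y s w); last first.
  by apply/funext => w; rewrite /lin_comb big_cons.
apply: measurable_funD; last by apply: IH => p' ps; apply: Ss; rewrite inE ps orbT.
apply: measurable_funM => // _ B mB; rewrite setTI.
apply: sub_sigma_algebra; exists p.2, B; split => //.
by apply: Ss; rewrite inE eqxx.
Qed.

Lemma integral_ge_of_ae (v : R) (V : Omega -> R) (A : set Omega) : measurable A ->
  P.-integrable setT (EFin \o V) -> {ae P, forall w, v <= V w} ->
  (v%:E * P A <= \int[P]_(w in A) (V w)%:E)%E.
Proof.
move=> mA iV vV.
have mV : measurable_fun setT V by apply/measurable_EFinP; exact: measurable_int iV.
have iVA : P.-integrable A (EFin \o V) by exact: integrableS iV.
have ic : P.-integrable A (EFin \o cst v) by exact: finite_measure_integrable_cst.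
have ivV : P.-integrable A (fun w => (Num.max v (V w))%:E).
  have iA : P.-integrable A (fun w => (`|v| + `|V w|)%:E).
    under eq_fun do rewrite EFinD; apply: integrableD => //.
      exact: (finite_measure_integrable_cst P `|v|).
    exact: (integrable_abse iVA).
  apply: le_integrable iA => //.
    apply/measurable_EFinP; apply: measurable_maxr => //; exact: measurable_funTS.
  move=> w _; rewrite lee_fin [leRHS]ger0_norm ?addr_ge0//.
  by case: (leP v (V w)) => _; [rewrite lerDr|rewrite lerDl].
rewrite (_ : (\int[P]_(w in A) (V w)%:E)%E = (\int[P]_(w in A) (Num.max v (V w))%:E)%E); last first.
  apply: ae_eq_integral => //.
  - exact: measurable_int iVA.
  - exact: measurable_int ivV.
  - by apply: filterS vV => w vw _; congr EFin; apply/esym/max_idPr.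
rewrite -integral_cst//; apply: le_integral => // w _.
by rewrite lee_fin le_max lexx.
Qed.

End ConditionalVariance.

Section ConditionalVarianceBound.
Context (R : realType) (dd : measure_display) (Omega : measurableType dd)
  (P : probability Omega R) (I : eqType) (Y : I -> {RV P >-> R}) (S : set I)
  (gY : gaussian_process Y) (cY : forall x, ('E_P[Y x] = 0)%E).
Notation G := (sigma_gen S Y).

(** With D = Y x - W and h = W - L, one has (D + h)^2 = D^2 + 2 a D + 2 D (h - a) + h^2. On A the
    term 2 a D integrates to 0, since a is constant and A belongs to G, and 2 D (h - a) is at least
    - 2 e |D|. *)
Lemma cond_var_cell (x : I) (L W V : Omega -> R) (v a e : R) (A : set Omega) :
  lin_span Y S L -> cond_exp_version P G (Y x) W ->
  cond_exp_version P G (fun w => (Y x w - W w) ^+ 2) V ->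
  {ae P, forall w, v <= V w} -> 0 <= e ->
  G A -> (forall w, A w -> a <= W w - L w < a + e) ->
  (v%:E * P A <= \int[P]_(w in A) ((Y x w - L w) ^+ 2)%:E
     + \int[P]_(w in A) (2 * e * `|Y x w - W w|)%:E)%E.
Proof.
move=> GL [iZ iW mW WE] [iD iV mV VE] vV e0 GA Aa.
have mA := sigma_gen_measurable GA.
have HL : lin_span Y setT L by apply: lin_span_sub GL.
have [_ ll] := lin_span_linear Y setT.
have HZL : lin_span Y setT (fun w => Y x w + -1 * L w).
  by apply: ll => //; exact: lin_span_gen.
have iZL : P.-integrable setT (fun w => ((Y x w - L w) ^+ 2)%:E).
  have := gs_sqr (lin_span_gaussian_space gY cY) HZL.
  by under eq_fun do rewrite mulN1r.
apply: le_trans (integral_ge_of_ae mA iV vV) _; rewrite VE//.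
have S1 (f : Omega -> \bar R) : P.-integrable setT f -> P.-integrable A f by exact: integrableS.
have iZW : P.-integrable A (fun w => (Y x w - W w)%:E).
  by under eq_fun do rewrite EFinB; apply: integrableB => //; exact: S1.
have iN : P.-integrable A (fun w => (2 * e * `|Y x w - W w|)%:E).
  by under eq_fun do rewrite EFinM; apply: integrableZl => //; exact: (integrable_abse iZW).
have ia : P.-integrable A (fun w => (2 * a * (Y x w - W w))%:E).
  by under eq_fun do rewrite EFinM; apply: integrableZl.
have E0 : (\int[P]_(w in A) (2 * a * (Y x w - W w))%:E = 0)%E.
  under eq_integral do rewrite EFinM.
  rewrite integralZl//; under eq_integral do rewrite EFinB.
  rewrite integralB//; [|exact: S1..].
  rewrite WE// subee ?mule0//.
  exact: (integrable_fin_num mA (S1 _ iZ)).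
rewrite -[leLHS]adde0 -E0 -integralD//; [|exact: S1].
rewrite -integralD//; [|exact: S1].
apply: le_integral => //.
- by apply: integrableD => //; exact: S1.
- by apply: integrableD => //; exact: S1.
move=> w; rewrite inE => /Aa /andP[aH Ha]; rewrite -!EFinD lee_fin.
move: (Y x w) (W w) (L w) aH Ha => z u l.
set D := z - u; set h := u - l => aH Ha.
have -> : z - l = D + h by rewrite /D /h; ring.
have hD : - (2 * e * `|D|) <= 2 * D * (h - a).
  have : `|2 * D * (h - a)| <= 2 * e * `|D|.
    have -> : 2 * e * `|D| = 2 * `|D| * e by ring.
    rewrite !normrM (normr_nat R 2); apply: ler_wpM2l; first by rewrite mulr_ge0.
    by rewrite ger0_norm; lra.
  by rewrite ler_norml => /andP[].
have h2 := sqr_ge0 h.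
have -> : (D + h) ^+ 2 = D ^+ 2 + 2 * a * D + 2 * D * (h - a) + h ^+ 2 by ring.
by move: hD h2; set t := 2 * D * (h - a); lra.
Qed.

(* The conditional expectation W is not known to be square integrable, so that
   E (Y x - L)^2 = E (Y x - W)^2 + E (W - L)^2 is only approximated, on the events
   where W - L lies in a short interval. *)
Lemma cond_var_lower (x : I) (L V : Omega -> R) (v : R) : 0 <= v ->
  lin_span Y S L -> cond_var_version P G (Y x) V -> {ae P, forall w, v <= V w} ->
  (v%:E <= \int[P]_w ((Y x w - L w) ^+ 2)%:E)%E.
Proof.
move=> v0 GL [W [cW cV]] vV.
have [iZ iW mW WE] := cW; have [iD iV mV VE] := cV.
pose H w := W w - L w.
have mH : measurable_fun setT (H : g_sigma_algebraType (cylinders Y S) -> R).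
  apply: measurable_funB; last exact: (lin_span_sigma_gen GL).
  by move=> _ B mB; rewrite setTI; exact: mW.
have GH (B : set R) : measurable B -> G (H @^-1` B).
  by move=> mB; have := mH measurableT _ mB; rewrite setTI.
set Q := (\int[P]_w ((Y x w - L w) ^+ 2)%:E)%E.
have mYL : measurable_fun setT (fun w => (Y x w - L w)).
  apply: measurable_funB => //; have [s _ ->] := GL; exact: measurable_lin_comb.
have mYW : measurable_fun setT (fun w => (Y x w - W w)).
  by apply: measurable_funB => //; apply/measurable_EFinP; exact: measurable_int iW.
have iN : P.-integrable setT (fun w => `|(Y x w - W w)%:E|%E).
  by apply: integrable_abse; under eq_fun do rewrite EFinB; apply: integrableB.
set M := (\int[P]_w `|(Y x w - W w)%:E|)%E.
have M0 : (0 <= M)%E by exact: integral_ge0.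
have Mfin : M \is a fin_num by exact: integrable_fin_num.
(* A run of m consecutive intervals of length e from - n e on. The cell estimates are added over
   them by induction on m; with m = 2 n the runs exhaust the line, and e tends to 0 last. *)
pose J (e : R) (n m : nat) : set R := `[- (n%:R * e), m%:R * e - n%:R * e[%classic.
have mJ e n m : measurable (J e n m) by exact: measurable_itv.
have strip (e : R) (n m : nat) : 0 < e ->
  (v%:E * P (H @^-1` J e n m) <=
    \int[P]_(w in H @^-1` J e n m) ((Y x w - L w) ^+ 2)%:E
   + \int[P]_(w in H @^-1` J e n m) (2 * e * `|Y x w - W w|)%:E)%E.
  move=> e0; elim: m => [|m IH].
    rewrite /J mul0r sub0r set_itvco0 preimage_set0 measure0 mule0 !integral_set0.
    by rewrite adde0.
  pose K : set R := `[m%:R * e - n%:R * e, m.+1%:R * e - n%:R * e[%classic.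
  have mK : measurable K by exact: measurable_itv.
  have -> : J e n m.+1 = J e n m `|` K.
    have m0 : 0 <= m%:R * e by rewrite mulr_ge0// ltW.
    rewrite /J /K; apply/seteqP; split => t /=; rewrite !in_itv/= -natr1 mulrDl mul1r.
      move=> /andP[t1 t2]; case: (ltP t (m%:R * e - n%:R * e)) => h; [left|right].
        by rewrite t1.
      by rewrite t2.
    by move=> [|] /andP[t1 t2]; apply/andP; split; lra.
  rewrite preimage_setU.
  set A := H @^-1` _; set B := H @^-1` K.
  have GA : G A by apply: GH.
  have GB : G B by apply: GH.
  have mA := sigma_gen_measurable GA; have mB := sigma_gen_measurable GB.
  have AB0 : A `&` B = set0.
    apply/seteqP; split => w //=; rewrite /A /B /J /K /= !in_itv/= => -[/andP[_ h1] /andP[h2 _]]; lra.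
  have dAB : [disjoint A & B] by apply/disj_set2P.
  rewrite measureU// muleDr//; last by rewrite ge0_adde_def// inE measure_ge0.
  rewrite ge0_integral_setU//; last 2 first.
  - by apply/measurable_EFinP/measurable_funTS; apply: measurable_funX.
  - by move=> w _; rewrite lee_fin sqr_ge0.
  rewrite ge0_integral_setU//; last 2 first.
  - by apply/measurable_EFinP/measurable_funTS; apply: measurable_funM => //; exact: measurableT_comp.
  - by move=> w _; rewrite lee_fin !mulr_ge0// ltW.
  rewrite addeACA; apply: leeD => //.
  apply: (cond_var_cell (a := m%:R * e - n%:R * e) GL cW cV vV (ltW e0) GB).
  move=> w; rewrite /B /K /= in_itv/= -/(H w) -natr1 mulrDl mul1r => /andP[h1 h2].
  by apply/andP; split; lra.
have bound (e : R) : 0 < e -> (v%:E <= Q + (2 * e)%:E * M)%E.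
  move=> e0.
  have cvgP : P (H @^-1` J e n (2 * n)%N) @[n --> \oo] --> P (\bigcup_n (H @^-1` J e n (2 * n)%N)).
    apply: nondecreasing_cvg_mu => //.
    - by move=> n; apply: (@sigma_gen_measurable _ _ _ P _ Y S); exact: GH.
    - apply: bigcup_measurable => n _; apply: (@sigma_gen_measurable _ _ _ P _ Y S); exact: GH.
    - move=> n m nm; apply/subsetPset => w; rewrite /J /= !in_itv/=.
      have : n%:R * e <= m%:R * e by rewrite ler_pM2r// ler_nat.
      rewrite !natrM => h /andP[h1 h2]; apply/andP; split; lra.
  have UT : \bigcup_n (H @^-1` J e n (2 * n)%N) = setT.
    apply/seteqP; split => // w _.
    exists (Num.bound (`|H w| / e)) => //.
    have : `|H w| / e < (Num.bound (`|H w| / e))%:R by apply: archi_boundP; rewrite divr_ge0// ltW.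
    rewrite ltr_pdivrMr// ltr_norml /J /= in_itv/= natrM => /andP[h1 h2].
    by apply/andP; split; lra.
  rewrite UT probability_setT in cvgP.
  have le n : (v%:E * P (H @^-1` J e n (2 * n)%N) <= Q + (2 * e)%:E * M)%E.
    apply: le_trans (strip e n (2 * n)%N e0) _.
    have mA : measurable (H @^-1` J e n (2 * n)%N) by apply: (@sigma_gen_measurable _ _ _ P _ Y S); exact: GH.
    apply: leeD.
      apply: ge0_subset_integral => //.
        by apply/measurable_EFinP; apply: measurable_funX.
      by move=> w _; rewrite lee_fin sqr_ge0.
    rewrite /M -ge0_integralZl//; last 2 first.
    - by apply: measurableT_comp => //; exact/measurable_EFinP.
    - by rewrite lee_fin mulr_ge0// ltW.
    apply: ge0_subset_integral => //.
      by apply/measurable_EFinP; apply: measurable_funM => //; exact: measurableT_comp.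
    by move=> w _; rewrite lee_fin !mulr_ge0// ltW.
  have cv : (v%:E * P (H @^-1` J e n (2 * n)%N))%E @[n --> \oo] --> (v%:E * 1)%E.
    by apply: cvgeZl => //.
  rewrite mule1 in cv.
  apply: (cvge_le _ cv); exact: nearW.
apply/lee_addgt0Pr => e e0.
have [m ME] : exists m, M = m%:E by exists (fine M); rewrite fineK.
have m0 : 0 <= m by move: M0; rewrite ME lee_fin.
have k0 : 0 < 2 * m + 1 by lra.
apply: le_trans (bound (e / (2 * m + 1)) _) _; first by rewrite divr_gt0.
apply: leeD => //; rewrite ME -EFinM lee_fin.
have te : e / (2 * m + 1) * (2 * m + 1) = e by rewrite divfK// gt_eqF.
have t0 : 0 < e / (2 * m + 1) by rewrite divr_gt0.
move: te t0; set t := e / _ => te t0; lra.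
Qed.
End ConditionalVarianceBound.

Section SmallBallProcess.
Context (R : realType) (dd : measure_display) (Omega : measurableType dd)
  (P : probability Omega R) (I : eqType) (Y : I -> {RV P >-> R})
  (gY : gaussian_process Y) (cY : forall x, ('E_P[Y x] = 0)%E)
  (S : set I) (kap : I -> I -> R) (d : nat).

(* In the application kap y z is a function of |y - z| and z is the point of zs
   nearest to y. *)
Definition nondet_on : Prop :=
  forall (y : I) (zs : seq I), S y -> (forall z, z \in zs -> S z) -> zs != [::] ->
    exists2 z, z \in zs & forall L, lin_span Y [set z | z \in zs] L ->
      ((kap y z)%:E <= \int[P]_w ((Y y w - L w) ^+ 2)%:E)%E.

(** The point z given by [nondet_on] depends on the configuration. Its factor is bounded by the sum
    over all candidates, each of which can be integrated in y. *)
Fixpoint kchain (r : R) (x : I) (ys : seq I) : R :=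
  if ys is y :: ys' then
    (\sum_(z <- x :: ys') gfac (kap y z / r ^+ 2) ^+ d) * kchain r x ys'
  else 1.

(** For u_y = (Y y - Y x) / r, the residual of u_y is (Y y - L) / r with L in the span of the values
    at x and at the points already treated, so that its square norm is at least kap y z / r^2 for
    some such z. The intermediate B is the bound for one coordinate; only its d-th power is compared
    with sums, because the d-th power has to be taken before the maximum over z is replaced by a
    sum. *)
Lemma small_ball_process (r : R) (x : I) (ys : seq I) : nondet_on -> 0 < r ->
  S x -> (forall y, y \in ys -> S y) ->
  exists B : R, [/\ 0 <= B, B ^+ d <= kchain r x ys &
    (P [set w | forall y, y \in ys -> (`|Y y w - Y x w| <= r)%R] <=
      (expR ((size ys)%:R / 2) * B)%:E)%E].
Proof.
move=> nd r0 Sx Sys.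
have gs := lin_span_gaussian_space gY cY.
pose u y w : R := 0 + r^-1 * (Y y w + -1 * Y x w).
have [l0 ll] := lin_span_linear Y setT.
have Hu y : lin_span Y setT (u y).
  by apply: (ll) => //; apply: (ll); exact: lin_span_gen.
have Hus zs : {in [seq u y | y <- zs], forall f, lin_span Y setT f}.
  by move=> f /mapP[y _ ->].
exists (gfac_prod P [seq u y | y <- ys]); split.
- exact: gfac_prod_ge0.
- elim: ys Sys => [|y ys IH] Sys /=; first by rewrite expr1n.
  rewrite exprMn; apply: ler_pM; rewrite ?exprn_ge0 ?gfac_ge0 ?gfac_prod_ge0//; last first.
    by apply: IH => z zs; apply: Sys; rewrite inE zs orbT.
  have Sy : S y by apply: Sys; rewrite inE eqxx.
  have Sz z : z \in x :: ys -> S z.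
    by rewrite inE => /orP[/eqP ->//|zs]; apply: Sys; rewrite inE zs orbT.
  have [z zs hz] := nd y (x :: ys) Sy Sz isT.
  rewrite (big_rem z)//= -[leLHS]addr0; apply: lerD; last first.
    by apply: sumr_ge0 => z' _; rewrite exprn_ge0// gfac_ge0.
  apply: lerXn2r; rewrite ?nnegrE ?gfac_ge0//; apply: gfac_le.
  have [g0 gl] := lin_span_linear Y [set z | z \in x :: ys].
  have Gx z' : z' \in x :: ys -> lin_span Y [set z | z \in x :: ys] (Y z').
    by move=> z'x; exact: lin_span_gen.
  have Gus : {in [seq u y | y <- ys], forall f, lin_span Y [set z | z \in x :: ys] f}.
    move=> f /mapP[y' y'ys ->]; apply: (gl) => //; apply: (gl); apply: Gx.
      by rewrite inE y'ys orbT.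
    by rewrite inE eqxx.
  have [p Gp ->] := @residual_sub R _ _ P _ (u y) _ (lin_span_linear Y _) Gus.
  have GL : lin_span Y [set z | z \in x :: ys] (fun w => Y x w + r * p w).
    by apply: (gl) => //; apply: Gx; rewrite inE eqxx.
  have := hz _ GL.
  have HL : lin_span Y setT (fun w => Y y w + -1 * (Y x w + r * p w)).
    by apply: (ll); [exact: lin_span_gen|exact: lin_span_sub GL].
  have Hp : lin_span Y setT (fun w => u y w + -1 * p w).
    by apply: (ll) => //; exact: lin_span_sub Gp.
  rewrite (_ : (\int[P]_w ((Y y w - (Y x w + r * p w)) ^+ 2)%:E)%E =
    ((r ^+ 2)%:E * \int[P]_w ((u y w + -1 * p w) * (u y w + -1 * p w))%:E)%E); last first.
    rewrite -integralZl//; last exact: (integrable_mul_gs gs).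
    apply: eq_integral => w _; rewrite -EFinM; congr EFin; rewrite /u.
    by field; rewrite gt_eqF.
  rewrite (ipE gs)// -EFinM lee_fin => h.
  by rewrite ler_pdivrMr ?exprn_gt0// mulrC.
have := gauss_small_ball gs (Hus ys); rewrite size_map.
apply: le_trans; rewrite le_eqVlt; apply/orP; left; apply/eqP; congr (P _).
apply/seteqP; split => w h.
  move=> f /mapP[y yys ->]; rewrite /u add0r mulN1r normrM gtr0_norm ?invr_gt0//.
  by rewrite ler_pdivrMl// mulr1; exact: h.
move=> y yys; have := h (u y) (map_f _ yys).
by rewrite /u add0r mulN1r normrM gtr0_norm ?invr_gt0// ler_pdivrMl// mulr1.
Qed.

End SmallBallProcess.

(** * Moments of random masses *)

Section MomentBound.
Context (R : realType) (d1 d2 : measure_display) (T : measurableType d1)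
  (Omega : measurableType d2) (mu : probability T R) (P : probability Omega R)
  (A : set T) (E : set (T * Omega)) (phi : T -> T -> R) (x : T)
  (C : nat -> R) (G : R).

Definition section_indic (ys : seq T) (w : Omega) : R := \prod_(y <- ys) \1_E (y, w).

Definition section_mass (w : Omega) : R := fine (mu (ysection E w)).

(** The abstract form of [kchain], with phi for the d-th power of the Gaussian factor. *)
Fixpoint chain (ys : seq T) : R :=
  if ys is y :: ys' then (\sum_(z <- x :: ys') phi y z) * chain ys' else 1.

Hypotheses (mA : measurable A) (mE : measurable E)
  (EA : forall y w, E (y, w) -> A y) (phi0 : forall y z, 0 <= phi y z)
  (Ax : A x) (C0 : forall n, 0 <= C n) (G0 : 0 <= G).
Hypothesis mphi : forall z, measurable_fun setT (phi ^~ z).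
Hypothesis phiG : forall z, A z -> (\int[mu]_(y in A) (phi y z)%:E <= G%:E)%E.
Hypothesis chainP : forall ys, (forall y, y \in ys -> A y) ->
  (\int[P]_w (section_indic ys w)%:E <= (C (size ys) * chain ys)%:E)%E.

Lemma chain_ge0 ys : 0 <= chain ys.
Proof. by elim: ys => //= y ys IH; rewrite mulr_ge0// sumr_ge0. Qed.

Lemma section_indic_ge0 ys w : 0 <= section_indic ys w.
Proof. by apply: prodr_ge0. Qed.

Lemma section_mass_ge0 w : 0 <= section_mass w.
Proof. exact: fine_ge0. Qed.

Lemma measurable_section_indic ys : measurable_fun setT (section_indic ys).
Proof.
elim: ys => [|y ys IH].
  by rewrite (_ : section_indic _ = cst 1)//; apply/funext => w; rewrite /section_indic big_nil.
rewrite (_ : section_indic _ = fun w => \1_E (y, w) * section_indic ys w); last first.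
  by apply/funext => w; rewrite /section_indic big_cons.
apply: measurable_funM => //.
exact: (measurableT_comp (measurable_indic mE) (measurable_pair1 y)).
Qed.

Lemma section_massE w : mu (ysection E w) = (section_mass w)%:E.
Proof. by rewrite fineK// fin_num_measure//; exact: measurable_ysection. Qed.

Lemma measurable_section_mass : measurable_fun setT section_mass.
Proof.
apply/measurable_EFinP; rewrite (_ : _ \o _ = mu \o ysection E).
  exact: measurable_fun_ysection.
by apply/funext => w /=; rewrite section_massE.
Qed.

(* Writing one factor of the mass as an integral over y adds the point y to ys. *)
Lemma section_mass_moment (m : nat) (ys : seq T) : (forall y, y \in ys -> A y) ->
  (\int[P]_w (section_indic ys w * section_mass w ^+ m)%:E <=
    (C (size ys + m) * ((size ys + m)%:R * G) ^+ m * chain ys)%:E)%E.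
Proof.
elim: m ys => [|m IH] ys Ays.
  under eq_integral do rewrite expr0 mulr1.
  by rewrite addn0 expr0 mulr1; exact: chainP.
pose f (z : T * Omega) : \bar R := (section_indic (z.1 :: ys) z.2 * section_mass z.2 ^+ m)%:E.
have fE z : f z = (\1_E z * section_indic ys z.2 * section_mass z.2 ^+ m)%:E.
  by rewrite /f /section_indic big_cons -surjective_pairing.
have mf : measurable_fun setT f.
  rewrite (funext fE); apply/measurable_EFinP.
  apply: measurable_funM; first apply: measurable_funM.
  - exact: measurable_indic.
  - exact: measurableT_comp (measurable_section_indic ys) measurable_snd.
  - by apply: measurable_funX; exact: measurableT_comp measurable_section_mass measurable_snd.
have f0 z : (0 <= f z)%E.
  by rewrite lee_fin mulr_ge0 ?section_indic_ge0// exprn_ge0// section_mass_ge0.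
have -> : (\int[P]_w (section_indic ys w * section_mass w ^+ m.+1)%:E =
   \int[P]_w \int[mu]_y f (y, w))%E.
  apply: eq_integral => w _.
  transitivity (\int[mu]_y ((section_indic ys w * section_mass w ^+ m)%:E * (\1_(ysection E w) y)%:E))%E.
    rewrite ge0_integralZl//; first last.
    - by rewrite lee_fin mulr_ge0 ?section_indic_ge0// exprn_ge0// section_mass_ge0.
    - by apply/measurable_EFinP/measurable_indic; exact: measurable_ysection.
    rewrite integral_indic//; last exact: measurable_ysection.
    transitivity ((section_indic ys w * section_mass w ^+ m)%:E * (section_mass w)%:E)%E.
      by rewrite -EFinM exprSr mulrA.
    by congr (_ * _)%E; rewrite setIT -section_massE.
  apply: eq_integral => y _; rewrite fE /= -EFinM; congr EFin.
  rewrite !indicE mem_ysection; ring.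
rewrite -(fubini_tonelli _ mf f0).
apply: (@le_trans _ _ (\int[mu]_(y in A) ((C (size ys + m.+1) * ((size ys + m.+1)%:R * G) ^+ m * chain ys)%:E *
    (\sum_(z <- x :: ys) phi y z)%:E))%E).
  have -> : (\int[mu]_y \int[P]_w f (y, w) = \int[mu]_(y in A) \int[P]_w f (y, w))%E.
    rewrite [RHS]integral_mkcond; apply: eq_integral => y _.
    rewrite patchE; case: ifPn => //; rewrite notin_setE => nAy.
    apply: integral0_eq => w _; rewrite fE indicE memNset ?mul0r//.
    by move=> /EA.
  apply: ge0_le_integral => //.
  - by move=> y _; apply: integral_ge0.
  - apply: measurable_funTS; by apply: (measurable_fun_fubini_tonelli_F _ mf).
  - apply/measurable_EFinP; apply: measurable_funM => //.
    by apply: measurable_funTS; apply: measurable_sum => z; exact: mphi.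
  - move=> y Ay; have := IH (y :: ys).
    rewrite /= addSnnS => /(_ _)/le_trans; apply.
      by move=> y'; rewrite inE => /orP[/eqP -> //|]; exact: Ays.
    by rewrite lee_fin -!mulrA ler_wpM2l// ler_wpM2l ?exprn_ge0 ?mulr_ge0// mulrC.
rewrite ge0_integralZl//; last 3 first.
- by apply/measurable_EFinP; apply: measurable_funTS; apply: measurable_sum => z; exact: mphi.
- by move=> y _; rewrite lee_fin sumr_ge0.
- by rewrite lee_fin !mulr_ge0 ?chain_ge0// exprn_ge0// mulr_ge0.
have -> : C (size ys + m.+1) * ((size ys + m.+1)%:R * G) ^+ m.+1 * chain ys =
  C (size ys + m.+1) * ((size ys + m.+1)%:R * G) ^+ m * chain ys * ((size ys + m.+1)%:R * G).
  by rewrite exprSr; ring.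
rewrite [leRHS]EFinM; apply: lee_wpmul2l.
  by rewrite lee_fin !mulr_ge0 ?chain_ge0// exprn_ge0// mulr_ge0.
(* Each of the 1 + size ys centers lies in A and contributes at most G; this is where the potential
   must be bounded on all of A. *)
apply: (@le_trans _ _ ((size (x :: ys))%:R * G)%:E); last first.
  by rewrite lee_fin ler_wpM2r// ler_nat addnS ltnS leq_addr.
have : forall z, z \in x :: ys -> A z.
  by move=> z; rewrite inE => /orP[/eqP -> //|]; exact: Ays.
elim: (x :: ys) => [|z zs IHz] Azs.
  by under eq_integral do rewrite big_nil; rewrite integral0 mul0r.
under eq_integral do rewrite big_cons EFinD.
have Az : A z by apply: Azs; rewrite inE eqxx.
have Azs' z' : z' \in zs -> A z' by move=> h; apply: Azs; rewrite inE h orbT.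
rewrite ge0_integralD//.
- by rewrite /= -nat1r mulrDl mul1r EFinD; apply: leeD; [exact: phiG|exact: IHz].
- by move=> y _; rewrite lee_fin.
- by apply/measurable_EFinP; apply: measurable_funTS; exact: mphi.
- by move=> y _; rewrite lee_fin sumr_ge0.
- by apply/measurable_EFinP; apply: measurable_funTS; apply: measurable_sum => z'; exact: mphi.
Qed.

End MomentBound.

(** * Mesh sums and ball energies *)

Section PowerSums.
Context (R : realType).

Lemma ler_powR2 (p a b : R) : 0 < p -> 0 <= a -> a <= b -> a `^ p <= b `^ p.
Proof.
move=> p0 a0 ab; apply: ge0_ler_powR => //; first exact: ltW.
by rewrite nnegrE (le_trans a0).
Qed.

(** The sum is at most its length times its maximum M, and the p-th power of M is at most the sum of
    the p-th powers. The argument works for every p > 0, whereas q - 1 may be smaller than 1. *)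
Lemma ler_powR_sum (I : eqType) (s : seq I) (t : I -> R) (p : R) : 0 < p ->
  (forall i, i \in s -> 0 <= t i) ->
  (\sum_(i <- s) t i) `^ p <= (size s)%:R `^ p * \sum_(i <- s) t i `^ p.
Proof.
move=> p0 t0.
suff [M [M0 tM Mp]] : exists M, [/\ 0 <= M, forall i, i \in s -> t i <= M & M `^ p <= \sum_(i <- s) t i `^ p].
  apply: (@le_trans _ _ (((size s)%:R * M) `^ p)).
    apply: ler_powR2 => //.
      by rewrite big_seq; apply: sumr_ge0 => i /t0.
    rewrite big_seq; apply: (le_trans (ler_sum _ tM)).
    by rewrite -big_seq big_const_seq count_predT iter_addr addr0 mulr_natl.
  by rewrite powRM// ler_wpM2l ?powR_ge0.
elim: s t0 => [|i s IH] t0.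
  by exists 0; split => //; rewrite big_nil powR0// gt_eqF.
have [M [M0 tM Mp]] := IH (fun j js => t0 j (mem_behead (s := i :: s) js)).
have ti : 0 <= t i by apply: t0; rewrite inE eqxx.
have S0 : 0 <= \sum_(j <- s) t j `^ p by apply: sumr_ge0 => j _; exact: powR_ge0.
exists (Num.max M (t i)); split; first by rewrite le_max M0.
- by move=> j; rewrite inE le_max => /orP[/eqP ->|/tM ->//]; rewrite lexx orbT.
- rewrite big_cons; case: (leP M (t i)) => _; first by rewrite lerDl.
  by apply: (le_trans Mp); rewrite lerDr powR_ge0.
Qed.

(** An affine minorant of t^(p+1) that vanishes at a. Summed over mesh cubes it takes the place of
    Hölder's inequality. *)
Lemma powR_ge_tangent (a t p : R) : 0 < a -> 0 <= t -> 0 < p ->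
  a `^ p * (t - a) <= t * t `^ p.
Proof.
move=> a0 t0 p0; have [ta|at_] := ltP t a.
  apply: (@le_trans _ _ 0); last by rewrite mulr_ge0 ?powR_ge0.
  by rewrite mulr_ge0_le0 ?powR_ge0// subr_le0 ltW.
apply: (@le_trans _ _ (a `^ p * t)).
  by apply: ler_wpM2l; [exact: powR_ge0|rewrite lerBlDr lerDl ltW].
rewrite mulrC; apply: ler_wpM2l => //.
by apply: ler_powR2 => //; exact: ltW.
Qed.

Lemma powR_le_1_exprn (t p : R) (n : nat) : 0 <= t -> 0 < p -> p <= n%:R ->
  t `^ p <= 1 + t ^+ n.
Proof.
move=> t0 p0 pn; have [t1|t1] := leP t 1.
  apply: (@le_trans _ _ 1); last by rewrite lerDl exprn_ge0.
  by have := ler_powR2 p0 t0 t1; rewrite powR1.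
apply: (@le_trans _ _ (t ^+ n)); last by rewrite lerDr.
by rewrite -powR_mulrn//; apply: ler_powR => //; exact: ltW.
Qed.

End PowerSums.

Section EsumSeq.
Context (R : realType) (T : choiceType) (a : T -> \bar R).

Lemma esum_le_seq (B : \bar R) :
  (forall s : seq T, uniq s -> (\sum_(i <- s) a i <= B)%E) ->
  (\esum_(i in [set: T]) a i <= B)%E.
Proof.
move=> h; apply: ub_ereal_sup => _ [F [fF _] <-].
by rewrite fsbig_finite//=; apply: h; exact: finmap.fset_uniq.
Qed.

Lemma seq_le_esum (s : seq T) : (forall i, 0 <= a i)%E -> uniq s ->
  (\sum_(i <- s) a i <= \esum_(i in [set: T]) a i)%E.
Proof.
move=> a0 us; apply: esum_ge; exists [set` s].
  by split => //; exact: finite_seq.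
by rewrite fsbig_seq.
Qed.

End EsumSeq.

Section BorelMeasurability.
Context (R : realType) (n : nat).

Lemma continuous_borel (g : 'rV[R]_n -> R) : continuous g ->
  measurable_fun setT (g : borel_rV R n -> R).
Proof.
move=> cg; apply: (measurability (RGenOpens.G (R := R)) (RGenOpens.measurableE R)).
move=> _ [B [a [b ->]] <-]; rewrite setTI.
apply: sub_sigma_algebra; apply: open_comp => //.
Qed.

Lemma measurable_coord (j : 'I_n) : measurable_fun setT (fun x : borel_rV R n => (x : 'rV[R]_n) 0 j).
Proof. apply: continuous_borel; exact: coord_continuous. Qed.

Lemma measurable_forall_ord d (T : measurableType d) (A : 'I_n -> set T) :
  (forall j, measurable (A j)) -> measurable [set x | forall j, A j x].
Proof.
move=> mA; rewrite (_ : [set x | _] = \bigcap_(j in [set: 'I_n]) A j).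
  by apply: fin_bigcap_measurable.
by apply/seteqP; split => x h j //; exact: h.
Qed.

Lemma measurable_mesh_cube (r : R) (i : 'rV[int]_n) : measurable (mesh_cube r i : set (borel_rV R n)).
Proof.
pose A (j : 'I_n) : set (borel_rV R n) := (fun x : borel_rV R n => (x : 'rV[R]_n) 0 j) @^-1`
   `[(i 0 j)%:~R * r, ((i 0 j)%:~R + 1) * r[%classic.
rewrite (_ : mesh_cube r i = [set x | forall j, A j x]); last first.
  by apply/seteqP; split => x h j; have := h j; rewrite /A /= in_itv.
apply: measurable_forall_ord => j.
by rewrite -[X in measurable X]setTI; apply: measurable_coord.
Qed.

Lemma mesh_cubeP (r : R) (i : 'rV[int]_n) (x : 'rV[R]_n) : 0 < r ->
  mesh_cube r i x <-> forall j, Num.floor (x 0 j / r) = i 0 j.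
Proof.
move=> r0; split => h j.
  have /andP[h1 h2] := h j.
  by apply/eqP; rewrite floor_eq intrD ler_pdivlMr// ltr_pdivrMr// h1.
have := floor_itv (x 0 j / r); rewrite h intrD ler_pdivlMr// ltr_pdivrMr//.
Qed.

Definition mesh_index (r : R) (x : 'rV[R]_n) : 'rV[int]_n := \row_j Num.floor (x 0 j / r).

Lemma mesh_cube_index (r : R) (x : 'rV[R]_n) : 0 < r -> mesh_cube r (mesh_index r x) x.
Proof. by move=> r0; apply/mesh_cubeP => // j; rewrite mxE. Qed.

Lemma mesh_cube_uniq (r : R) (i : 'rV[int]_n) (x : 'rV[R]_n) : 0 < r -> mesh_cube r i x ->
  i = mesh_index r x.
Proof. by move=> r0 /(mesh_cubeP _ _ r0) h; apply/rowP => j; rewrite mxE h. Qed.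

(** Joint measurability of a Carathéodory function: by continuity it is the limit of its values at
    the corner of the mesh cube of side 1 / (m + 1) containing the point, and each approximation is
    measurable since the cubes are countably many. *)
Lemma measurable_caratheodory dd (Omega : measurableType dd) (X : 'rV[R]_n -> Omega -> R) :
  (forall x, measurable_fun setT (X x)) -> (forall w, continuous (X ^~ w)) ->
  measurable_fun setT (fun z : borel_rV R n * Omega => X z.1 z.2).
Proof.
move=> mX cX.
pose r m : R := m.+1%:R^-1.
have r0 m : 0 < r m by rewrite invr_gt0.
pose q m (x : 'rV[R]_n) : 'rV[R]_n := \row_j ((mesh_index (r m) x 0 j)%:~R * r m).
apply: (measurable_fun_cvg (h := fun m (z : borel_rV R n * Omega) => X (q m z.1) z.2)).
  move=> m _ B mB; rewrite setTI.
  rewrite (_ : _ @^-1` B = \bigcup_(i in [set: 'rV[int]_n]) (mesh_cube (r m) i `*`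
     (X (\row_j ((i 0 j)%:~R * r m)) @^-1` B))); last first.
    apply/seteqP; split => [[x w] /= h|[x w] /= [i _ [/= /(mesh_cube_uniq (r0 m)) -> h]] //].
    by exists (mesh_index (r m) x) => //; split => //=; exact: mesh_cube_index.
  apply: countable_bigcupT_measurable.
    exact: countableP.
  move=> i; apply: measurableX; first exact: measurable_mesh_cube.
  by rewrite -[X in measurable X]setTI; exact: mX.
move=> [x w] _ /=.
apply: (continuous_cvg _ (cX w x)).
apply/cvg_ballP => e e0.
have [m0 m0e] : exists m0 : nat, forall m, (m0 <= m)%N -> r m < e.
  exists (Num.bound e^-1) => m hm; rewrite /r invf_plt ?posrE//.
  apply: lt_le_trans (archi_boundP _) _; first by rewrite invr_ge0 ltW.
  by rewrite ler_nat (leq_trans hm).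
exists m0 => // m /= /m0e rme.
split => // i j; rewrite !mxE (ord1 i) /ball /=.
have /andP[] := mesh_cube_index x (r0 m) j; rewrite mxE mulrDl mul1r => h1 h2.
by rewrite ltr_norml; apply/andP; split; lra.
Qed.

End BorelMeasurability.

Lemma measure_bigsetU_le (R : realType) (d : measure_display) (T : measurableType d)
  (mu : {measure set T -> \bar R}) (L : Type) (s : seq L) (B : L -> set T) :
  (forall l, measurable (B l)) ->
  (mu (\big[setU/set0]_(l <- s) B l) <= \sum_(l <- s) mu (B l))%E.
Proof.
move=> mB; elim: s => [|l s IH]; first by rewrite !big_nil measure0.
rewrite !big_cons; apply: le_trans (measureU2 _ _ _) _ => //.
  exact: bigsetU_measurable.
exact: leeD.
Qed.

Section MeshBallComparison.
Context (R : realType) (d : measure_display) (T : measurableType d)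
  (mu : probability T R) (n : nat) (f : T -> 'rV[R]_n) (q : R).
Hypothesis mf : forall j, measurable_fun setT (fun x => f x 0 j).
Hypothesis hq : 1 < q.
Implicit Types (A : set T) (r : R) (i : 'rV[int]_n).

(** Energies of the image measure are written on the source space with a map f. The identity and the
    sample path are then compared on the same pairs of points, and the source can be cut into pieces
    A. *)
Definition near_set A r x : set T := [set y | A y /\ forall j, `|f y 0 j - f x 0 j| < r].
Definition near_mass A r x : R := fine (mu (near_set A r x)).
Definition ball_energy A r : \bar R := (\int[mu]_(x in A) (near_mass A r x `^ (q - 1))%:E)%E.
Definition cell_mass A r i : R := fine (mu (A `&` f @^-1` mesh_cube r i)).

Let q1 : 0 < q - 1. Proof. by rewrite subr_gt0. Qed.
Let q0 : 0 < q. Proof. exact: lt_trans hq. Qed.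

Lemma measurable_cell r i : measurable (f @^-1` mesh_cube r i).
Proof.
pose B j := (fun x => f x 0 j) @^-1` `[(i 0 j)%:~R * r, ((i 0 j)%:~R + 1) * r[%classic.
rewrite (_ : _ @^-1` _ = [set x | forall j, B j x]); last first.
  by apply/seteqP; split => x h j; have := h j; rewrite /B /= in_itv.
apply: measurable_forall_ord => j.
by rewrite -[X in measurable X]setTI; exact: mf.
Qed.

Lemma measurable_near_pairs A r : measurable A ->
  measurable [set z : T * T | A z.2 /\ forall j, `|f z.2 0 j - f z.1 0 j| < r].
Proof.
move=> mA.
rewrite (_ : [set z | _] = (snd @^-1` A) `&` [set z | forall j, `|f z.2 0 j - f z.1 0 j| < r]).
  apply: measurableI; first by rewrite -[X in measurable X]setTI; exact: measurable_snd.
  apply: measurable_forall_ord => j; apply: measurable_lt_cst.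
  apply: measurableT_comp => //; apply: measurable_funB.
    exact: measurableT_comp (mf j) measurable_snd.
  exact: measurableT_comp (mf j) measurable_fst.
by apply/seteqP; split.
Qed.

Lemma near_setE A r x : near_set A r x =
  xsection [set z : T * T | A z.2 /\ forall j, `|f z.2 0 j - f z.1 0 j| < r] x.
Proof. by apply/seteqP; split => y; rewrite /xsection /= inE. Qed.

Lemma measurable_near_set A r x : measurable A -> measurable (near_set A r x).
Proof. by move=> mA; rewrite near_setE; apply: measurable_xsection; exact: measurable_near_pairs. Qed.

Lemma near_massE A r x : measurable A -> mu (near_set A r x) = (near_mass A r x)%:E.
Proof. by move=> mA; rewrite fineK// fin_num_measure//; exact: measurable_near_set. Qed.

Lemma near_mass_ge0 A r x : 0 <= near_mass A r x.
Proof. exact: fine_ge0. Qed.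

Lemma near_mass_le1 A r x : measurable A -> near_mass A r x <= 1.
Proof. by move=> mA; rewrite -lee_fin -near_massE//; apply: probability_le1; exact: measurable_near_set. Qed.

Lemma measurable_near_mass A r : measurable A -> measurable_fun setT (near_mass A r).
Proof.
move=> mA; apply/measurable_EFinP.
rewrite (_ : _ \o _ = mu \o xsection [set z : T * T | A z.2 /\ forall j, `|f z.2 0 j - f z.1 0 j| < r]).
  by apply: measurable_fun_xsection; exact: measurable_near_pairs.
by apply/funext => x /=; rewrite -near_setE near_massE.
Qed.

Lemma measurable_near_mass_powR A r : measurable A ->
  measurable_fun setT (fun x => (near_mass A r x `^ (q - 1))%:E).
Proof.
move=> mA; apply/measurable_EFinP; apply: (measurableT_comp (measurable_powR (q - 1))).
exact: measurable_near_mass.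
Qed.

Lemma cell_massE A r i : measurable A -> mu (A `&` f @^-1` mesh_cube r i) = (cell_mass A r i)%:E.
Proof. by move=> mA; rewrite fineK// fin_num_measure//; apply: measurableI => //; exact: measurable_cell. Qed.

Lemma cell_mass_ge0 A r i : 0 <= cell_mass A r i.
Proof. exact: fine_ge0. Qed.

Lemma cell_trivIset A r (s : set 'rV[int]_n) : 0 < r ->
  trivIset s (fun i => A `&` f @^-1` mesh_cube r i).
Proof.
move=> r0; apply/trivIsetP => i j _ _ ij; apply/seteqP; split => // x [[_ xi] [_ xj]].
by move/eqP: ij; apply; rewrite (mesh_cube_uniq r0 xi) (mesh_cube_uniq r0 xj).
Qed.

Lemma mesh_cube_near r i x y : mesh_cube r i (f x) -> mesh_cube r i (f y) ->
  forall j, `|f y 0 j - f x 0 j| < r.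
Proof.
move=> xi yi j; have /andP[h1 h2] := xi j; have /andP[h3 h4] := yi j.
by rewrite ltr_norml; apply/andP; split; lra.
Qed.

(** Two points of a cube of side r are within r of each other, so that on a cell the near mass is at
    least the mass of the cell; the cells are disjoint. *)
Lemma cells_le_ball_energy A r (s : seq 'rV[int]_n) : measurable A -> 0 < r -> uniq s ->
  (\sum_(i <- s) (cell_mass A r i `^ q)%:E <= ball_energy A r)%E.
Proof.
move=> mA r0 us.
pose D i := A `&` f @^-1` mesh_cube r i.
have mD i : measurable (D i) by apply: measurableI => //; exact: measurable_cell.
apply: (@le_trans _ _ (\sum_(i <- s) \int[mu]_(x in D i) (near_mass A r x `^ (q - 1))%:E)%E).
  apply: lee_sum => i _.
  rewrite -(mulr_powRB1 (cell_mass_ge0 _ _ _) q0) mulrC EFinM -cell_massE//.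
  rewrite -(integral_cst mu (mD i)); apply: ge0_le_integral => //.
  - by move=> x _; rewrite lee_fin powR_ge0.
  - by apply: measurable_funTS; exact: measurable_near_mass_powR.
  - move=> x [Ax xi]; rewrite lee_fin; apply: ler_powR2 => //; first exact: cell_mass_ge0.
    rewrite -lee_fin -cell_massE// -near_massE//; apply: le_measure; rewrite ?inE//.
    + exact: mD.
    + exact: measurable_near_set.
    + by move=> y [Ay yi]; split => //; exact: mesh_cube_near yi.
have mI : measurable_fun setT (fun x => (near_mass A r x `^ (q - 1))%:E).
  exact: measurable_near_mass_powR.
rewrite -ge0_integral_bigsetU//; first last.
- by move=> x _; rewrite lee_fin powR_ge0.
- exact: measurable_funTS.
- exact: cell_trivIset.
apply: ge0_subset_integral => //.
- exact: bigsetU_measurable.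
- exact: measurable_funTS.
- by move=> x _; rewrite lee_fin powR_ge0.
- by rewrite -bigcup_seq => x [i _ []].
Qed.

Definition mesh r : \bar R := mesh_sum (pushforward mu (f : T -> borel_rV R n)) r q.

Lemma meshE r : mesh r = \esum_(i in [set: 'rV[int]_n]) (cell_mass setT r i `^ q)%:E.
Proof.
rewrite /mesh /mesh_sum; apply: eq_esum => i _.
by rewrite /pushforward -poweR_EFin -cell_massE// setTI.
Qed.

(** Cutting the source into |L| pieces costs the factor |L|^q only, which is harmless as long as |L|
    is a power of log (1 / r). *)
Lemma mesh_le_ball_energies (L : finType) (A : L -> set T) r : 0 < r ->
  (forall l, measurable (A l)) -> (forall x, exists l, A l x) ->
  (mesh r <= (#|L|%:R `^ q)%:E * \sum_(l : L) ball_energy (A l) r)%E.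
Proof.
move=> r0 mA cov; rewrite meshE; apply: esum_le_seq => s us.
apply: (@le_trans _ _ (\sum_(i <- s) (#|L|%:R `^ q * \sum_(l : L) cell_mass (A l) r i `^ q)%:E)%E).
  apply: lee_sum => i _; rewrite lee_fin.
  apply: (@le_trans _ _ ((\sum_(l : L) cell_mass (A l) r i) `^ q)).
    apply: ler_powR2 => //; first exact: cell_mass_ge0.
    rewrite -lee_fin -sumEFin -cell_massE//.
    under [leRHS]eq_bigr do rewrite -cell_massE//.
    have mC l : measurable (A l `&` f @^-1` mesh_cube r i).
      by apply: measurableI => //; exact: measurable_cell.
    apply: le_trans (measure_bigsetU_le mu (index_enum L) mC).
    apply: le_measure; rewrite ?inE.
    - by apply: measurableI => //; exact: measurable_cell.
    - by apply: bigsetU_measurable => l _.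
    - move=> x [_ xi]; have [l Alx] := cov x.
      by rewrite -bigcup_seq; exists l => //=; exact: mem_index_enum.
  rewrite cardE -!(big_enum _ _ predT)/=.
  by apply: ler_powR_sum => // l _; exact: cell_mass_ge0.
under eq_bigr do rewrite EFinM.
rewrite -ge0_sume_distrr; last by move=> i _; rewrite lee_fin sumr_ge0// => l _; exact: powR_ge0.
apply: lee_wpmul2l; first by rewrite lee_fin powR_ge0.
under eq_bigr do rewrite -sumEFin.
rewrite exchange_big/=; apply: lee_sum => l _.
exact: cells_le_ball_energy.
Qed.

Lemma integral_cells_le (g : T -> \bar R) r (b : 'rV[int]_n -> \bar R) (B : \bar R) : 0 < r ->
  measurable_fun setT g -> (forall x, 0 <= g x)%E ->
  (forall i, \int[mu]_(x in f @^-1` mesh_cube r i) g x <= b i)%E ->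
  (forall s, uniq s -> \sum_(i <- s) b i <= B)%E -> (\int[mu]_x g x <= B)%E.
Proof.
move=> r0 mg g0 gb bB.
pose F m : set T := if pickle_inv m is Some i then f @^-1` mesh_cube r i else set0.
have mF m : measurable (F m).
  by rewrite /F; case: pickle_inv => // i; exact: measurable_cell.
have UF : \bigcup_m F m = setT.
  apply/seteqP; split => // x _; exists (pickle (mesh_index r (f x))) => //.
  by rewrite /F pickleK_inv; exact: mesh_cube_index.
have tF : trivIset setT F.
  apply/trivIsetP => m m' _ _ mm'; apply/seteqP; split => // x []; rewrite /F.
  case Em : (pickle_inv m) => [i|]//; case Em' : (pickle_inv m') => [i'|]// xi xi'.
  have ii' : i = i' by rewrite (mesh_cube_uniq r0 xi) (mesh_cube_uniq r0 xi').
  have := @pickle_invK 'rV[int]_n m; rewrite Em /= => e1.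
  have := @pickle_invK 'rV[int]_n m'; rewrite Em' /= => e2.
  by move/eqP: mm'; rewrite -e1 -e2 ii'.
rewrite -UF ge0_integral_bigcup//; last by rewrite UF.
apply: lime_le.
  by apply: is_cvg_nneseries => m _ _; apply: integral_ge0.
apply: nearW => M.
apply: le_trans (bB (pmap (@pickle_inv 'rV[int]_n) (index_iota 0 M)) _); last first.
  apply: (pmap_uniq (@pickle_invK _)); exact: iota_uniq.
elim: (index_iota 0 M) => [|m s IH]; first by rewrite !big_nil.
rewrite big_cons /= /F; case: pickle_inv => [i|]/=.
  by rewrite big_cons; apply: leeD.
by rewrite integral_set0 add0e.
Qed.

Lemma le_ball_energy A r r' : measurable A -> r <= r' -> (ball_energy A r <= ball_energy A r')%E.
Proof.
move=> mA rr'; apply: ge0_le_integral => //.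
- by move=> x _; rewrite lee_fin powR_ge0.
- by apply: measurable_funTS; exact: measurable_near_mass_powR.
- by apply: measurable_funTS; exact: measurable_near_mass_powR.
move=> x _; rewrite lee_fin; apply: ler_powR2 => //; first exact: near_mass_ge0.
rewrite -lee_fin -!near_massE//; apply: le_measure; rewrite ?inE; try exact: measurable_near_set.
by move=> y [Ay yx]; split => // j; apply: lt_le_trans (yx j) rr'.
Qed.

(** The e j - k run through the integers of [- k, k]; a finite type of shifts makes their number
    available as a constant. *)
Definition cell_shift (k : nat) (i : 'rV[int]_n) (e : {ffun 'I_n -> 'I_(2 * k).+1}) : 'rV[int]_n :=
  \row_j (i 0 j + (e j)%:Z - k%:Z).

Lemma near_mass_le_cells (k : nat) r i x : 0 < r -> mesh_cube r i (f x) ->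
  near_mass setT (k%:R * r) x <= \sum_(e : {ffun 'I_n -> 'I_(2 * k).+1}) cell_mass setT r (cell_shift i e).
Proof.
move=> r0 xi; rewrite -lee_fin -sumEFin -near_massE//.
under eq_bigr do rewrite -cell_massE//.
have mC e : measurable ([set: T] `&` f @^-1` mesh_cube r (@cell_shift k i e)).
  by apply: measurableI => //; exact: measurable_cell.
apply: le_trans (measure_bigsetU_le mu (index_enum _) mC).
apply: le_measure; rewrite ?inE; first exact: measurable_near_set.
  by apply: bigsetU_measurable => e _.
move=> y [_ yx]; rewrite -bigcup_seq.
have bnd j : 0 <= Num.floor (f y 0 j / r) - i 0 j + k%:Z < (2 * k).+1%:Z.
  have := yx j; have /andP[h1 h2] := xi j; rewrite ltr_norml => /andP[h3 h4].
  have /andP[h5 h6] := floor_itv (f y 0 j / r).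
  move: h5 h6; rewrite intrD ler_pdivlMr// ltr_pdivrMr// => h5 h6.
  set u := Num.floor _ in h5 h6 *.
  have a1 : (i 0 j - k%:Z)%:~R < (u + 1)%:~R :> R.
    rewrite intrB intrD -(ltr_pM2r r0) /= -[(k%:Z)%:~R]/(k%:R); lra.
  have a2 : u%:~R < (i 0 j + 1 + k%:Z)%:~R :> R.
    rewrite !intrD -(ltr_pM2r r0) /= -[(k%:Z)%:~R]/(k%:R); lra.
  by move: a1 a2; rewrite !ltr_int => a1 a2; clear - a1 a2; apply/andP; split; lia.
pose e := [ffun j => inord (absz (Num.floor (f y 0 j / r) - i 0 j + k%:Z))] : {ffun 'I_n -> 'I_(2 * k).+1}.
exists e => /=; first exact: mem_index_enum.
split => //; apply/mesh_cubeP => // j.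
rewrite mxE ffunE inordK; have /andP[b1 b2] := bnd j; last by lia.
by rewrite gez0_abs//; lia.
Qed.

(** The ball of radius k r around a point of a cube is covered by the (2 k + 1)^n neighbours of that
    cube, itself included, and each cube is a neighbour of as many. Together with
    [mesh_le_ball_energies] this makes mesh sums and energies comparable. *)
Lemma ball_energy_le_mesh (k : nat) r : 0 < r ->
  (ball_energy setT (k%:R * r) <=
    ((#|{ffun 'I_n -> 'I_(2 * k).+1}|%:R : R) `^ q * #|{ffun 'I_n -> 'I_(2 * k).+1}|%:R)%:E * mesh r)%E.
Proof.
move=> r0; set E := ({ffun 'I_n -> 'I_(2 * k).+1} : finType).
pose b i : \bar R := (#|E|%:R `^ q * \sum_(e : E) cell_mass setT r (cell_shift i e) `^ q)%:E.
apply: (integral_cells_le r0 (b := b)).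
- exact: measurable_near_mass_powR.
- by move=> x; rewrite lee_fin powR_ge0.
- move=> i; pose t := \sum_(e : E) cell_mass setT r (cell_shift i e).
  have t0 : 0 <= t by apply: sumr_ge0 => e _; exact: cell_mass_ge0.
  apply: (@le_trans _ _ ((t `^ (q - 1))%:E * mu (f @^-1` mesh_cube r i))%E).
    rewrite -(integral_cst mu (measurable_cell r i)).
    apply: ge0_le_integral => //.
    + exact: measurable_cell.
    + by move=> x _; rewrite lee_fin powR_ge0.
    + by apply: measurable_funTS; exact: measurable_near_mass_powR.
    + move=> x xi; rewrite lee_fin; apply: ler_powR2 => //; first exact: near_mass_ge0.
      exact: near_mass_le_cells.
  have it : mu (f @^-1` mesh_cube r i) = (cell_mass setT r i)%:E by rewrite -cell_massE// setTI.
  rewrite it -EFinM lee_fin.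
  apply: (@le_trans _ _ (t `^ q)).
    rewrite -(mulr_powRB1 t0 q0) mulrC; apply: ler_wpM2r; first exact: powR_ge0.
    pose e0 : E := [ffun=> inord k].
    rewrite /t (bigD1 e0)//= (_ : cell_shift i e0 = i).
      by rewrite lerDl; apply: sumr_ge0 => e _; exact: cell_mass_ge0.
    apply/rowP => j; rewrite mxE ffunE inordK; last by rewrite ltnS mul2n -addnn leq_addr.
    by rewrite addrK.
  rewrite cardE /t -!(big_enum _ _ predT)/=.
  by apply: ler_powR_sum => // e _; exact: cell_mass_ge0.
move=> s us; rewrite /b.
under eq_bigr do rewrite EFinM.
rewrite -ge0_sume_distrr; last by move=> i _; rewrite lee_fin sumr_ge0// => e _; exact: powR_ge0.
rewrite EFinM -muleA; apply: lee_wpmul2l; first by rewrite lee_fin powR_ge0.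
under eq_bigr do rewrite -sumEFin.
rewrite exchange_big/=.
apply: (@le_trans _ _ (\sum_(e : E) mesh r)%E).
  apply: lee_sum => e _; rewrite meshE.
  rewrite -(big_map (fun i => cell_shift i e) xpredT (fun i => (cell_mass setT r i `^ q)%:E)).
  apply: seq_le_esum; first by move=> i; rewrite lee_fin powR_ge0.
  rewrite map_inj_uniq// => i i' /rowP h; apply/rowP => j.
  by have := h j; rewrite !mxE => /addIr/addIr.
by rewrite sumr_const mule_natl.
Qed.

End MeshBallComparison.

(** * Lower and upper limits at 0+ *)

Section LimInfSup.
Context (R : realType) (g : R -> \bar R).
Notation F := (0^'+ : set_system R).

Lemma limf_einf_ge (s : \bar R) : (\forall r \near F, s <= g r)%E -> (s <= limf_einf g F)%E.
Proof.
move=> h; rewrite limf_einfE; apply: ereal_sup_ge.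
exists (ereal_inf (g @` [set r | (s <= g r)%E])).
  by exists [set r | (s <= g r)%E].
by apply: le_ereal_inf_tmp => _ [r /= sr <-].
Qed.

Lemma limf_esup_le (s : \bar R) : (\forall r \near F, g r <= s)%E -> (limf_esup g F <= s)%E.
Proof.
move=> h; rewrite limf_esupE; apply: ereal_inf_le.
exists (ereal_sup (g @` [set r | (g r <= s)%E])).
  by exists [set r | (g r <= s)%E].
by apply: ub_ereal_sup => _ [r /= sr <-].
Qed.

Lemma near_of_lt_limf_einf (s : \bar R) : (s < limf_einf g F)%E -> (\forall r \near F, s <= g r)%E.
Proof.
rewrite limf_einfE => /ereal_sup_gt[_ [V FV <-] sV].
apply: filterS FV => r Vr; apply/ltW/(lt_le_trans sV).
by apply: ereal_inf_lbound; exists r.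
Qed.

Lemma near_of_limf_esup_lt (s : \bar R) : (limf_esup g F < s)%E -> (\forall r \near F, g r <= s)%E.
Proof.
rewrite limf_esupE => /ereal_inf_lt[_ [V FV <-] sV].
apply: filterS FV => r Vr; apply/ltW/(le_lt_trans _ sV).
by apply: ereal_sup_ubound; exists r.
Qed.

Lemma limf_einf_le_freq (s : \bar R) :
  (forall e : R, 0 < e -> exists2 r, 0 < r < e & (g r <= s)%E) -> (limf_einf g F <= s)%E.
Proof.
move=> h; rewrite limf_einfE; apply: ub_ereal_sup => _ [V FV <-].
have [e /= e0 eV] := FV.
have [r /andP[r0 re] rs] := h e e0.
apply: ereal_inf_le; exists (g r) => //; exists r => //.
by apply: eV => //=; rewrite sub0r normrN gtr0_norm.
Qed.

Lemma freq_of_limf_einf_lt (s : \bar R) : (limf_einf g F < s)%E ->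
  forall e : R, 0 < e -> exists2 r, 0 < r < e & (g r <= s)%E.
Proof.
move=> h e e0; apply: contrapT => /forall2NP nx.
move: h; rewrite ltNge => /negP; apply; apply: limf_einf_ge.
near=> r.
have [|/negP] := nx r.
  move=> nr; exfalso; apply: nr; apply/andP; split; near: r.
    exact: nbhs_right_gt.
  exact: nbhs_right_lt.
by rewrite -ltNge => /ltW.
Unshelve. all: by end_near. Qed.

Lemma limf_einf_le_esup : (limf_einf g F <= limf_esup g F)%E.
Proof.
rewrite limf_einfE limf_esupE; apply: ub_ereal_sup => _ [V FV <-].
apply: le_ereal_inf_tmp => _ [W FW <-].
have [r [Vr Wr]] : (V `&` W) !=set0 by exact: (@filter_ex _ F _ _ (filterI FV FW)).
apply: (@le_trans _ _ (g r)).
  by apply: ereal_inf_lbound; exists r.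
by apply: ereal_sup_ubound; exists r.
Qed.

End LimInfSup.

(** * Lower bounds for mesh sums of measures carried by a box *)

Lemma box_mesh_cover (R : realType) (n m : nat) (b r : R) (x : 'rV[R]_n) : 0 < r -> b < m%:R * r ->
  (forall j, `|x 0 j| <= b) ->
  exists e : {ffun 'I_n -> 'I_(2 * m).+1}, mesh_cube r (cell_shift 0 e) x.
Proof.
move=> r0 bm xb.
have bnd j : 0 <= Num.floor (x 0 j / r) + m%:Z < (2 * m).+1%:Z.
  have := xb j; rewrite ler_norml => /andP[h3 h4].
  have /andP[h5 h6] := floor_itv (x 0 j / r).
  move: h5 h6; rewrite intrD ler_pdivlMr// ltr_pdivrMr// => h5 h6.
  set u := Num.floor _ in h5 h6 *.
  have a1 : (- m%:Z)%:~R < (u + 1)%:~R :> R.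
    rewrite intrN intrD -(ltr_pM2r r0) /= -[(m%:Z)%:~R]/(m%:R); lra.
  have a2 : u%:~R < (m%:Z)%:~R :> R.
    rewrite -(ltr_pM2r r0) /= -[(m%:Z)%:~R]/(m%:R); lra.
  move: a1 a2; rewrite !ltr_int => a1 a2; apply/andP; split; lia.
exists [ffun j => inord (absz (Num.floor (x 0 j / r) + m%:Z))].
apply/mesh_cubeP => // j; rewrite !mxE ffunE inordK; have /andP[b1 b2] := bnd j; last by lia.
by rewrite gez0_abs// add0r addrK.
Qed.

Section MeshLowerBound.
Context (R : realType) (d : measure_display) (T : measurableType d)
  (mu : probability T R) (n : nat) (f : T -> 'rV[R]_n) (q : R).
Hypothesis mf : forall j, measurable_fun setT (fun x => f x 0 j).
Hypothesis hq : 1 < q.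
Notation mesh := (mesh mu f q).
Notation ball_energy := (ball_energy mu f q).

Let q1 : 0 < q - 1. Proof. by rewrite subr_gt0. Qed.
Let q0 : 0 < q. Proof. exact: lt_trans hq. Qed.

Lemma mesh_ge0 r : (0 <= mesh r)%E.
Proof. by rewrite meshE//; apply: esum_ge0 => i _; rewrite lee_fin powR_ge0. Qed.

Lemma ball_energy_le1 r : (ball_energy setT r <= 1)%E.
Proof.
rewrite -(@probability_setT _ _ _ mu) -[leRHS]mul1e -integral_cst//.
apply: ge0_le_integral => //.
- by move=> x _; rewrite lee_fin powR_ge0.
- exact: measurable_near_mass_powR.
move=> x _; rewrite lee_fin.
by have := ler_powR2 q1 (near_mass_ge0 mu f setT r x) (near_mass_le1 mu mf r x measurableT); rewrite powR1.
Qed.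

Lemma mesh_le_ball_energy r : 0 < r -> (mesh r <= ball_energy setT r)%E.
Proof.
move=> r0.
have := @mesh_le_ball_energies _ _ _ mu n f q mf hq unit (fun _ => setT) r r0 (fun _ => measurableT) (fun x => ex_intro _ tt I).
by rewrite card_unit powR1 mul1e (bigD1 tt)//= big1 ?adde0//; case.
Qed.

Lemma mesh_le1 r : 0 < r -> (mesh r <= 1)%E.
Proof. by move=> r0; apply: le_trans (mesh_le_ball_energy r0) _; exact: ball_energy_le1. Qed.

(** The unit mass sits in J = (2 m + 1)^n cubes. With a = 1 / (2 J) the affine minorant sums to at
    least a^(q-1) (1 - J a), which is a^(q-1) / 2. *)
Lemma mesh_ge_card (B r : R) (m : nat) : 0 < r -> B < m%:R * r ->
  mu [set x | forall j, `|f x 0 j| <= B] = 1%E ->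
  (((2 * (2 * m).+1%:R ^+ n)^-1 `^ (q - 1) / 2)%:E <= mesh r)%E.
Proof.
move=> r0 Bm muB.
pose E := ({ffun 'I_n -> 'I_(2 * m).+1} : finType).
pose J : R := (2 * m).+1%:R ^+ n.
have cE : #|E|%:R = J by rewrite card_ffun !card_ord natrX.
have J0 : 0 < J by rewrite exprn_gt0.
pose a : R := (2 * J)^-1.
have a0 : 0 < a by rewrite invr_gt0 mulr_gt0.
pose c (e : E) : R := cell_mass mu f setT r (cell_shift 0 e).
have c0 e : 0 <= c e by exact: cell_mass_ge0.
have mC e : measurable ([set: T] `&` f @^-1` mesh_cube r (@cell_shift n m 0 e)).
  by apply: measurableI => //; exact: measurable_cell.
have cov : 1 <= \sum_(e : E) c e.
  rewrite -lee_fin -muB -sumEFin.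
  under eq_bigr do rewrite /c -cell_massE//.
  apply: le_trans (measure_bigsetU_le mu (index_enum _) mC).
  apply: le_measure; rewrite ?inE.
  - apply: measurable_forall_ord => j.
    by apply: measurable_le_cst; exact: measurableT_comp (mf j).
  - by apply: bigsetU_measurable => e _.
  move=> x xB; rewrite -bigcup_seq.
  by have [e he] := box_mesh_cover r0 Bm xB; exists e => /=; [exact: mem_index_enum|split].
have inj : injective (@cell_shift n m 0).
  move=> e e' /rowP h; apply/ffunP => j; have := h j; rewrite !mxE => /addIr/addrI[] h'.
  exact: val_inj.
apply: (@le_trans _ _ (\sum_(e : E) (c e `^ q)%:E)%E); last first.
  rewrite meshE// /c -(big_map (@cell_shift n m 0) xpredT (fun i => (cell_mass mu f setT r i `^ q)%:E)).
  apply: seq_le_esum; first by move=> i; rewrite lee_fin powR_ge0.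
  by rewrite map_inj_uniq// index_enum_uniq.
rewrite sumEFin lee_fin.
apply: (@le_trans _ _ (\sum_(e : E) (a `^ (q - 1) * (c e - a)))); last first.
  apply: ler_sum => e _; rewrite -(mulr_powRB1 (c0 e) q0).
  exact: powR_ge_tangent.
rewrite -mulr_sumr sumrB sumr_const -/J -/a.
apply: ler_wpM2l; first exact: powR_ge0.
have aJ : a *+ #|E| = 2^-1.
  transitivity (#|E|%:R * a); first by rewrite mulr_natl.
  by rewrite cE /a; field; rewrite gt_eqF.
rewrite (_ : a *+ _ = 2^-1); last exact: aJ.
by move: cov; lra.
Qed.

Lemma mesh_lower (B : R) : 0 <= B -> mu [set x | forall j, `|f x 0 j| <= B] = 1%E ->
  exists2 c : R, 0 < c & forall r, 0 < r <= 1 ->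
    ((c * r `^ (n%:R * (q - 1)))%:E <= mesh r)%E.
Proof.
(* For m = floor (B / r) + 1 and r <= 1, (2 m + 1) r is at most 2 B + 3, hence at most K. *)
move=> B0 muB; pose K := 2 * B + 5.
have K0 : 0 < K by rewrite /K; lra.
exists ((2 * K ^+ n)^-1 `^ (q - 1) / 2).
  by rewrite divr_gt0 ?powR_gt0 ?invr_gt0 ?mulr_gt0 ?exprn_gt0.
move=> r /andP[r0 r1].
have Br0 : 0 <= B / r by rewrite divr_ge0// ltW.
have f0 : 0 <= Num.floor (B / r) by rewrite floor_ge0.
pose m := (absz (Num.floor (B / r))).+1.
have /andP[fl1 fl2] := floor_itv (B / r).
have mE : m%:R = (Num.floor (B / r))%:~R + 1 :> R.
  by rewrite /m -natr1 -[_%:R in LHS]/((absz (Num.floor (B / r)))%:Z%:~R) gez0_abs.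
have Bm : B < m%:R * r by rewrite -ltr_pdivrMr// mE -intrD1.
apply: le_trans (mesh_ge_card r0 Bm muB); rewrite lee_fin.
have mK : (2 * m).+1%:R <= K / r.
  rewrite -natr1 natrM mE ler_pdivlMr//.
  have h : (Num.floor (B / r))%:~R * r <= B by rewrite -ler_pdivlMr.
  rewrite /K; nra.
have KV0 : 0 <= (2 * K ^+ n)^-1 by rewrite invr_ge0 mulr_ge0// exprn_ge0// ltW.
have rn0 : 0 <= r ^+ n by rewrite exprn_ge0// ltW.
rewrite mulrAC ler_pM2r// mulrC powRrM powR_mulrn; last exact: ltW.
rewrite -powRM//; apply: ler_powR2 => //; first exact: mulr_ge0.
rewrite -[r ^+ n]invrK -exprVn -invfM lef_pV2 ?posrE ?mulr_gt0 ?exprn_gt0 ?invr_gt0//.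
rewrite mulrCA ler_pM2l// -exprMn [r^-1 * K]mulrC.
by apply: lerXn2r; rewrite ?nnegrE ?divr_ge0// ltW.
Qed.

End MeshLowerBound.

(** * Generalized dimensions from dyadic scales *)

Section GenDimScaling.
Context (R : realType) (d : measure_display) (T : measurableType d)
  (mu : probability T R) (n : nat) (f : T -> 'rV[R]_n) (q : R).
Hypothesis mf : forall j, measurable_fun setT (fun x => f x 0 j).
Hypothesis hq : 1 < q.
Variable B : R.
Hypothesis B0 : 0 <= B.
Hypothesis muB : mu [set x | forall j, `|f x 0 j| <= B] = 1%E.
Notation mesh := (mesh mu f q).
Notation energy := (ball_energy mu f q setT).
Notation nu := (pushforward mu (f : T -> borel_rV R n)).

Let q1 : 0 < q - 1. Proof. by rewrite subr_gt0. Qed.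

Lemma mesh_fin r : 0 < r <= 1 -> exists2 m : R, 0 < m & mesh r = m%:E.
Proof.
move=> /andP[r0 r1]; have [c c0 /(_ r)] := mesh_lower mf hq B0 muB.
rewrite r0 r1 => /(_ isT); have := mesh_le1 mu mf hq r0.
case: mesh => [m _||]//; rewrite lee_fin => h; exists m => //.
by apply: lt_le_trans h; rewrite mulr_gt0// powR_gt0.
Qed.

Lemma dim_quotient_ge s r : 0 < r < 1 ->
  (s%:E <= dim_quotient nu q r)%E = (mesh r <= (r `^ ((q - 1) * s))%:E)%E.
Proof.
move=> /andP[r0 r1]; have [|m m0 mE] := @mesh_fin r; first by rewrite r0 ltW.
have lr : ln r < 0 by rewrite ln_lt0// r0.
rewrite /dim_quotient -/(mesh r) mE /= !lee_fin.
rewrite -[in RHS]ler_ln ?posrE ?powR_gt0// ln_powR.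
rewrite ler_ndivlMr; last by rewrite nmulr_llt0.
by rewrite mulrCA mulrA.
Qed.

Lemma dim_quotient_le s r : 0 < r < 1 ->
  (dim_quotient nu q r <= s%:E)%E = ((r `^ ((q - 1) * s))%:E <= mesh r)%E.
Proof.
move=> /andP[r0 r1]; have [|m m0 mE] := @mesh_fin r; first by rewrite r0 ltW.
have lr : ln r < 0 by rewrite ln_lt0// r0.
rewrite /dim_quotient -/(mesh r) mE /= !lee_fin.
rewrite -[in RHS]ler_ln ?posrE ?powR_gt0// ln_powR.
rewrite ler_ndivrMr; last by rewrite nmulr_llt0.
by rewrite mulrCA mulrA.
Qed.

Lemma near_unit : \forall r \near (0 : R)^'+, 0 < r < 1.
Proof.
near=> r; apply/andP; split; near: r; first exact: nbhs_right_gt.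
exact: nbhs_right_lt.
Unshelve. all: by end_near. Qed.

Lemma energy_fin r : energy r = (fine (energy r))%:E.
Proof.
rewrite fineK// ge0_fin_numE; last by apply: integral_ge0 => x _; rewrite lee_fin powR_ge0.
by apply: le_lt_trans (ball_energy_le1 mu mf hq r) _; rewrite ltry.
Qed.

Lemma energy_le_mesh : exists2 K : R, 0 < K & forall r, 0 < r -> (energy r <= K%:E * mesh r)%E.
Proof.
set K := (#|{ffun 'I_n -> 'I_(2 * 1).+1}|%:R : R) `^ q * #|{ffun 'I_n -> 'I_(2 * 1).+1}|%:R.
exists (K + 1).
  by rewrite ltr_wpDl// /K mulr_ge0// powR_ge0.
move=> r r0; have := @ball_energy_le_mesh _ _ _ mu n f q mf hq 1 r r0.
rewrite mul1r => /le_trans; apply.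
by apply: lee_wpmul2r; [exact: mesh_ge0 | rewrite lee_fin lerDl].
Qed.

Lemma powR_cvg0 (e : R) : 0 < e -> forall c : R, 0 < c -> \forall r \near (0 : R)^'+, r `^ e <= c.
Proof.
move=> e0 c c0; near=> r.
have r0 : 0 < r by near: r; exact: nbhs_right_gt.
rewrite -[leRHS](powRr1 (ltW c0)) -(mulVf (lt0r_neq0 e0)) powRrM.
apply: ler_powR2 => //.
by near: r; apply: nbhs_right_le; exact: powR_gt0.
Unshelve. all: by end_near. Qed.

Lemma lower_dim_ge (s C : R) :
  (\forall r \near (0 : R)^'+, mesh r <= (C * r `^ ((q - 1) * s))%:E)%E ->
  (s%:E <= lower_gen_dim nu q)%E.
Proof.
move=> h; apply/lee_addgt0Pr => e e0; rewrite -leeBlDr//; apply: limf_einf_ge.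
have C0 : 0 < `|C| + 1 by rewrite ltr_wpDl.
have := @powR_cvg0 ((q - 1) * e) (mulr_gt0 q1 e0) (`|C| + 1)^-1; rewrite invr_gt0 => /(_ C0) he.
have hu := near_unit.
near=> r.
have ru : 0 < r < 1 by near: r.
have /andP[r0 r1] := ru.
rewrite -EFinB dim_quotient_ge//.
have hr0 : (mesh r <= (C * r `^ ((q - 1) * s))%:E)%E by near: r.
apply: le_trans hr0 _.
rewrite lee_fin mulrBr powRD; last by rewrite (gt_eqF r0) implybT.
rewrite powRN mulrC; apply: ler_wpM2l; first exact: powR_ge0.
have hr : r `^ ((q - 1) * e) <= (`|C| + 1)^-1 by near: r.
apply: (@le_trans _ _ (`|C| + 1)); first by rewrite (le_trans (ler_norm _))// lerDl.
by rewrite -[leLHS]invrK lef_pV2// posrE ?invr_gt0// powR_gt0.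
Unshelve. all: by end_near. Qed.

Lemma lower_dim_ge0 : (0 <= lower_gen_dim nu q)%E.
Proof.
apply: (@lower_dim_ge 0 1); near=> r; rewrite mulr0 powRr0 mul1r; exact: mesh_le1.
Unshelve. all: by end_near. Qed.

Lemma upper_dim_le (s c : R) : 0 < c ->
  (\forall r \near (0 : R)^'+, (c * r `^ ((q - 1) * s))%:E <= energy r)%E ->
  (upper_gen_dim nu q <= s%:E)%E.
Proof.
move=> c0 h; apply/lee_addgt0Pr => e e0; rewrite -EFinD; apply: limf_esup_le.
have [K K0 hK] := energy_le_mesh.
have := @powR_cvg0 ((q - 1) * e) (mulr_gt0 q1 e0) (c / K); rewrite divr_gt0// => /(_ isT) he.
have hu := near_unit.
near=> r.
have ru : 0 < r < 1 by near: r.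
have /andP[r0 r1] := ru.
rewrite dim_quotient_le// -(@lee_pmul2l _ K%:E)//.
have hr0 : ((c * r `^ ((q - 1) * s))%:E <= energy r)%E by near: r.
apply: le_trans (hK r r0); apply: le_trans hr0.
rewrite -EFinM lee_fin mulrDr powRD; last by rewrite (gt_eqF r0) implybT.
rewrite mulrCA mulrC; apply: ler_wpM2r; first exact: powR_ge0.
rewrite mulrC -ler_pdivlMr//.
by near: r.
Unshelve. all: by end_near. Qed.

Lemma lower_dim_le_freq (s c : R) : 0 < c ->
  (forall e : R, 0 < e -> exists2 r, 0 < r < e & ((c * r `^ ((q - 1) * s))%:E <= energy r)%E) ->
  (lower_gen_dim nu q <= s%:E)%E.
Proof.
move=> c0 h; apply/lee_addgt0Pr => e e0; rewrite -EFinD; apply: limf_einf_le_freq => e1 e10.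
have [K K0 hK] := energy_le_mesh.
have := @powR_cvg0 ((q - 1) * e) (mulr_gt0 q1 e0) (c / K); rewrite divr_gt0// => /(_ isT) [e2 /= e20 he].
have [|r /andP[r0 re] hr] := h (Num.min e1 (Num.min e2 1)).
  by rewrite !lt_min e10 e20/=.
move: re; rewrite !lt_min => /and3P[re1 re2 r1].
exists r; first by rewrite r0.
rewrite dim_quotient_le ?r0// -(@lee_pmul2l _ K%:E)//.
apply: le_trans (hK r r0); apply: le_trans hr.
rewrite -EFinM lee_fin mulrDr powRD; last by rewrite (gt_eqF r0) implybT.
rewrite mulrCA mulrC; apply: ler_wpM2r; first exact: powR_ge0.
rewrite mulrC -ler_pdivlMr//.
by apply: he => //=; rewrite sub0r normrN gtr0_norm.
Qed.

Lemma upper_dim_le_dim : (upper_gen_dim nu q <= n%:R%:E)%E.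
Proof.
have [c c0 hc] := mesh_lower mf hq B0 muB.
apply: (@upper_dim_le _ c) => //.
have hu := near_unit.
near=> r.
have /andP[r0 r1] : 0 < r < 1 by near: r.
rewrite mulrC [_ * n%:R]mulrC mulrC; apply: le_trans (mesh_le_ball_energy mu mf hq r0).
by apply: hc; rewrite r0 ltW.
Unshelve. all: by end_near. Qed.

Lemma energy_upper (s : R) : (s%:E < lower_gen_dim nu q)%E ->
  exists2 C : R, 0 < C & forall r, 0 < r <= 1 -> (energy r <= (C * r `^ ((q - 1) * s))%:E)%E.
Proof.
move=> /near_of_lt_limf_einf[e /= e0 he].
have [K K0 hK] := energy_le_mesh.
pose e' := Num.min e 1; have e'0 : 0 < e' by rewrite lt_min e0/=.
(* A positive lower bound of r^((q-1) s) on [e', 1], for either sign of s; above e' the energy is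
   only known to be at most 1. *)
pose m := Num.min (e' `^ ((q - 1) * s)) 1.
have m0 : 0 < m by rewrite lt_min powR_gt0//=.
exists (K + m^-1); first by rewrite addr_gt0// invr_gt0.
move=> r /andP[r0 r1]; have p0 := powR_ge0 r ((q - 1) * s).
have [re|re] := ltP r e'.
  move: re; rewrite lt_min => /andP[re r1'].
  apply: le_trans (hK r r0) _; apply: (@le_trans _ _ (K%:E * (r `^ ((q - 1) * s))%:E)%E).
    apply: lee_wpmul2l; first by rewrite lee_fin ltW.
    rewrite -dim_quotient_ge ?r0//; apply: he => //=.
    by rewrite sub0r normrN gtr0_norm.
  by rewrite -EFinM lee_fin; apply: ler_wpM2r => //; rewrite lerDl invr_ge0 ltW.
apply: le_trans (ball_energy_le1 mu mf hq r) _; rewrite lee_fin.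
apply: (@le_trans _ _ (m^-1 * r `^ ((q - 1) * s))); last first.
  by apply: ler_wpM2r => //; rewrite lerDr ltW.
rewrite mulrC ler_pdivlMr// mul1r /m.
have [s0|s0] := leP 0 ((q - 1) * s).
  apply: le_trans (_ : e' `^ ((q - 1) * s) <= _); first by rewrite ge_min lexx.
  move: s0; rewrite le_eqVlt => /predU1P[<-|s0]; first by rewrite !powRr0.
  by apply: ler_powR2 => //; rewrite ltW.
apply: le_trans (_ : 1 <= _); first by rewrite ge_min lexx orbT.
rewrite -[X in _ `^ X]opprK powRN -[leLHS]invr1 lef_pV2 ?posrE ?powR_gt0//.
have := @ler_powR2 _ (- ((q - 1) * s)) r 1; rewrite oppr_gt0 s0 (ltW r0) r1 powR1.
by apply.
Qed.

Lemma energy_lower_near (s : R) : (upper_gen_dim nu q < s%:E)%E ->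
  (\forall r \near (0 : R)^'+, (r `^ ((q - 1) * s))%:E <= energy r)%E.
Proof.
move=> /near_of_limf_esup_lt h; have hu := near_unit; near=> r.
have ru : 0 < r < 1 by near: r.
have /andP[r0 r1] := ru.
by apply: le_trans (mesh_le_ball_energy mu mf hq r0); rewrite -dim_quotient_le//; near: r.
Unshelve. all: by end_near. Qed.

Lemma energy_lower_freq (s : R) : (lower_gen_dim nu q < s%:E)%E ->
  forall e : R, 0 < e -> exists2 r, 0 < r < e & ((r `^ ((q - 1) * s))%:E <= energy r)%E.
Proof.
move=> /freq_of_limf_einf_lt h e e0.
have [|r /andP[r0]] := h (Num.min e 1); first by rewrite lt_min e0/=.
rewrite lt_min => /andP[re r1] hr; exists r; first by rewrite r0.
by apply: le_trans (mesh_le_ball_energy mu mf hq r0); rewrite -dim_quotient_le ?r0.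
Qed.

End GenDimScaling.

Definition dyadic (R : realType) (n : nat) : R := 2^-1 ^+ n.

Section Dyadic.
Variable R : realType.
Implicit Types r b : R.

Lemma dyadic_gt0 n : 0 < dyadic R n.
Proof. by rewrite exprn_gt0// invr_gt0. Qed.

Lemma dyadic_le1 n : dyadic R n <= 1.
Proof. by rewrite exprn_ile1// ?invf_le1// ?invr_ge0// ler1n. Qed.

Lemma dyadicS n : dyadic R n.+1 = dyadic R n / 2.
Proof. by rewrite /dyadic exprS mulrC. Qed.

Lemma dyadic_le m n : (m <= n)%N -> dyadic R n <= dyadic R m.
Proof. by move=> mn; rewrite /dyadic ler_wiXn2l// ?invr_ge0// invf_le1// ler1n. Qed.

Lemma dyadic_small r : 0 < r -> exists n, forall m, (n <= m)%N -> dyadic R m < r.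
Proof.
move=> r0; have [n nr] : exists n, dyadic R n < r.
  have /cvgrPdist_lt /(_ r r0)[n _ /(_ n (leqnn n)) h] : (fun n => 2^-1 ^+ n : R) @ \oo --> (0 : R).
    by apply: cvg_expr; rewrite ger0_norm ?invr_ge0// invf_lt1// ltr1n.
  by exists n; move: h; rewrite /= sub0r normrN; apply: le_lt_trans; exact: ler_norm.
by exists n => m nm; apply: le_lt_trans nr; exact: dyadic_le.
Qed.

Lemma dyadic_scale r n0 : 0 < r -> r < dyadic R n0 ->
  exists2 n, (n0 <= n)%N & dyadic R n.+1 <= r < dyadic R n.
Proof.
move=> r0 rn0.
have ex : exists n, dyadic R n <= r.
  by have [n /(_ n (leqnn n)) nr] := dyadic_small r0; exists n; exact: ltW.
case: (ex_minnP ex) => -[|m] mr min.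
  by move: rn0; rewrite ltNge (le_trans _ mr)//; exact: dyadic_le.
exists m; last by rewrite mr ltNge; apply/negP => /min; rewrite ltnn.
rewrite leqNgt; apply/negP => mn0.
by move: rn0; rewrite ltNge (le_trans _ mr)//; exact: dyadic_le.
Qed.

End Dyadic.

(** Mesh cubes of unrelated sides are not nested, so that a scale between two dyadic ones is reached
    through the energy, which increases with the radius. *)
Lemma lower_dim_ge_dyadic (R : realType) (d : measure_display) (T : measurableType d)
  (mu : probability T R) (n : nat) (f : T -> 'rV[R]_n) (q B s C : R) (n0 : nat) :
  (forall j, measurable_fun setT (fun x => f x 0 j)) -> 1 < q ->
  0 <= B -> mu [set x | forall j, `|f x 0 j| <= B] = 1%E -> 0 < s -> 0 <= C ->
  (forall m, (n0 <= m)%N ->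
     mesh mu f q (dyadic R m) <= (C * dyadic R m `^ ((q - 1) * s))%:E)%E ->
  (s%:E <= lower_gen_dim (pushforward mu (f : T -> borel_rV R n)) q)%E.
Proof.
move=> mf hq B0 muB s0 C0 h.
have q1 : 0 < q - 1 by rewrite subr_gt0.
have [K K0 hK] := energy_le_mesh mu mf hq.
apply: (lower_dim_ge mf hq B0 muB (C := K * C * 2 `^ ((q - 1) * s))).
near=> r.
have r0 : 0 < r by near: r; exact: nbhs_right_gt.
have [|m nm /andP[mr rm]] := @dyadic_scale R r n0 r0.
  by near: r; apply: nbhs_right_lt; exact: dyadic_gt0.
apply: le_trans (mesh_le_ball_energy mu mf hq r0) _.
apply: le_trans (le_ball_energy mu mf hq measurableT (ltW rm)) _.
apply: le_trans (hK _ (dyadic_gt0 _ _)) _.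
apply: (@le_trans _ _ (K%:E * (C * dyadic R m `^ ((q - 1) * s))%:E)%E).
  by apply: lee_wpmul2l; [rewrite lee_fin ltW | exact: h].
rewrite -EFinM lee_fin -!mulrA; apply: ler_wpM2l; first exact: ltW.
have r0w := ltW r0; apply: ler_wpM2l => //; rewrite -powRM//; apply: ler_powR2.
- exact: mulr_gt0.
- exact/ltW/dyadic_gt0.
by move: mr; rewrite dyadicS; lra.
Unshelve. all: by end_near. Qed.

(** * Transfer of dimensions from one map to another *)

Section HolderTransfer.
Context (R : realType) (d : measure_display) (T : measurableType d)
  (mu : probability T R) (n k : nat) (f : T -> 'rV[R]_n) (g : T -> 'rV[R]_k) (q : R).
Hypothesis mf : forall j, measurable_fun setT (fun x => f x 0 j).
Hypothesis mg : forall j, measurable_fun setT (fun x => g x 0 j).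
Hypothesis hq : 1 < q.
Variables (B B' : R).
Hypothesis B0 : 0 <= B.
Hypothesis muB : mu [set x | forall j, `|f x 0 j| <= B] = 1%E.
Hypothesis B'0 : 0 <= B'.
Hypothesis muB' : mu [set x | forall j, `|g x 0 j| <= B'] = 1%E.
Variables (b c : R).
Hypothesis b0 : 0 < b.
Hypothesis c0 : 0 < c.
Notation ef := (ball_energy mu f q setT).
Notation eg := (ball_energy mu g q setT).
Notation nuf := (pushforward mu (f : T -> borel_rV R n)).
Notation nug := (pushforward mu (g : T -> borel_rV R k)).

(** The only trace of Hölder continuity of g with respect to f that is kept: an inequality of
    energies at one scale, which tolerates a small set of exceptional pairs. *)
Definition holder_scale (m : nat) : Prop :=
  (c%:E * ef (dyadic R m) <= eg (dyadic R m `^ b))%E.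

Let q1 : 0 < q - 1. Proof. by rewrite subr_gt0. Qed.

Let expE (x s : R) : 0 < x -> (x `^ b) `^ ((q - 1) * (s / b)) = x `^ ((q - 1) * s).
Proof. by move=> x0; rewrite -powRrM; congr (_ `^ _); field; rewrite gt_eqF. Qed.

Let pos_upper (s : R) : (upper_gen_dim nuf q < s%:E)%E -> 0 < s.
Proof.
move=> h; rewrite -lte_fin; apply: le_lt_trans h; apply: le_trans (limf_einf_le_esup _).
exact: (lower_dim_ge0 mf hq B0 muB).
Qed.

Let pos_lower (s : R) : (lower_gen_dim nuf q < s%:E)%E -> 0 < s.
Proof.
move=> h; rewrite -lte_fin; apply: le_lt_trans h.
exact: (lower_dim_ge0 mf hq B0 muB).
Qed.

Lemma upper_dim_transfer (n0 : nat) (s : R) :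
  (forall m, (n0 <= m)%N -> holder_scale m) ->
  (upper_gen_dim nuf q < s%:E)%E -> (upper_gen_dim nug q <= (s / b)%:E)%E.
Proof.
move=> hs us; have s0 := pos_upper us.
have e0 : 0 < (q - 1) * s by exact: mulr_gt0.
have [e /= ee0 he] := energy_lower_near mf hq B0 muB us.
apply: (upper_dim_le mg hq B'0 muB' (c := c * 2^-1 `^ ((q - 1) * s))).
  by rewrite mulr_gt0// powR_gt0// invr_gt0.
have bV0 : 0 < b^-1 by rewrite invr_gt0.
have p1 := powR_cvg0 bV0 (_ : 0 < dyadic R n0 / 2).
have p2 := powR_cvg0 bV0 (_ : 0 < e / 2).
have {}p1 := p1 (divr_gt0 (dyadic_gt0 _ _) (ltr0Sn _ _)).
have {}p2 := p2 (divr_gt0 ee0 (ltr0Sn _ _)).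
near=> r.
have r0 : 0 < r by near: r; exact: nbhs_right_gt.
have x1 : r `^ b^-1 <= dyadic R n0 / 2 by near: r.
have x2 : r `^ b^-1 <= e / 2 by near: r.
pose x := r `^ b^-1; rewrite -/x in x1 x2; have x0 : 0 < x by exact: powR_gt0.
have xb : x `^ b = r by rewrite /x -powRrM mulVf ?powRr1 ?gt_eqF// ltW.
have [|m nm /andP[mr rm]] := @dyadic_scale R x n0 x0.
  by have := dyadic_gt0 R n0; lra.
have D0 := dyadic_gt0 R m.+1.
apply: (@le_trans _ _ (eg (dyadic R m.+1 `^ b))); last first.
  apply: le_ball_energy => //; rewrite -xb; apply: ler_powR2 => //; exact: ltW.
apply: le_trans (hs _ _); last exact: leqW.
rewrite -mulrA EFinM; apply: lee_wpmul2l; first by rewrite lee_fin ltW.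
apply: (@le_trans _ _ (dyadic R m.+1 `^ ((q - 1) * s))%:E); last first.
  apply: he => //=; rewrite sub0r normrN gtr0_norm//; lra.
rewrite lee_fin -xb expE// -powRM ?invr_ge0//; last exact: ltW.
apply: ler_powR2 => //; first by rewrite mulr_ge0// ?invr_ge0// ltW.
by rewrite dyadicS mulrC; lra.
Unshelve. all: by end_near. Qed.

(** The energy of f is large along some sequence of scales only; all dyadic scales being good for
    the transfer, the one next above such a scale can be used. *)
Lemma lower_dim_transfer (n0 : nat) (s : R) :
  (forall m, (n0 <= m)%N -> holder_scale m) ->
  (lower_gen_dim nuf q < s%:E)%E -> (lower_gen_dim nug q <= (s / b)%:E)%E.
Proof.
move=> hs us; have s0 := pos_lower us.
have e0 : 0 < (q - 1) * s by exact: mulr_gt0.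
have hf := energy_lower_freq mf hq B0 muB us.
apply: (lower_dim_le_freq mg hq B'0 muB' (c := c * 2^-1 `^ ((q - 1) * s))).
  by rewrite mulr_gt0// powR_gt0// invr_gt0.
move=> e ee0.
have eb0 : 0 < e `^ b^-1 by exact: powR_gt0.
have [|r /andP[r0 re] hr] := hf (Num.min (dyadic R n0) (e `^ b^-1 / 2)).
  by rewrite lt_min dyadic_gt0 divr_gt0.
move: re; rewrite lt_min => /andP[re1 re2].
have [m nm /andP[mr rm]] := @dyadic_scale R r n0 r0 re1.
have D0 := dyadic_gt0 R m.
have De : dyadic R m < e `^ b^-1 by move: mr; rewrite dyadicS; lra.
exists (dyadic R m `^ b).
  rewrite powR_gt0//=.
  rewrite -[ltRHS](powRr1 (ltW ee0)) -(mulVf (lt0r_neq0 b0)) powRrM.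
  by apply: gt0_ltr_powR => //; rewrite ?nnegrE ltW.
have hm := hs _ nm; rewrite /holder_scale in hm; rewrite (expE s D0); apply: (le_trans _ hm).
rewrite -mulrA EFinM; apply: lee_wpmul2l; first by rewrite lee_fin ltW.
apply: le_trans (le_ball_energy mu mf hq measurableT (ltW rm)).
apply: le_trans hr; rewrite lee_fin -powRM ?invr_ge0//; last exact: ltW.
apply: ler_powR2 => //; first by rewrite mulr_ge0// ?invr_ge0// ltW.
by move: mr; rewrite dyadicS mulrC.
Qed.

(** The good scales cannot be chosen, so that the energy of f has to be large at all small scales;
    this is what its upper dimension provides. *)
Lemma lower_dim_transfer_freq (s : R) :
  (forall n0, exists2 m, (n0 <= m)%N & holder_scale m) ->
  (upper_gen_dim nuf q < s%:E)%E -> (lower_gen_dim nug q <= (s / b)%:E)%E.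
Proof.
move=> hs us; have s0 := pos_upper us.
have [e /= ee0 he] := energy_lower_near mf hq B0 muB us.
apply: (lower_dim_le_freq mg hq B'0 muB' c0) => e1 e10.
have eb0 : 0 < e1 `^ b^-1 by exact: powR_gt0.
have [|n0 hn0] := @dyadic_small R (Num.min e (e1 `^ b^-1)).
  by rewrite lt_min ee0.
have [m nm hm] := hs n0.
have := hn0 m nm; rewrite lt_min => /andP[me me1].
have D0 := dyadic_gt0 R m.
exists (dyadic R m `^ b).
  rewrite powR_gt0//=.
  rewrite -[ltRHS](powRr1 (ltW e10)) -(mulVf (lt0r_neq0 b0)) powRrM.
  by apply: gt0_ltr_powR => //; rewrite ?nnegrE ltW.
rewrite /holder_scale in hm; rewrite (expE s D0); apply: (le_trans _ hm).
rewrite EFinM; apply: lee_wpmul2l; first by rewrite lee_fin ltW.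
by apply: he => //=; rewrite sub0r normrN gtr0_norm.
Qed.

End HolderTransfer.

(** * Measures of compact support live in a box *)

Lemma compact_coord_bounded (R : realType) (n k : nat) (g : 'rV[R]_n -> 'rV[R]_k) (K : set 'rV[R]_n) :
  compact K -> continuous g ->
  exists2 B : R, 0 <= B & forall x, K x -> forall j, `|g x 0 j| <= B.
Proof.
move=> cK cg.
have hj (j : 'I_k) : exists B : R, 0 <= B /\ forall x, K x -> `|g x 0 j| <= B.
  have cgj : continuous (fun x => g x 0 j : R^o).
    by move=> x; apply: (cvg_trans _ (@coord_continuous _ _ _ 0 j (g x)));
      apply: (cvg_comp _ (fun y : 'rV[R]_k => y 0 j : R) (cg x)).
  have : compact ((fun x => g x 0 j : R^o) @` K).
    by apply: continuous_compact => //; apply: continuous_subspaceT.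
  move=> /compact_bounded[M [_ hM]].
  exists (`|M| + 1); split; first by rewrite addr_ge0.
  move=> x Kx; apply: (hM (`|M| + 1)); last by exists x.
  by rewrite (le_lt_trans (ler_norm M))// ltrDl.
have [b hb] := choice hj.
exists (\sum_j b j); first by apply: sumr_ge0 => j _; have [] := hb j.
move=> x Kx j; rewrite (bigD1 j)//=; apply: ler_wpDr.
  by apply: sumr_ge0 => i _; have [] := hb i.
by have [_] := hb j; apply.
Qed.

Lemma compact_box (R : realType) (n : nat) (B : R) :
  compact [set x : 'rV[R]_n | forall j, `|x 0 j| <= B].
Proof.
rewrite (_ : [set x | _] = [set v : 'rV[R]_n | forall j, `[- B, B]%classic (v ord0 j)]).
  by apply: (@rV_compact R n (fun=> `[- B, B]%classic)) => j; exact: segment_compact.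
by apply/seteqP; split => x /= h j; have := h j; rewrite in_itv /= ler_norml.
Qed.

Lemma measurable_box (R : realType) (n : nat) (B : R) :
  measurable ([set x | forall j, `|x 0 j| <= B] : set (borel_rV R n)).
Proof.
apply: measurable_forall_ord => j; apply: measurable_le_cst.
by apply: measurableT_comp => //; exact: measurable_coord.
Qed.

(** The definition of the support does not say that its complement is null. Every point outside it
    lies in a null mesh cube of side 1 / (m + 1) for some m, and such cubes are countably many. *)
Lemma msupport_box (R : realType) (n : nat) (nu : probability (borel_rV R n) R) :
  compact (msupport nu) ->
  exists2 B : R, 0 <= B & nu [set x : borel_rV R n | forall j, `|(x : 'rV[R]_n) 0 j| <= B] = 1%E.
Proof.
move=> cs; have cid : continuous (fun x : 'rV[R]_n => x) by move=> x; exact: cvg_id.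
have [B B0 hB] := compact_coord_bounded cs cid.
exists B => //.
set K := [set x | _]; have mK : measurable (K : set (borel_rV R n)) by exact: measurable_box.
suff /(congr1 (fun x => (1 - x)%E)) : nu (~` K) = 0%E.
  by rewrite -probability_setC ?setCK ?sube0//; exact: measurableC.
pose cube (p : nat * 'rV[int]_n) : set (borel_rV R n) := mesh_cube p.1.+1%:R^-1 p.2.
pose F k := if pickle_inv k is Some p then (if nu (cube p) == 0%E then cube p else set0) else set0.
have nF : nu.-negligible (\bigcup_k F k).
  apply: negligible_bigcup => k; rewrite /F; case: pickle_inv => [p|]; last exact: negligible_set0.
  case: eqP => [h|_]; last exact: negligible_set0.
  by apply/negligibleP => //; exact: measurable_mesh_cube.
apply/negligibleP; first exact: measurableC.
apply: negligibleS nF => x nKx.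
have : ~ msupport nu x by move=> /hB.
move=> /existsNP[U /not_implyP[oU /not_implyP[Ux /negP]]]; rewrite -leNgt => nuU.
have : nbhs (x : 'rV[R]_n) U by exact: open_nbhs_nbhs.
move=> /nbhs_ballP[e /= e0 eU].
have /(cvgr_lt 0)/(_ e e0)[m _ /(_ m (leqnn m)) hm] := cvg_inv_nat (1 : R).
rewrite /= div1r in hm.
have m0 : 0 < m.+1%:R^-1 :> R by rewrite invr_gt0.
pose p := (m, mesh_index m.+1%:R^-1 x).
have sub : cube p `<=` U.
  move=> y yp; apply: eU; split => // i j; rewrite (ord1 i) /ball /= distrC.
  by apply: lt_trans hm; exact: (mesh_cube_near (f := fun x : borel_rV R n => (x : 'rV[R]_n)) (mesh_cube_index x m0) yp).
exists (pickle p) => //; rewrite /F pickleK_inv.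
rewrite (_ : (nu (cube p) == 0)%E); first exact: mesh_cube_index.
rewrite eq_le measure_ge0 andbT; apply: le_trans nuU.
apply: le_measure; rewrite ?inE//; first exact: measurable_mesh_cube.
exact: sub_sigma_algebra.
Qed.

(** * Upper bounds for the image measure *)

Lemma integral_section_swap (R : realType) (d1 d2 : measure_display)
  (T1 : measurableType d1) (T2 : measurableType d2)
  (m1 : {sigma_finite_measure set T1 -> \bar R}) (m2 : {sigma_finite_measure set T2 -> \bar R})
  (D : set (T1 * T2)) : measurable D ->
  (\int[m1]_x m2 (xsection D x) = \int[m2]_y m1 (ysection D y))%E.
Proof.
move=> mD.
exact: (@product_measure_unique _ _ _ _ _ m1 m2 (m1 \x^ m2)%E (@product_measure2E _ _ _ _ _ m1 m2) _ mD).
Qed.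

(** The Borel-Cantelli argument in integrated form: the sum of the F n has finite mean, so that it
    is almost surely finite, and it bounds every F n. *)
Lemma ae_bounded_of_summable (R : realType) (d : measure_display) (T : measurableType d)
  (P : probability T R) (F : nat -> T -> \bar R) (C x : R) : 0 <= x -> x < 1 ->
  (forall n, measurable_fun setT (F n)) -> (forall n w, 0 <= F n w)%E ->
  (forall n, \int[P]_w F n w <= (C * x ^+ n)%:E)%E ->
  {ae P, forall w, exists M : R, forall n, (F n w <= M%:E)%E}.
Proof.
move=> x0 x1 mF F0 FC.
pose S w := (\sum_(0 <= n <oo) F n w)%E.
have mS : measurable_fun setT S by apply: ge0_emeasurable_sum => // n x _ _; exact: F0.
have S0 w : (0 <= S w)%E by apply: nneseries_ge0 => n _ _.
have C0 : 0 <= C.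
  have : (0 <= \int[P]_w F 0%N w)%E by apply: integral_ge0.
  by move=> /le_trans/(_ (FC 0%N)); rewrite lee_fin expr0 mulr1.
have x1' : 0 < 1 - x by rewrite subr_gt0.
have SC : (\int[P]_w S w <= ((1 - x)^-1 * C)%:E)%E.
  rewrite integral_nneseries//; apply: lime_le; first by apply: is_cvg_nneseries => n _ _; exact: integral_ge0.
  apply: nearW => n; apply: (@le_trans _ _ (\sum_(0 <= i < n) (C * x ^+ i)%:E)%E); first exact: lee_sum.
  rewrite sumEFin lee_fin -mulr_sumr mulrC; apply: ler_wpM2r => //.
  rewrite -[leRHS]mul1r ler_pdivlMr// mulrC big_mkord.
  by have := subrX1 x n; have := exprn_ge0 n x0; lra.
have /integrable_ae : P.-integrable setT S.
  apply/integrableP; split => //; under eq_integral do rewrite gee0_abs//.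
  by apply: le_lt_trans SC _; rewrite ltry.
move=> /(_ measurableT); apply: filterS => w /(_ I) fS.
exists (fine (S w)) => n; rewrite fineK//.
apply: le_trans (@nneseries_lim_ge _ (F ^~ w) xpredT 0%N n.+1 _); last by [].
by rewrite big_nat_recr//= leeDr// sume_ge0.
Qed.

Section EnergyTransfer.
Context (R : realType) (d : measure_display) (T : measurableType d)
  (mu : probability T R) (n k : nat) (f : T -> 'rV[R]_n) (g : T -> 'rV[R]_k) (q : R).
Hypothesis mf : forall j, measurable_fun setT (fun x => f x 0 j).
Hypothesis mg : forall j, measurable_fun setT (fun x => g x 0 j).
Hypothesis hq : 1 < q.
Notation ef := (ball_energy mu f q setT).
Notation eg := (ball_energy mu g q setT).

Let q1 : 0 < q - 1. Proof. by rewrite subr_gt0. Qed.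

Definition split_pairs (r r' : R) : set (T * T) :=
  [set z | (forall j, `|f z.2 0 j - f z.1 0 j| < r) /\ ~ (forall j, `|g z.2 0 j - g z.1 0 j| < r')].

Lemma measurable_split_pairs r r' : measurable (split_pairs r r').
Proof.
have h1 := measurable_near_pairs mf r (@measurableT _ T).
have h2 := measurable_near_pairs mg r' (@measurableT _ T).
rewrite (_ : split_pairs _ _ = [set z | setT z.2 /\ forall j, `|f z.2 0 j - f z.1 0 j| < r] `\`
  [set z | setT z.2 /\ forall j, `|g z.2 0 j - g z.1 0 j| < r']); first exact: measurableD.
by apply/seteqP; split => z /= [h1' h2']; [split => // -[]|split; [case: h1'|move=> h; apply: h2']].
Qed.

Lemma energy_transfer r r' (e D : R) : 0 < e ->
  (\int[mu]_x mu (xsection (split_pairs r r') x) <= D%:E)%E ->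
  (ef r <= (2 `^ (q - 1))%:E * (eg r' + (e `^ (q - 1) + D / e)%:E))%E.
Proof.
move=> e0 hD; pose b x := fine (mu (xsection (split_pairs r r') x)).
have mS := measurable_split_pairs r r'.
have bE x : mu (xsection (split_pairs r r') x) = (b x)%:E.
  by rewrite fineK// fin_num_measure//; exact: measurable_xsection.
have b0 x : 0 <= b x by exact: fine_ge0.
have b1 x : b x <= 1 by rewrite -lee_fin -bE probability_le1//; exact: measurable_xsection.
have mb : measurable_fun setT b.
  apply/measurable_EFinP; rewrite (_ : _ \o _ = mu \o xsection (split_pairs r r')).
    exact: measurable_fun_xsection.
  by apply/funext => x /=; rewrite bE.
have mass x : near_mass mu f setT r x <= near_mass mu g setT r' x + b x.
  rewrite -lee_fin EFinD -bE -!near_massE//.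
  apply: le_trans (measureU2 _ _ _) => //; try exact: measurable_near_set; try exact: measurable_xsection.
  apply: le_measure; rewrite ?inE; try exact: measurable_near_set.
    by apply: measurableU; [exact: measurable_near_set|exact: measurable_xsection].
  move=> y [_ yx]; have [h|h] := pselect (forall j, `|g y 0 j - g x 0 j| < r'); first by left.
  by right; rewrite /xsection /= inE.
(* Only the integral of b is known. Below the threshold e the power is at most e^(q-1); above it the
   power is at most 1, hence at most b / e. *)
have bq x : b x `^ (q - 1) <= e `^ (q - 1) + b x / e.
  have [be|eb] := leP (b x) e.
    by apply: ler_wpDr; [rewrite divr_ge0// ltW|apply: ler_powR2].
  apply: ler_wpDl; first exact: powR_ge0.
  apply: (@le_trans _ _ 1); last by rewrite ler_pdivlMr// mul1r ltW.
  by have := ler_powR2 q1 (b0 x) (b1 x); rewrite powR1.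
have pw x : near_mass mu f setT r x `^ (q - 1) <=
    2 `^ (q - 1) * (near_mass mu g setT r' x `^ (q - 1) + (e `^ (q - 1) + b x / e)).
  apply: (@le_trans _ _ (2 `^ (q - 1) * (near_mass mu g setT r' x `^ (q - 1) + b x `^ (q - 1)))); last first.
    by apply: ler_wpM2l; [exact: powR_ge0|rewrite lerD2l].
  apply: le_trans (ler_powR2 q1 (near_mass_ge0 _ _ _ _ _) (mass x)) _.
  have := @ler_powR_sum R bool [:: true; false] (fun c => if c then near_mass mu g setT r' x else b x) (q - 1) q1.
  rewrite !big_cons !big_nil /= !addr0; apply => -[] _; [exact: near_mass_ge0|exact: b0].
have m1 : measurable_fun setT (fun x => (near_mass mu g setT r' x `^ (q - 1))%:E).
  exact: measurable_near_mass_powR.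
have m2 : measurable_fun setT (fun x => (e `^ (q - 1) + b x / e)%:E).
  by apply/measurable_EFinP; apply: measurable_funD => //; apply: measurable_funM.
apply: (@le_trans _ _ (\int[mu]_x ((2 `^ (q - 1))%:E * ((near_mass mu g setT r' x `^ (q - 1))%:E + (e `^ (q - 1) + b x / e)%:E)))%E).
  apply: ge0_le_integral => //.
  - by move=> x _; rewrite lee_fin powR_ge0.
  - exact: measurable_near_mass_powR.
  - by apply: emeasurable_funM => //; exact: emeasurable_funD.
  - by move=> x _; rewrite -EFinD -EFinM lee_fin.
have p1 x : (0 <= (near_mass mu g setT r' x `^ (q - 1))%:E)%E by rewrite lee_fin powR_ge0.
have p2 x : (0 <= (e `^ (q - 1) + b x / e)%:E)%E.
  by rewrite lee_fin addr_ge0 ?powR_ge0// divr_ge0// ltW.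
rewrite ge0_integralZl//; first last.
- by move=> x _; rewrite adde_ge0.
- exact: emeasurable_funD.
apply: lee_wpmul2l; first by rewrite lee_fin powR_ge0.
rewrite ge0_integralD//; apply: leeD => //.
under eq_integral do rewrite EFinD.
rewrite ge0_integralD//; first last.
- by apply/measurable_EFinP; apply: measurable_funM.
- by move=> x _; rewrite lee_fin divr_ge0// ltW.
- by move=> x _; rewrite lee_fin powR_ge0.
rewrite EFinD; apply: leeD.
  rewrite integral_cst// -[leRHS]mule1; apply: lee_wpmul2l; first by rewrite lee_fin powR_ge0.
  exact: probability_le1.
under eq_integral do rewrite EFinM -bE.
rewrite ge0_integralZr//; first last.
- by rewrite lee_fin invr_ge0 ltW.
- exact: measurable_fun_xsection.
rewrite EFinM; apply: lee_wpmul2r => //.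
by rewrite lee_fin invr_ge0 ltW.
Qed.

End EnergyTransfer.

Lemma same_law_pair (R : realType) (d1 d2 : measure_display)
  (O1 : measurableType d1) (O2 : measurableType d2)
  (P1 : probability O1 R) (P2 : probability O2 R) (I : Type)
  (Y1 : I -> {RV P1 >-> R}) (Y2 : I -> {RV P2 >-> R}) (x y : I) (A : set R) :
  same_law Y1 Y2 -> measurable A ->
  P1 [set w | A (Y1 y w - Y1 x w)] = P2 [set w | A (Y2 y w - Y2 x w)].
Proof.
move=> sl mA; pose t (i : 'I_2) := if i == 0 then x else y.
pose B : set (borel_rV R 2) := [set v | A ((v : 'rV[R]_2) 0 1 - (v : 'rV[R]_2) 0 0)].
have mB : measurable B.
  rewrite (_ : B = (fun v : borel_rV R 2 => (v : 'rV[R]_2) 0 1 - (v : 'rV[R]_2) 0 0) @^-1` A)//.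
  rewrite -[X in measurable X]setTI.
  have mm : measurable_fun setT (fun v : borel_rV R 2 => (v : 'rV[R]_2) 0 1 - (v : 'rV[R]_2) 0 0).
    by apply: measurable_funB; exact: measurable_coord.
  exact: mm.
have := sl 2%N t B mB; rewrite /B /=.
under eq_set do rewrite !mxE.
by move=> ->; under eq_set do rewrite !mxE.
Qed.

Lemma enorm_le_sup (R : realType) (n : nat) (x : 'rV[R]_n) (r : R) : 0 <= r ->
  (forall j, `|x 0 j| <= r) -> enorm x <= Num.sqrt n%:R * r.
Proof.
move=> r0 h; rewrite /enorm; have {1}<- : Num.sqrt (r ^+ 2) = r by rewrite sqrtr_sqr ger0_norm.
rewrite -sqrtrM//.
apply: ler_wsqrtr; apply: (@le_trans _ _ (\sum_(j < n) r ^+ 2)).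
  by apply: ler_sum => j _; rewrite -real_normK ?num_real//; apply: lerXn2r; rewrite ?nnegrE.
by rewrite sumr_const card_ord mulr_natl.
Qed.

Lemma expRN_le_fact (R : realType) (y : R) (m : nat) : 0 < y -> expR (- y) <= m`!%:R * y ^- m.
Proof.
move=> y0; rewrite expRN; case: m => [|m].
  by rewrite expr0 invr1 mulr1 -[leRHS]invr1 lef_pV2 ?posrE ?expR_gt0// -[leLHS]expR0 ler_expR ltW.
rewrite -[leRHS]invrK lef_pV2 ?posrE ?expR_gt0 ?invr_gt0 ?mulr_gt0 ?invr_gt0 ?exprn_gt0 ?ltr0n ?fact_gt0//.
rewrite invfM invrK mulrC; apply: le_trans (expR_ge1Dxn m (ltW y0)).
by rewrite lerDr.
Qed.

Section IncrementTail.
Context (R : realType) (dd0 : measure_display) (Omega0 : measurableType dd0)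
    (P0 : probability Omega0 R) (I : eqType) (Y : I -> {RV P0 >-> R}).
Hypothesis gY : gaussian_process Y.
Hypothesis cY : forall x, ('E_P0[Y x] = 0)%E.

Lemma increment_tail (x y : I) (v r : R) : 0 <= r -> 0 < v ->
  (\int[P0]_w ((Y y w - Y x w) ^+ 2)%:E <= v%:E)%E ->
  (P0 [set w | (r < `|Y y w - Y x w|)%R] <= (Num.sqrt 2 * expR (- (r ^+ 2 / (4 * v))))%:E)%E.
Proof.
move=> r0 v0 hv.
have [l0 ll] := lin_span_linear Y setT.
have : lin_span Y setT (fun w => Y y w + -1 * Y x w).
  by apply: (ll); exact: lin_span_gen.
rewrite (_ : (fun w => _) = (fun w => Y y w - Y x w)); last by apply/funext => w; rewrite mulN1r.
move=> /(lin_span_centered gY cY )[mZ gZ Z0].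
have [s [s0 Es _ ht]] := gaussian_rv_centered mZ gZ Z0.
apply: ht => //; move: hv; by rewrite Es lee_fin.
Qed.

End IncrementTail.

Section PairMeasure.
Context (R : realType) (d : measure_display) (T : measurableType d) (mu : probability T R).

(* Instance inference only finds a sigma-finite measure on mu \x mu. *)
Definition pair_measure : set (T * T) -> \bar R := (mu \x mu)%E.

HB.instance Definition _ := Measure.on pair_measure.

Let pair_measure_setT : pair_measure [set: T * T] = 1%E.
Proof.
rewrite /pair_measure -setXTT product_measure1E// -[RHS]mule1.
by rewrite -{1}(probability_setT mu) -(probability_setT mu).
Qed.

HB.instance Definition _ := Measure_isProbability.Build _ _ _ pair_measure pair_measure_setT.

End PairMeasure.

Section SamplePathTransfer.
Context (R : realType) (N d : nat)
    (dd0 : measure_display) (Omega0 : measurableType dd0)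
    (P0 : probability Omega0 R) (X0 : 'rV[R]_N -> {RV P0 >-> R})
    (dd : measure_display) (Omega : measurableType dd)
    (P : probability Omega R) (X : 'I_d -> 'rV[R]_N -> {RV P >-> R})
    (X0_gauss : gaussian_process X0)
    (X0_centered : forall x, ('E_P0[X0 x] = 0)%E)
    (X_cont : forall w, continuous (sample_path X w))
    (X_copies : forall i, same_law (X i) X0)
    (mu : probability (borel_rV R N) R).
Notation T := (borel_rV R N).
Notation idT := (fun x : T => (x : 'rV[R]_N)).

Lemma sample_coord_cont i w : continuous (fun x => X i x w).
Proof.
move=> x; have h : (fun y => X i y w) = (fun v : 'rV[R]_d => v 0 i : R) \o sample_path X w.
  by apply/funext => y; rewrite /= /sample_path mxE.
rewrite h; apply: continuous_comp; first exact: X_cont.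
exact: coord_continuous.
Qed.

Lemma measurable_sample_coord i : measurable_fun setT (fun z : T * Omega => X i z.1 z.2).
Proof. by apply: (@measurable_caratheodory R N _ Omega (fun x w => X i x w)) => [x|w] //; exact: sample_coord_cont. Qed.

Lemma measurable_sample_path w j : measurable_fun setT (fun x : T => sample_path X w x 0 j).
Proof.
rewrite (_ : (fun x => _) = (fun x : T => X j x w)); last by apply/funext => x; rewrite /sample_path mxE.
by apply: continuous_borel; exact: sample_coord_cont.
Qed.

Lemma measurable_id_coord (j : 'I_N) : measurable_fun setT (fun x : T => idT x 0 j).
Proof. exact: measurable_coord. Qed.

Definition increments_le (r v : R) := forall x y : 'rV[R]_N, (forall j, `|y 0 j - x 0 j| < r) ->
  (\int[P0]_w ((X0 y w - X0 x w) ^+ 2)%:E <= v%:E)%E.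

Definition split_mass (r r' : R) (w : Omega) : \bar R :=
  (\int[mu]_x mu (xsection (split_pairs idT (sample_path X w) r r') x))%E.

Definition split_triples (r r' : R) : set ((T * T) * Omega) :=
  [set z | split_pairs idT (sample_path X z.2) r r' z.1].

Lemma measurable_split_triples r r' : measurable (split_triples r r').
Proof.
have m1 := measurable_near_pairs measurable_id_coord r (@measurableT _ T).
have m2 : measurable [set z : (T * T) * Omega | forall j, `|X j z.1.2 z.2 - X j z.1.1 z.2| < r'].
  apply: measurable_forall_ord => j; apply: measurable_lt_cst.
  apply: measurableT_comp => //; apply: measurable_funB.
    apply: (measurableT_comp (measurable_sample_coord j)
      (g := fun z : (T * T) * Omega => (z.1.2, z.2))).
    apply: measurable_fun_pair => //.
    exact: (measurableT_comp measurable_snd measurable_fst).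
  apply: (measurableT_comp (measurable_sample_coord j)
    (g := fun z : (T * T) * Omega => (z.1.1, z.2))).
  apply: measurable_fun_pair => //.
  exact: (measurableT_comp measurable_fst measurable_fst).
rewrite (_ : split_triples r r' = (fst @^-1` [set z : T * T | setT z.2 /\ forall j, `|idT z.2 0 j - idT z.1 0 j| < r])
   `\` [set z : (T * T) * Omega | forall j, `|X j z.1.2 z.2 - X j z.1.1 z.2| < r']).
  apply: measurableD => //; rewrite -[X in measurable X]setTI; exact: measurable_fst.
rewrite /split_triples /split_pairs; apply/seteqP; split => z /= [h1 h2].
  by split => // h3; apply: h2 => j; rewrite !mxE.
by split; [case: h1|move=> h3; apply: h2 => j; have := h3 j; rewrite !mxE].
Qed.

Lemma split_massE r r' w : split_mass r r' w = pair_measure mu (ysection (split_triples r r') w).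
Proof.
rewrite /split_mass /pair_measure /product_measure1; congr integral; apply/funext => x /=; congr (mu _).
by apply/seteqP; split => y; rewrite /xsection /ysection /split_triples /= !inE /= ?inE.
Qed.

Lemma measurable_split_mass r r' : measurable_fun setT (split_mass r r').
Proof.
rewrite (_ : split_mass r r' = pair_measure mu \o ysection (split_triples r r')).
  by apply: measurable_fun_ysection; exact: measurable_split_triples.
by apply/funext => w /=; rewrite split_massE.
Qed.

Lemma split_mass_ge0 r r' w : (0 <= split_mass r r' w)%E.
Proof. exact: integral_ge0. Qed.

Lemma split_prob r r' v (z : T * T) : 0 < r' -> 0 < v -> increments_le r v ->
  (P (xsection (split_triples r r') z) <= (d%:R * (Num.sqrt 2 * expR (- (r' ^+ 2 / (16 * v)))))%:E)%E.
Proof.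
move=> r'0 v0 inc.
have [hz|nz] := pselect (forall j, `|idT z.2 0 j - idT z.1 0 j| < r); last first.
  rewrite (_ : xsection _ _ = set0); last first.
    by apply/seteqP; split => // w; rewrite /xsection /= inE => -[/= h _]; apply: nz.
  by rewrite measure0 lee_fin !mulr_ge0// expR_ge0.
(* Failing [< r'] is a non-strict inequality, while the tail bound is for a strict one; halving r'
   bridges this and turns 4 v into 16 v. *)
pose B (i : 'I_d) : set Omega := [set w | (r' / 2 < `|X i z.2 w - X i z.1 w|)%R].
have mA : measurable [set t : R | (r' / 2 < `|t|)%R] by exact: measurable_gt_cst.
have mB i : measurable (B i).
  by apply: measurable_gt_cst; apply: measurableT_comp => //; exact: measurable_funB.
have PB i : (P (B i) <= (Num.sqrt 2 * expR (- (r' ^+ 2 / (16 * v))))%:E)%E.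
  have -> : P (B i) = P0 [set w | (r' / 2 < `|X0 z.2 w - X0 z.1 w|)%R].
    exact: (same_law_pair z.1 z.2 (X_copies i) mA).
  apply: le_trans (increment_tail X0_gauss X0_centered _ v0 (inc _ _ hz)) _.
    by rewrite divr_ge0// ltW.
  rewrite lee_fin; have -> : (r' / 2) ^+ 2 / (4 * v) = r' ^+ 2 / (16 * v).
    by field; rewrite gt_eqF.
  by [].
apply: (@le_trans _ _ (P (\big[setU/set0]_(i < d) B i))).
  apply: le_measure; rewrite ?inE.
  - by apply: measurable_xsection; exact: measurable_split_triples.
  - by apply: bigsetU_measurable => i _.
  move=> w; rewrite /xsection /= inE => -[/= _ /existsNP[i hi]].
  rewrite -bigcup_seq; exists i => /=; first exact: mem_index_enum.
  rewrite /B /=; move/negP: hi; rewrite -leNgt !mxE; apply: lt_le_trans; lra.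
apply: le_trans (measure_bigsetU_le P (index_enum _) mB) _.
apply: (@le_trans _ _ (\sum_(i < d) (Num.sqrt 2 * expR (- (r' ^+ 2 / (16 * v))))%:E)%E).
  by apply: lee_sum => i _; exact: PB.
by rewrite sumEFin sumr_const card_ord [d%:R * _]mulr_natl.
Qed.

Lemma expected_split_mass r r' v : 0 < r' -> 0 < v -> increments_le r v ->
  (\int[P]_w split_mass r r' w <= (d%:R * (Num.sqrt 2 * expR (- (r' ^+ 2 / (16 * v)))))%:E)%E.
Proof.
move=> r'0 v0 inc.
under eq_integral do rewrite split_massE.
rewrite -(@integral_section_swap _ _ _ _ _ (pair_measure mu) P); last exact: measurable_split_triples.
set C := (_ * _ : R).
apply: (@le_trans _ _ (\int[pair_measure mu]_z (cst C%:E z))%E); last first.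
  by rewrite integral_cst// -[leRHS]mule1; apply: lee_wpmul2l; [by rewrite lee_fin /C !mulr_ge0// expR_ge0|exact: probability_le1].
apply: ge0_le_integral => //.
- by apply: measurable_fun_xsection; exact: measurable_split_triples.
- by move=> z _; exact: split_prob.
Qed.

End SamplePathTransfer.

Lemma powR_antitone (R : realType) (a x y : R) : 0 < a -> a <= 1 -> x <= y -> a `^ y <= a `^ x.
Proof.
move=> a0 a1; rewrite -subr_ge0 => xy.
rewrite -[y](subrK x) powRD; last by rewrite (gt_eqF a0) implybT.
rewrite -[leRHS]mul1r; apply: ler_wpM2r; first exact: powR_ge0.
move: xy; rewrite le_eqVlt => /predU1P[<-|xy]; first by rewrite powRr0.
by have := ler_powR2 xy (ltW a0) a1; rewrite powR1.
Qed.

Section HolderScales.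
Context (R : realType) (N d : nat)
    (dd0 : measure_display) (Omega0 : measurableType dd0)
    (P0 : probability Omega0 R) (X0 : 'rV[R]_N -> {RV P0 >-> R})
    (dd : measure_display) (Omega : measurableType dd)
    (P : probability Omega R) (X : 'I_d -> 'rV[R]_N -> {RV P >-> R})
    (X0_gauss : gaussian_process X0)
    (X0_centered : forall x, ('E_P0[X0 x] = 0)%E)
    (X_cont : forall w, continuous (sample_path X w))
    (X_copies : forall i, same_law (X i) X0)
    (q : R) (hq : 1 < q)
    (mu : probability (borel_rV R N) R).
Notation T := (borel_rV R N).
Notation idT := (fun x : T => (x : 'rV[R]_N)).
Variables (b b' V : R).
Hypothesis b'b : b' < b.
Hypothesis V0 : 0 < V.

(** The Gaussian exponent y = r^(2 b') / (16 V r^(2 b)) is a negative power of r because b' < b, and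
    exp(- y) is at most m! / y^m; m is taken with 2 m (b - b') >= K + 1. The additional 1 makes the
    bounds summable over dyadic scales after division by r^K. *)
Lemma split_mass_decay (K : R) : exists2 C : R, 0 <= C & forall n,
  increments_le X0 (dyadic R n) (V * dyadic R n `^ (2 * b)) ->
  (\int[P]_w split_mass X mu (dyadic R n) (dyadic R n `^ b') w <=
    (C * dyadic R n `^ (K + 1))%:E)%E.
Proof.
have g0 : 0 < 2 * (b - b') by rewrite mulr_gt0// subr_gt0.
have [m hm] : exists m : nat, K + 1 <= m%:R * (2 * (b - b')).
  exists (Num.bound `|(K + 1) / (2 * (b - b'))|).
  rewrite -ler_pdivrMr//; apply/ltW/(le_lt_trans (ler_norm _)).
  exact: archi_boundP.
exists (d%:R * (Num.sqrt 2 * (m`!%:R * (16 * V) ^+ m))).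
  by rewrite !mulr_ge0// exprn_ge0// mulr_ge0// ltW.
move=> n inc; set r := dyadic R n in inc *.
have r0 : 0 < r by exact: dyadic_gt0.
have r1 : r <= 1 by exact: dyadic_le1.
apply: le_trans (expected_split_mass X0_gauss X0_centered X_cont X_copies mu _ _ inc) _.
- by rewrite powR_gt0.
- by rewrite mulr_gt0// powR_gt0.
rewrite lee_fin -[leRHS]mulrA; apply: ler_wpM2l => //.
rewrite -[leRHS]mulrA; apply: ler_wpM2l => //.
pose y := (r `^ b') ^+ 2 / (16 * (V * r `^ (2 * b))); rewrite -/y.
have y0 : 0 < y by rewrite divr_gt0 ?exprn_gt0 ?mulr_gt0 ?powR_gt0.
apply: le_trans (expRN_le_fact m y0) _; rewrite -mulrA.
apply: ler_wpM2l => //.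
have -> : y = (16 * V)^-1 * r `^ (- (2 * (b - b'))).
  rewrite /y -powR_mulrn ?powR_ge0// -powRrM.
  rewrite invfM mulrCA [in RHS](_ : - (2 * (b - b')) = b' * 2 - 2 * b); last by ring.
  rewrite powRD; last by rewrite (gt_eqF r0) implybT.
  by rewrite powRN !invfM; ring.
rewrite exprMn invfM exprVn invrK; apply: ler_wpM2l; first by rewrite exprn_ge0// mulr_ge0// ltW.
rewrite -powR_mulrn ?powR_ge0// -powRrM -powRN mulNr opprK.
by apply: powR_antitone => //; rewrite mulrC.
Qed.

(* The split mass is smaller than every power of the scale, while the energy of a
   boundedly supported measure is at least a power of it by mesh_lower. *)
Lemma ae_holder_scales (B : R) : 0 <= B ->
  mu [set x : T | forall j, `|idT x 0 j| <= B] = 1%E ->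
  {ae P, forall w, exists n0, forall n, (n0 <= n)%N ->
    increments_le X0 (dyadic R n) (V * dyadic R n `^ (2 * b)) ->
    holder_scale mu idT (sample_path X w) q b' (2 `^ (- q)) n}.
Proof.
move=> B0 muB.
have q1 : 0 < q - 1 by rewrite subr_gt0.
(* The threshold in [energy_transfer] is r^L. With L = N + 1 and K = L + L (q - 1), both error terms
   e^(q-1) and M r^K / r^L are of order r^(L (q-1)), smaller by r^(q-1) than the lower bound r^(N
   (q-1)) for the energy of mu. *)
pose L : R := N%:R + 1; have L0 : 0 < L by rewrite ltr_wpDl.
pose K := L + L * (q - 1).
have [C C0 hC] := split_mass_decay K.
(* The control of the increments is deterministic; setting F to 0 at the other scales lets one null
   set serve any set of good scales. *)
pose good n := `[< increments_le X0 (dyadic R n) (V * dyadic R n `^ (2 * b)) >].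
pose F n w := if good n then ((dyadic R n `^ K)^-1%:E * split_mass X mu (dyadic R n) (dyadic R n `^ b') w)%E else 0%E.
have mF n : measurable_fun setT (F n).
  rewrite /F; case: (good n); last exact: measurable_cst.
  by apply: emeasurable_funM => //; exact: measurable_split_mass.
have F0 n w : (0 <= F n w)%E.
  by rewrite /F; case: (good n) => //; rewrite mule_ge0 ?split_mass_ge0// lee_fin invr_ge0 powR_ge0.
have FC n : (\int[P]_w F n w <= (C * dyadic R n)%:E)%E.
  rewrite /F; case: (boolP (good n)) => [/asboolP gn|_]; last first.
    by rewrite integral0 lee_fin mulr_ge0// ltW// dyadic_gt0.
  rewrite ge0_integralZl//; first last.
  - by rewrite lee_fin invr_ge0 powR_ge0.
  - by move=> w _; exact: split_mass_ge0.
  - exact: measurable_split_mass.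
  apply: le_trans (lee_wpmul2l _ (hC n gn)) _; first by rewrite lee_fin invr_ge0 powR_ge0.
  have D0 := dyadic_gt0 R n; have p0 : 0 < dyadic R n `^ K by exact: powR_gt0.
  rewrite -EFinM lee_fin powRD; last by rewrite (gt_eqF D0) implybT.
  rewrite powRr1; last exact: ltW.
  by rewrite [C * _]mulrCA mulKf// gt_eqF.
have half0 : 0 <= (2^-1 : R) by rewrite invr_ge0.
have half1 : (2^-1 : R) < 1 by rewrite invf_lt1// ltr1n.
apply: filterS (ae_bounded_of_summable half0 half1 mF F0 FC) => w [M hM].
have M0 : 0 <= M by rewrite -lee_fin; exact: le_trans (F0 0%N w) (hM 0%N).
have [c c0 hc] := mesh_lower (@measurable_id_coord R N) hq B0 muB.
have [e /= e0 he] := @powR_cvg0 R (q - 1) q1 (c / 2 / (2 `^ (q - 1) * (1 + M))) (ltac:(by rewrite !divr_gt0// mulr_gt0 ?powR_gt0// ltr_wpDr)).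
have [n0 hn0] := dyadic_small e0.
exists n0 => n nn0 gn; rewrite /holder_scale.
set r := dyadic R n; have r0 : 0 < r by exact: dyadic_gt0.
have r1 : r <= 1 by exact: dyadic_le1.
have mX := measurable_sample_path X_cont w.
have mi := @measurable_id_coord R N.
have hD : (\int[mu]_x mu (xsection (split_pairs idT (sample_path X w) r (r `^ b')) x) <= (M * r `^ K)%:E)%E.
  have := hM n; rewrite /F /good asboolT// -/r muleC lee_pdivrMr ?powR_gt0//.
have : (ball_energy mu idT q setT r <= (2 `^ (q - 1))%:E * (ball_energy mu (sample_path X w) q setT (r `^ b') +
    ((r `^ L) `^ (q - 1) + M * r `^ K / r `^ L)%:E))%E.
  have h := energy_transfer mi mX hq (powR_gt0 L r0) hD.
  exact h.
have := le_trans (hc r _) (mesh_le_ball_energy mu mi hq r0); rewrite r0 r1 => /(_ isT).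
have [u ->] : exists u, ball_energy mu idT q setT r = u%:E by eexists; exact: energy_fin.
have [v ->] : exists v, ball_energy mu (sample_path X w) q setT (r `^ b') = v%:E.
  by eexists; exact: energy_fin.
rewrite -EFinD -!EFinM !lee_fin => hu huv.
set A := 2 `^ (q - 1) in huv; have A0 : 0 < A by exact: powR_gt0.
have rL : (r `^ L) `^ (q - 1) + M * r `^ K / r `^ L = (1 + M) * (r `^ (N%:R * (q - 1)) * r `^ (q - 1)).
  rewrite -powRD; last by rewrite (gt_eqF r0) implybT.
  rewrite -powRrM (_ : N%:R * (q - 1) + (q - 1) = L * (q - 1)); last by rewrite /L; ring.
  rewrite /K powRD; last by rewrite (gt_eqF r0) implybT.
  by field; rewrite gt_eqF// powR_gt0.
have hr : r `^ (q - 1) <= c / 2 / (A * (1 + M)).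
  by apply: he => //=; rewrite sub0r normrN gtr0_norm//; exact: hn0.
have M1 : 0 < 1 + M by rewrite ltr_wpDr.
have h1 : A * ((1 + M) * (r `^ (N%:R * (q - 1)) * r `^ (q - 1))) <= u / 2.
  move: hr; rewrite ler_pdivlMr ?mulr_gt0// => hr.
  apply: (@le_trans _ _ (c * r `^ (N%:R * (q - 1)) / 2)); last by rewrite ler_pM2r.
  rewrite [leLHS](_ : _ = (r `^ (q - 1) * (A * (1 + M))) * r `^ (N%:R * (q - 1))); last by ring.
  by rewrite [leRHS]mulrAC; apply: ler_wpM2r => //; exact: powR_ge0.
rewrite rL mulrDr in huv.
have h2 : u / 2 <= A * v by lra.
rewrite powRN (_ : 2 `^ q = 2 * A); last first.
  by rewrite /A -{2}(powRr1 (ler0n R 2)) -powRD ?pnatr_eq0 ?implybT// addrC subrK.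
by rewrite mulrC ler_pdivrMr ?mulr_gt0//; lra.
Qed.

End HolderScales.

(** * Lower bounds for the image measure *)

Section PathSmallBall.
Context (R : realType) (I : eqType) (d : nat)
    (dd0 : measure_display) (Omega0 : measurableType dd0)
    (P0 : probability Omega0 R) (X0 : I -> {RV P0 >-> R})
    (dd : measure_display) (Omega : measurableType dd)
    (P : probability Omega R) (X : 'I_d -> I -> {RV P >-> R})
    (X0_gauss : gaussian_process X0)
    (X0_centered : forall x, ('E_P0[X0 x] = 0)%E)
    (X_indep : independent_processes X)
    (X_copies : forall i, same_law (X i) X0).

Let near_event (dd' : measure_display) (O : measurableType dd') (Q : probability O R)
  (Y : I -> {RV Q >-> R}) (r : R) (x : I) (ys : seq I) : set O :=
  [set w | forall y, y \in ys -> (`|Y y w - Y x w| < r)%R].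

Let near_event_law i r x ys : P (near_event (X i) r x ys) = P0 (near_event X0 r x ys).
Proof.
pose k := size ys; pose t (j : 'I_k.+1) := nth x (x :: ys) j.
pose B : set (borel_rV R k.+1) := [set v | forall j : 'I_k.+1, `|(v : 'rV[R]_k.+1) 0 j - (v : 'rV[R]_k.+1) 0 0| < r].
have mB : measurable B.
  apply: measurable_forall_ord => j; apply: measurable_lt_cst.
  by apply: measurableT_comp => //; apply: measurable_funB; exact: measurable_coord.
have E (dd' : measure_display) (O : measurableType dd') (Q : probability O R) (Y : I -> {RV Q >-> R}) :
    0 < r -> near_event Y r x ys = [set w | B (\row_j Y (t j) w)].
  move=> r0; apply/seteqP; split => w /= h.
    move=> j; rewrite !mxE /t /=; case: (unliftP 0 j) => [j'|] ->; last by rewrite subrr normr0.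
    by rewrite lift0 /=; apply: h; apply: mem_nth.
  move=> y yys; have jk : ((index y ys).+1 < k.+1)%N by rewrite ltnS index_mem.
  by have := h (Ordinal jk); rewrite !mxE /t /= nth_index.
have [r0|r0] := ltP 0 r; first by rewrite !E//; exact: X_copies.
case: ys {k t B mB E} => [|y ys].
  rewrite /near_event (_ : [set w | _] = setT); last by apply/seteqP; split.
  rewrite (_ : [set w | _] = setT); last by apply/seteqP; split.
  by rewrite (@probability_setT _ _ _ P) (@probability_setT _ _ _ P0).
have E0 (dd' : measure_display) (O : measurableType dd') (Q : probability O R) (Y : I -> {RV Q >-> R}) :
    near_event Y r x (y :: ys) = set0.
  apply/seteqP; split => // w /(_ y); rewrite inE eqxx => /(_ isT).
  by apply/negP; rewrite -leNgt (le_trans r0).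
by rewrite !E0 !measure0.
Qed.

Let measurable_near_event (dd' : measure_display) (O : measurableType dd') (Y : I -> O -> R)
  (r : R) (x : I) (ys : seq I) : (forall y, measurable_fun setT (Y y)) ->
  measurable [set w | forall y, y \in ys -> (`|Y y w - Y x w| < r)%R].
Proof.
move=> mY.
have mE y : measurable [set w | `|Y y w - Y x w| < r].
  apply: measurable_lt_cst; apply: measurableT_comp => //.
  by apply: measurable_funB; exact: mY.
elim: ys => [|y ys IH].
  by rewrite (_ : [set w | _] = setT)//; apply/seteqP; split.
rewrite (_ : [set w | _] = [set w | `|Y y w - Y x w| < r] `&`
   [set w | forall y, y \in ys -> `|Y y w - Y x w| < r]); first exact: measurableI.
apply/seteqP; split => w /= h.
  by split => [|z zs]; apply: h; rewrite inE ?eqxx// zs orbT.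
by move=> z; rewrite inE => /orP[/eqP->|]; [case: h|case: h => _; apply].
Qed.

Let near_event_sigma i r x ys : sigma_gen setT (X i) (near_event (X i) r x ys).
Proof.
pose G := [set A | exists (y : I) (B : set R), [/\ [set: I] y, measurable B & A = X i y @^-1` B]].
have mX y : measurable_fun setT (X i y : g_sigma_algebraType G -> R).
  move=> _ B mB; rewrite setTI; apply: sub_sigma_algebra.
  by exists y, B.
exact: (measurable_near_event r x ys mX).
Qed.

(** The events for the d coordinates are independent, and each has the probability of the
    corresponding event for X0, since it depends on finitely many values; the bound for one
    coordinate is raised to the power d. *)
Lemma path_small_ball (S : set I) (kap : I -> I -> R) (r : R) (x : I) (ys : seq I) :
  nondet_on X0 S kap -> 0 < r -> S x -> (forall y, y \in ys -> S y) ->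
  (P [set w | forall y, y \in ys -> forall j, (`|X j y w - X j x w| < r)%R] <=
    (expR ((size ys)%:R / 2) ^+ d * kchain kap d r x ys)%:E)%E.
Proof.
move=> nd r0 Sx Sys.
have [b [b0 bd Pb]] := small_ball_process X0_gauss X0_centered d nd r0 Sx Sys.
have h i : (P (near_event (X i) r x ys) <= (expR ((size ys)%:R / 2) * b)%:E)%E.
  rewrite near_event_law; apply: le_trans Pb; apply: le_measure; rewrite ?inE.
  - exact: measurable_near_event.
  - have mE y : measurable [set w | `|X0 y w - X0 x w| <= r].
      by apply: measurable_le_cst; apply: measurableT_comp => //; exact: measurable_funB.
    rewrite (_ : [set w | _] = \bigcap_(j in [set: 'I_(size ys)]) [set w | `|X0 (nth x ys j) w - X0 x w| <= r]).
      exact: fin_bigcap_measurable.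
    apply/seteqP; split => w /= hw; first by move=> j _; apply/hw/mem_nth.
    move=> y yys; have jk : (index y ys < size ys)%N by rewrite index_mem.
    by have := hw (Ordinal jk) Logic.I; rewrite /= nth_index.
  - by move=> w /= hw y yys; apply/ltW/hw.
have := X_indep (J := finset.setTfor 'I_d) (A := fun i => near_event (X i) r x ys) (fun i _ => @near_event_sigma i r x ys).
rewrite (_ : \bigcap_(i in _) _ = [set w | forall y, y \in ys -> forall j, (`|X j y w - X j x w| < r)%R]); last first.
  apply/seteqP; split => w /= hw; first by move=> y yys j; apply: (hw j) => //=; rewrite inE.
  by move=> j _ y yys; apply: hw.
move=> ->.
have pE i : P (near_event (X i) r x ys) = (fine (P (near_event (X i) r x ys)))%:E.
  by rewrite fineK// fin_num_measure//; exact: measurable_near_event.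
under eq_bigr do rewrite pE.
rewrite prodEFin lee_fin; apply: (@le_trans _ _ (\prod_(i in finset.setTfor 'I_d) (expR ((size ys)%:R / 2) * b))).
  by apply: ler_prod => i _; rewrite fine_ge0//= -lee_fin -pE.
rewrite prodr_const cardsT card_ord exprMn; apply: ler_wpM2l => //.
Qed.

End PathSmallBall.

Section CellEnergy.
Context (R : realType) (N d : nat)
    (dd0 : measure_display) (Omega0 : measurableType dd0)
    (P0 : probability Omega0 R) (X0 : 'rV[R]_N -> {RV P0 >-> R})
    (dd : measure_display) (Omega : measurableType dd)
    (P : probability Omega R) (X : 'I_d -> 'rV[R]_N -> {RV P >-> R})
    (X0_gauss : gaussian_process X0)
    (X0_centered : forall x, ('E_P0[X0 x] = 0)%E)
    (X_cont : forall w, continuous (sample_path X w))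
    (X_indep : independent_processes X)
    (X_copies : forall i, same_law (X i) X0)
    (q : R) (hq : 1 < q)
    (mu : probability (borel_rV R N) R).
Notation T := (borel_rV R N).
Variables (A : set T) (kap : 'rV[R]_N -> 'rV[R]_N -> R) (r : R).
Hypotheses (mA : measurable A) (r0 : 0 < r) (nd : nondet_on X0 A kap).
(** Up to constants the probability that X(y) falls within r of its prediction from X(z): min(1, r /
    sqrt (kap y z))^d. *)
Definition ball_kernel (y z : 'rV[R]_N) : R := gfac (kap y z / r ^+ 2) ^+ d.
Hypothesis mphi : forall z, measurable_fun setT (fun y : T => ball_kernel y z).

Let q1 : 0 < q - 1. Proof. by rewrite subr_gt0. Qed.

Let near_triples : set ((T * Omega) * T) :=
  [set z | A z.2 /\ forall j, `|X j z.2 z.1.2 - X j z.1.1 z.1.2| < r].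

Let measurable_near_triples : measurable near_triples.
Proof.
have mX := @measurable_sample_coord _ _ _ _ _ P X X_cont.
have m2 : measurable [set z : (T * Omega) * T | forall j, `|X j z.2 z.1.2 - X j z.1.1 z.1.2| < r].
  apply: measurable_forall_ord => j; apply: measurable_lt_cst.
  apply: measurableT_comp => //; apply: measurable_funB.
    apply: (measurableT_comp (mX j) (g := fun z : (T * Omega) * T => (z.2, z.1.2))).
    apply: measurable_fun_pair => //.
    exact: (measurableT_comp measurable_snd measurable_fst).
  exact: (measurableT_comp (mX j) measurable_fst).
rewrite (_ : near_triples = (snd @^-1` A) `&`
   [set z : (T * Omega) * T | forall j, `|X j z.2 z.1.2 - X j z.1.1 z.1.2| < r]).
  by apply: measurableI => //; rewrite -[X in measurable X]setTI; exact: measurable_snd.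
by apply/seteqP; split.
Qed.

Let near_set_sample w x : near_set (sample_path X w : T -> 'rV[R]_d) A r x = xsection near_triples (x, w).
Proof.
apply/seteqP; split => y; rewrite /near_set /xsection /= inE /near_triples /=.
  by move=> [Ay h]; split => // j; have := h j; rewrite !mxE.
by move=> [Ay h]; split => // j; rewrite !mxE.
Qed.

Let mass (z : T * Omega) : R := near_mass mu (sample_path X z.2) A r z.1.

Let massE z : (mass z)%:E = mu (xsection near_triples z).
Proof.
rewrite /mass /near_mass near_set_sample -surjective_pairing fineK// fin_num_measure//.
exact: measurable_xsection.
Qed.

Let mmass : measurable_fun setT mass.
Proof.
apply/measurable_EFinP; rewrite (_ : _ \o _ = mu \o xsection near_triples).
  exact: measurable_fun_xsection.
by apply/funext => z /=; rewrite massE.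
Qed.

Lemma measurable_ball_energy : measurable_fun setT (fun w => ball_energy mu (sample_path X w) q A r).
Proof.
pose f (z : T * Omega) : \bar R := (\1_A z.1 * mass z `^ (q - 1))%:E.
have mf : measurable_fun setT f.
  apply/measurable_EFinP; apply: measurable_funM.
    exact: (measurableT_comp (measurable_indic mA) measurable_fst).
  exact: (measurableT_comp (measurable_powR (q - 1)) mmass).
rewrite (_ : (fun w => _) = fubini_G mu f).
  apply: measurable_fun_fubini_tonelli_G => //.
  by move=> z; rewrite lee_fin mulr_ge0 ?powR_ge0// indicE ler0n.
apply/funext => w; rewrite /ball_energy /fubini_G [LHS]integral_mkcond.
apply: eq_integral => x _; rewrite patchE /f /= indicE.
by case: (x \in A); rewrite ?mul1r ?mul0r.
Qed.

Definition moment_order : nat := Num.bound (q - 1).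
Definition moment_const : R :=
  1 + expR (moment_order%:R / 2) ^+ d * moment_order%:R ^+ moment_order.

(** The power q - 1 is reached from an integer moment m above it by u^(q-1) <= 1 + u^m, applied to u
    = mass / G so that the bound stays homogeneous in G. The m-th moment comes from
    [section_mass_moment] with the empty list. *)
Lemma expected_near_mass (G : R) (x : T) : 0 < G -> A x ->
  (forall z, A z -> (\int[mu]_(y in A) (ball_kernel y z)%:E <= G%:E)%E) ->
  (\int[P]_w (near_mass mu (sample_path X w) A r x `^ (q - 1))%:E <=
    (moment_const * G `^ (q - 1))%:E)%E.
Proof.
move=> G0 Ax hG; set m := moment_order.
pose E : set (T * Omega) := [set z | A z.1 /\ forall j, `|X j z.1 z.2 - X j x z.2| < r].
have mE : measurable E.
  rewrite (_ : E = (fun z : T * Omega => ((x, z.2), z.1)) @^-1` near_triples); last first.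
    by apply/seteqP; split.
  rewrite -[X in measurable X]setTI.
  have mg : measurable_fun setT (fun z : T * Omega => ((x, z.2), z.1)).
    apply: measurable_fun_pair => //; apply: measurable_fun_pair => //.
  exact: mg.
have FE w : near_mass mu (sample_path X w) A r x = section_mass mu E w.
  rewrite /near_mass /section_mass near_set_sample.
  have -> : xsection near_triples (x, w) = ysection E w; last by [].
  by apply/seteqP; split => y; rewrite /xsection /ysection /= !inE.
have phi0 y z : 0 <= ball_kernel y z by rewrite exprn_ge0// gfac_ge0.
have Cge n : 0 <= expR (n%:R / 2) ^+ d :> R by rewrite exprn_ge0// expR_ge0.
have EA y w : E (y, w) -> A y by case.
have chainP (ys : seq T) : (forall y, y \in ys -> A y) ->
   (\int[P]_w (section_indic R E ys w)%:E <= (expR ((size ys)%:R / 2) ^+ d * chain (ball_kernel : T -> T -> R) x ys)%:E)%E.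
  move=> Ays; have := path_small_ball X0_gauss X0_centered X_indep X_copies nd r0 Ax Ays.
  have -> : kchain kap d r x ys = chain (ball_kernel : T -> T -> R) x ys.
    by elim: ys {Ays} => //= y ys ->.
  apply: le_trans.
  pose D := [set w | forall y, y \in ys -> forall j, (`|X j y w - X j x w| < r)%R].
  have DE w : section_indic R E ys w = \1_D w.
    rewrite /section_indic indicE.
    have [wD|wD] := boolP (w \in D).
      rewrite big_seq big1// => y yys; rewrite indicE mem_set//.
      by split; [exact: Ays|move: wD; rewrite inE => /(_ y yys)].
    apply/eqP; rewrite prodf_seq_eq0; apply: contraNT wD => /hasPn h.
    rewrite inE => y yys; have := h y yys; rewrite /= indicE.
    case: (boolP ((y, w) \in E)) => [|_]; last by rewrite eqxx.
    by rewrite inE => -[].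
  have mD : measurable D.
    have : measurable_fun setT (section_indic R E ys) by exact: measurable_section_indic.
    move=> /(_ measurableT [set 1] (measurable_set1 _)); rewrite setTI.
    rewrite (_ : _ @^-1` _ = D)//; apply/seteqP; split => w /=; rewrite DE indicE.
      by case: (boolP (w \in D)); rewrite ?inE// => _ /eqP; rewrite eq_sym oner_eq0.
    by move=> wD; rewrite mem_set.
  under eq_integral do rewrite DE.
  by rewrite integral_indic// setIT.
have := @section_mass_moment R _ _ T Omega mu P A E ball_kernel x (fun n => expR (n%:R / 2) ^+ d) G
  mA mE EA phi0 Ax Cge (ltW G0) mphi hG chainP m [::].
rewrite /= add0n mulr1 /section_indic; under eq_integral do rewrite big_nil mul1r.
move=> /(_ (fun _ h => False_ind _ (notF h))) hm.
have mS : measurable_fun setT (section_mass mu E) by exact: measurable_section_mass.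
have S0 w : 0 <= section_mass mu E w by exact: section_mass_ge0.
apply: (@le_trans _ _ (\int[P]_w ((G `^ (q - 1))%:E * (1%:E + (G ^- m)%:E * (section_mass mu E w ^+ m)%:E)))%E).
  apply: ge0_le_integral => //.
  - by move=> w _; rewrite lee_fin powR_ge0.
  - apply/measurable_EFinP; under eq_fun do rewrite FE.
    exact: (measurableT_comp (measurable_powR (q - 1)) mS).
  - apply: emeasurable_funM => //; apply: emeasurable_funD => //; apply: emeasurable_funM => //.
    by apply/measurable_EFinP; exact: measurable_funX.
  move=> w _; rewrite FE.
  change ((section_mass mu E w `^ (q - 1))%:E <= (G `^ (q - 1) * (1 + G ^- m * section_mass mu E w ^+ m))%:E)%E.
  rewrite lee_fin.
  rewrite -{1}(mulVKf (lt0r_neq0 G0) (section_mass mu E w)) powRM ?mulr_ge0 ?invr_ge0 ?(ltW G0)//.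
  apply: ler_wpM2l; first exact: powR_ge0.
  rewrite -exprVn -exprMn; apply: powR_le_1_exprn => //; first by rewrite mulr_ge0// invr_ge0 ltW.
  by rewrite ltW// /m /moment_order; apply: archi_boundP; exact: ltW.
have i0 w : [set: Omega] w -> (0 <= (section_mass mu E w ^+ m)%:E)%E by rewrite lee_fin exprn_ge0.
have mm : measurable_fun setT (fun w => (section_mass mu E w ^+ m)%:E).
  by apply/measurable_EFinP; exact: measurable_funX.
have Gm : (0 <= (G ^- m)%:E)%E by rewrite lee_fin invr_ge0 exprn_ge0// ltW.
rewrite ge0_integralZl//; last 3 first.
- by apply: emeasurable_funD => //; exact: emeasurable_funM.
- by move=> w _; rewrite adde_ge0// mule_ge0// i0.
- by rewrite lee_fin powR_ge0.
rewrite [leRHS]EFinM muleC; apply: lee_wpmul2r; first by rewrite lee_fin powR_ge0.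
rewrite ge0_integralD//; last 2 first.
- by move=> w _; rewrite mule_ge0// i0.
- exact: emeasurable_funM.
rewrite integral_cst// [X in (1 * X)%E](_ : _ = 1%E) ?mule1; last exact: probability_setT.
rewrite /moment_const EFinD; apply: leeD => //.
rewrite ge0_integralZl//.
apply: le_trans (lee_wpmul2l Gm hm) _.
by rewrite -EFinM lee_fin exprMn -/m [leLHS]mulrC -!mulrA mulfV ?mulr1// expf_neq0// lt0r_neq0.
Qed.

Lemma expected_ball_energy (G : R) : 0 < G ->
  (forall z, A z -> (\int[mu]_(y in A) (ball_kernel y z)%:E <= G%:E)%E) ->
  (\int[P]_w ball_energy mu (sample_path X w) q A r <=
    (moment_const * G `^ (q - 1))%:E * mu A)%E.
Proof.
move=> G0 hG.
pose f (z : T * Omega) : \bar R := (\1_A z.1 * mass z `^ (q - 1))%:E.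
have mf : measurable_fun setT f.
  apply/measurable_EFinP; apply: measurable_funM.
    exact: (measurableT_comp (measurable_indic mA) measurable_fst).
  exact: (measurableT_comp (measurable_powR (q - 1)) mmass).
have f0 z : (0 <= f z)%E by rewrite lee_fin mulr_ge0 ?powR_ge0// indicE ler0n.
have -> : (\int[P]_w ball_energy mu (sample_path X w) q A r = \int[P]_w \int[mu]_x f (x, w))%E.
  apply: eq_integral => w _; rewrite /ball_energy [LHS]integral_mkcond.
  apply: eq_integral => x _; rewrite patchE /f /= indicE.
  by case: (x \in A); rewrite ?mul1r ?mul0r.
rewrite -(fubini_tonelli _ mf f0) -integral_cst//.
have -> : (\int[mu]_x \int[P]_w f (x, w) = \int[mu]_(x in A) \int[P]_w f (x, w))%E.
  rewrite [RHS]integral_mkcond; apply: eq_integral => x _.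
  rewrite patchE; case: ifPn => // nAx.
  by apply: integral0_eq => w _; rewrite /f indicE (negbTE nAx) mul0r.
apply: ge0_le_integral => //.
- by move=> x _; exact: integral_ge0.
- apply: measurable_funTS; exact: (measurable_fun_fubini_tonelli_F _ mf).
move=> x Ax; apply: le_trans (expected_near_mass G0 Ax hG).
rewrite le_eqVlt; apply/orP; left; apply/eqP; apply: eq_integral => w _.
by rewrite /f indicE mem_set//= mul1r.
Qed.

End CellEnergy.

Lemma gfac_inv_sqr (R : realType) (u : R) : 0 < u -> gfac (u ^- 2) <= u.
Proof.
move=> u0; rewrite /gfac; case: ifPn => [|_]; last by rewrite -exprVn sqrtr_sqr gtr0_norm ?invr_gt0// invrK.
rewrite invf_le1 ?exprn_gt0// => u1; rewrite leNgt; apply/negP => h.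
by move: u1; rewrite leNgt exprn_ilt1// ltW.
Qed.

(** * Riesz kernels and their potentials *)

Section RieszKernel.
Context (R : realType) (N d : nat) (mu : probability (borel_rV R N) R).
Notation T := (borel_rV R N).
Notation idT := (fun x : T => (x : 'rV[R]_N)).
Variables (a c : R).
Hypotheses (a0 : 0 < a) (c0 : 0 < c).

Definition sq_dist (y z : 'rV[R]_N) : R := \sum_(j < N) (y 0 j - z 0 j) ^+ 2.

(** This is c |y - z|^(2 a) in the Euclidean norm: the lower bound for the variance of X0(y) given
    farther points when psi(r) >= r^(2 a). *)
Definition riesz (y z : 'rV[R]_N) : R := c * sq_dist y z `^ a.

Notation kernel r := (ball_kernel d riesz r).

Lemma sq_dist_ge0 y z : 0 <= sq_dist y z.
Proof. by apply: sumr_ge0 => j _; exact: sqr_ge0. Qed.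

Lemma measurable_riesz_kernel r : measurable_fun setT (fun p : T * T => kernel r p.1 p.2).
Proof.
apply: measurable_funX; apply: (measurableT_comp (f := @gfac R)).
  by apply: nonincreasing_measurable => // x y xy; exact: gfac_le.
apply: measurable_funM => //; apply: measurable_funM => //.
apply: (measurableT_comp (measurable_powR a)); apply: measurable_sum => j.
apply: measurable_funX; apply: measurable_funB.
  exact: (measurableT_comp (@measurable_coord R N j) measurable_fst).
exact: (measurableT_comp (@measurable_coord R N j) measurable_snd).
Qed.

Lemma kernel_ge0 r y z : 0 <= kernel r y z.
Proof. by rewrite exprn_ge0// gfac_ge0. Qed.

Lemma kernel_le1 r y z : kernel r y z <= 1.
Proof. by rewrite exprn_ile1// ?gfac_ge0// gfac_le1. Qed.

Variable t : R.
Hypotheses (t0 : 0 < t) (td : t <= d%:R).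

(** The Gaussian factor is at most 1, so that its exponent d may be lowered to any t <= d. This is
    the origin of d in min(d, D / a). *)
Lemma kernel_far (r e : R) (y z : 'rV[R]_N) : 0 < r -> 0 < e ->
  (exists j, e <= `|y 0 j - z 0 j|) ->
  kernel r y z <= ((Num.sqrt c)^-1 * e `^ (- a) * r) `^ t.
Proof.
move=> r0 e0 [j ej]; set u := (_ * _ * _ : R).
have u0 : 0 < u by rewrite !mulr_gt0 ?invr_gt0 ?sqrtr_gt0 ?powR_gt0.
have sq : e ^+ 2 <= sq_dist y z.
  rewrite /sq_dist (bigD1 j)//=; apply: ler_wpDr; first by apply: sumr_ge0 => i _; exact: sqr_ge0.
  by rewrite -[leRHS]real_normK ?num_real//; apply: lerXn2r; rewrite ?nnegrE// ltW.
have g1 : gfac (riesz y z / r ^+ 2) <= u.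
  apply: le_trans (gfac_inv_sqr u0); apply: gfac_le.
  have -> : u ^- 2 = c * (e ^+ 2) `^ a / r ^+ 2.
    have -> : (e ^+ 2) `^ a = (e `^ a) ^+ 2.
      by rewrite -(powR_mulrn 2 (ltW e0)) -(powR_mulrn 2 (powR_ge0 e a)) -!powRrM mulrC.
    rewrite /u powRN -{2}(sqr_sqrtr (ltW c0)).
    by field; rewrite !gt_eqF ?sqrtr_gt0 ?powR_gt0.
  apply: ler_wpM2r; first by rewrite invr_ge0 exprn_ge0// ltW.
  apply: ler_wpM2l; first exact: ltW.
  by apply: ler_powR2 => //; exact: sqr_ge0.
have g0 : 0 <= gfac (riesz y z / r ^+ 2) by exact: gfac_ge0.
rewrite /ball_kernel; apply: (@le_trans _ _ (gfac (riesz y z / r ^+ 2) `^ t)); last exact: ler_powR2.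
rewrite -powR_mulrn//; move: g0; rewrite le_eqVlt => /predU1P[<-|g0].
  by rewrite !powR0 ?gt_eqF// (lt_le_trans t0).
by apply: powR_antitone => //; exact: gfac_le1.
Qed.

Definition shell_weight (r : R) (m : nat) : R :=
  ((Num.sqrt c)^-1 * dyadic R m.+1 `^ (- a) * r) `^ t.

(** Decomposition according to the sup distance from z: the ball of radius 2^-M, where the kernel is
    bounded by 1, the M shells between 2^-(m+1) and 2^-m, and the points at distance at least 1. On
    each shell the indicator is enlarged to the full ball, whose mass is a near mass. *)
Lemma kernel_shells (r : R) (M : nat) (y z : 'rV[R]_N) : 0 < r ->
  kernel r y z <= \1_(near_set idT setT (dyadic R M) z) (y : T)
    + \sum_(m < M) shell_weight r m * \1_(near_set idT setT (dyadic R m) z) (y : T)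
    + ((Num.sqrt c)^-1 * r) `^ t.
Proof.
move=> r0.
have w0 m : 0 <= shell_weight r m by exact: powR_ge0.
have s0 M' : 0 <= \sum_(m < M') shell_weight r m * \1_(near_set idT setT (dyadic R m) z) (y : T).
  by apply: sumr_ge0 => m _; rewrite mulr_ge0// indicE ler0n.
have l0 : 0 <= ((Num.sqrt c)^-1 * r) `^ t by exact: powR_ge0.
have far M' : ~ near_set idT setT (dyadic R M') z y -> exists j, dyadic R M' <= `|y 0 j - z 0 j|.
  move=> h; apply: contrapT => /forallNP h'; apply: h; split => // j.
  by have /negP := h' j; rewrite -ltNge.
have near M' : near_set idT setT (dyadic R M') z y ->
   kernel r y z <= \1_(near_set idT setT (dyadic R M') z) (y : T)
    + \sum_(m < M') shell_weight r m * \1_(near_set idT setT (dyadic R m) z) (y : T)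
    + ((Num.sqrt c)^-1 * r) `^ t.
  move=> h; rewrite -addrA indicE mem_set//; apply: ler_wpDr; first by rewrite addr_ge0.
  exact: kernel_le1.
elim: M => [|M IH].
  have [h|h] := pselect (near_set idT setT (dyadic R 0) z y); first exact: near.
  rewrite big_ord0 addr0; apply: ler_wpDl; first by rewrite indicE ler0n.
  apply: le_trans (kernel_far r0 _ (far _ h)) _; first exact: dyadic_gt0.
  by rewrite /dyadic expr0 powR1 mulr1.
have [h|h] := pselect (near_set idT setT (dyadic R M.+1) z y); first exact: near.
rewrite [X in X + _ + _]indicE memNset// add0r big_ord_recr /=.
have [h'|h'] := pselect (near_set idT setT (dyadic R M) z y).
  apply: ler_wpDr => //; apply: ler_wpDl; first exact: s0.
  rewrite indicE mem_set// mulr1.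
  by apply: (kernel_far r0 _ (far _ h)); exact: dyadic_gt0.
move: IH; rewrite [X in X + _ + _]indicE memNset// add0r => /le_trans; apply.
by rewrite lerD2r lerDl mulr_ge0// indicE ler0n.
Qed.

Definition potential (r : R) (z : T) : R := fine (\int[mu]_y (kernel r y z)%:E).

Lemma measurable_kernel_l r z : measurable_fun setT (fun y : T => kernel r y z).
Proof.
exact: (measurableT_comp (measurable_riesz_kernel r) (measurable_pair2 (z : T))).
Qed.

Lemma potentialE r z : (\int[mu]_y (kernel r y z)%:E = (potential r z)%:E)%E.
Proof.
rewrite fineK// ge0_fin_numE; last by apply: integral_ge0 => y _; rewrite lee_fin kernel_ge0.
apply: le_lt_trans (ltry 1); rewrite -[leRHS](@probability_setT _ _ _ mu) -[leRHS]mul1e -integral_cst//.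
apply: ge0_le_integral => //.
- by move=> y _; rewrite lee_fin kernel_ge0.
- by apply/measurable_EFinP; exact: measurable_kernel_l.
- by move=> y _; rewrite lee_fin kernel_le1.
Qed.

Lemma potential_ge0 r z : 0 <= potential r z.
Proof. by apply: fine_ge0; apply: integral_ge0 => y _; rewrite lee_fin kernel_ge0. Qed.

Lemma potential_le1 r z : potential r z <= 1.
Proof.
rewrite -lee_fin -potentialE -[leRHS](@probability_setT _ _ _ mu) -[leRHS]mul1e -integral_cst//.
apply: ge0_le_integral => //.
- by move=> y _; rewrite lee_fin kernel_ge0.
- by apply/measurable_EFinP; exact: measurable_kernel_l.
- by move=> y _; rewrite lee_fin kernel_le1.
Qed.

Lemma measurable_potential r : measurable_fun setT (potential r).
Proof.
apply/measurable_EFinP.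
rewrite (_ : _ \o _ = fubini_G mu (fun p : T * T => (kernel r p.1 p.2)%:E)).
  apply: measurable_fun_fubini_tonelli_G; last by move=> p; rewrite lee_fin kernel_ge0.
  by apply/measurable_EFinP; exact: measurable_riesz_kernel.
by apply/funext => z; rewrite /= -potentialE.
Qed.

Lemma potential_shells (r : R) (M : nat) (z : T) : 0 < r ->
  potential r z <= near_mass mu idT setT (dyadic R M) z
    + \sum_(m < M) shell_weight r m * near_mass mu idT setT (dyadic R m) z
    + ((Num.sqrt c)^-1 * r) `^ t.
Proof.
move=> r0; have mi := @measurable_id_coord R N.
have mN m : measurable (near_set idT setT (dyadic R m) z) by exact: measurable_near_set.
have mI m : measurable_fun setT (\1_(near_set idT setT (dyadic R m) z) : T -> R).
  exact: measurable_indic.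
have w0 m : 0 <= shell_weight r m by exact: powR_ge0.
have l0 : 0 <= ((Num.sqrt c)^-1 * r) `^ t by exact: powR_ge0.
have I0 m y : 0 <= \1_(near_set idT setT (dyadic R m) z) (y : T) :> R by rewrite indicE ler0n.
have II m : (\int[mu]_y (\1_(near_set idT setT (dyadic R m) z) y)%:E = (near_mass mu idT setT (dyadic R m) z)%:E)%E.
  by rewrite integral_indic// setIT; exact: near_massE.
rewrite -lee_fin -potentialE.
have s0 y : 0 <= \sum_(m < M) shell_weight r m * \1_(near_set idT setT (dyadic R m) z) (y : T).
  by apply: sumr_ge0 => m _; exact: mulr_ge0.
have ms : measurable_fun setT (fun y : T => \sum_(m < M) shell_weight r m * \1_(near_set idT setT (dyadic R m) z) y).
  by apply: measurable_sum => m; exact: measurable_funM.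
apply: (@le_trans _ _ (\int[mu]_y ((\1_(near_set idT setT (dyadic R M) z) y)%:E +
   ((\sum_(m < M) shell_weight r m * \1_(near_set idT setT (dyadic R m) z) y)%:E + (((Num.sqrt c)^-1 * r) `^ t)%:E)))%E).
  apply: ge0_le_integral => //.
  - by move=> y _; rewrite lee_fin kernel_ge0.
  - by apply/measurable_EFinP; exact: measurable_kernel_l.
  - apply: emeasurable_funD; first exact/measurable_EFinP.
    by apply: emeasurable_funD => //; exact/measurable_EFinP.
  - by move=> y _; rewrite -!EFinD lee_fin addrA; exact: kernel_shells.
rewrite ge0_integralD//; last 3 first.
- exact/measurable_EFinP.
- by move=> y _; rewrite -EFinD lee_fin addr_ge0.
- by apply: emeasurable_funD => //; exact/measurable_EFinP.
rewrite II -addrA [leRHS]EFinD; apply: leeD => //.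
rewrite ge0_integralD//; last 2 first.
- by move=> y _; rewrite lee_fin s0.
- exact/measurable_EFinP.
rewrite EFinD; apply: leeD; last first.
  rewrite integral_cst// -[leRHS]mule1; apply: lee_wpmul2l; first by rewrite lee_fin.
  exact: probability_le1.
under eq_integral do rewrite -sumEFin.
rewrite ge0_integral_sum//; last 2 first.
- by move=> m; apply/measurable_EFinP; exact: measurable_funM.
- by move=> m y _; rewrite lee_fin mulr_ge0.
rewrite -sumEFin; apply: lee_sum => m _.
under eq_integral do rewrite EFinM.
rewrite ge0_integralZl// ?II ?EFinM//.
- exact/measurable_EFinP.
- by rewrite lee_fin.
Qed.

End RieszKernel.

Section PotentialMoment.
Context (R : realType) (N d : nat) (mu : probability (borel_rV R N) R) (q : R).
Hypothesis hq : 1 < q.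
Notation T := (borel_rV R N).
Notation idT := (fun x : T => (x : 'rV[R]_N)).
Variables (a c t s C : R).
Hypotheses (a0 : 0 < a) (c0 : 0 < c) (t0 : 0 < t) (td : t <= d%:R) (C0 : 0 <= C).
Hypothesis ats : a * t <= s.
Hypothesis energyC : forall r, 0 < r <= 1 ->
  (ball_energy mu idT q setT r <= (C * r `^ ((q - 1) * s))%:E)%E.

Let q1 : 0 < q - 1. Proof. by rewrite subr_gt0. Qed.
Let p0 : 0 < (q - 1) * t. Proof. exact: mulr_gt0. Qed.

Let energy_at m : (ball_energy mu idT q setT (dyadic R m) <= (C * (dyadic R m `^ a) `^ ((q - 1) * t))%:E)%E.
Proof.
have D0 := dyadic_gt0 R m.
apply: le_trans (energyC _) _; first by rewrite D0 dyadic_le1.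
rewrite lee_fin; apply: ler_wpM2l => //; rewrite -powRrM.
apply: powR_antitone => //; first exact: dyadic_le1.
by rewrite mulrCA ler_pM2l.
Qed.

(** The shell m contributes a constant times r^((q-1) t) 2^(m a (q-1) t) times the energy of mu at
    2^-m, and a t <= s makes this O(r^((q-1) t)) for every m. The innermost ball is of the same
    order since 2^(-M a) <= r. Of the factor (M + 2)^q, the power q - 1 comes from separating the M
    + 2 terms and one more from adding them. *)
Lemma potential_moment : exists2 K : R, 0 <= K & forall r M, 0 < r -> dyadic R M `^ a <= r ->
  (\int[mu]_z (potential d mu a c r z `^ (q - 1))%:E <= (K * M.+2%:R `^ q * r `^ ((q - 1) * t))%:E)%E.
Proof.
pose k := (Num.sqrt c)^-1; have k0 : 0 < k by rewrite invr_gt0 sqrtr_gt0.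
pose b := (q - 1) * t.
pose K1 := C * (k * 2 `^ a) `^ b; pose K3 := k `^ b.
have K10 : 0 <= K1 by rewrite mulr_ge0 ?powR_ge0.
have K30 : 0 <= K3 by exact: powR_ge0.
exists (K1 + C + K3); first by rewrite !addr_ge0.
move=> r M r0 Mr; have mi := @measurable_id_coord R N.
have mN m : measurable_fun setT (near_mass mu idT setT (dyadic R m)) by exact: measurable_near_mass.
have n0 m z : 0 <= near_mass mu idT setT (dyadic R m) z by exact: near_mass_ge0.
have mNq m : measurable_fun setT (fun z => (near_mass mu idT setT (dyadic R m) z `^ (q - 1))%:E).
  exact: measurable_near_mass_powR.
pose w m := if (m < M)%N then shell_weight a c t r m else 1.
have w0 m : 0 <= w m by rewrite /w; case: ifP => // _; exact: powR_ge0.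
pose tau z m := if (m <= M)%N then w m * near_mass mu idT setT (dyadic R m) z else (k * r) `^ t.
have tau0 z m : 0 <= tau z m by rewrite /tau; case: ifP => _; [exact: mulr_ge0|exact: powR_ge0].
have gtau z : potential d mu a c r z <= \sum_(m <- iota 0 M.+2) tau z m.
  apply: le_trans (potential_shells mu a0 c0 t0 td M z r0) _.
  rewrite -/(index_iota 0 M.+2) !big_nat_recr//= /tau ltnn leqnn /w ltnn mul1r.
  rewrite -/k lerD2r [leLHS]addrC; apply: lerD => //.
  rewrite big_mkord le_eqVlt; apply/orP; left; apply/eqP.
  by apply: eq_bigr => m _; rewrite ltn_ord (ltnW (ltn_ord m)).
have gq z : potential d mu a c r z `^ (q - 1) <= M.+2%:R `^ (q - 1) * \sum_(m <- iota 0 M.+2) tau z m `^ (q - 1).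
  apply: le_trans (ler_powR2 q1 (potential_ge0 _ _ _ _ _ _) (gtau z)) _.
  by have := @ler_powR_sum _ _ (iota 0 M.+2) (tau z) (q - 1) q1 (fun m _ => tau0 z m); rewrite size_iota.
have mtau m : measurable_fun setT (fun z => (tau z m `^ (q - 1))%:E).
  apply/measurable_EFinP; apply: (measurableT_comp (measurable_powR (q - 1))).
  by rewrite /tau; case: (m <= M)%N => //; apply: measurable_funM.
have itau m : (\int[mu]_z (tau z m `^ (q - 1))%:E <= ((K1 + C + K3) * r `^ b)%:E)%E.
  have rb0 : 0 <= r `^ b by exact: powR_ge0.
  rewrite /tau; case: leqP => mM; last first.
    rewrite integral_cst// -[leRHS]mule1; apply: lee_pmul => //.
    - by rewrite lee_fin powR_ge0.
    - rewrite lee_fin -powRrM [t * _]mulrC powRM ?(ltW k0) ?(ltW r0)//.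
      by apply: ler_wpM2r => //; rewrite lerDr addr_ge0.
    - exact: probability_le1.
  under eq_integral do rewrite powRM// EFinM.
  rewrite ge0_integralZl//; last 2 first.
  - by move=> z _; rewrite lee_fin powR_ge0.
  - by rewrite lee_fin powR_ge0.
  apply: le_trans (lee_wpmul2l _ (energy_at m)) _; first by rewrite lee_fin powR_ge0.
  rewrite -EFinM lee_fin /w; have D0 := dyadic_gt0 R m.
  have Da0 : 0 < dyadic R m `^ a by exact: powR_gt0.
  case: ltnP => mM'.
    have -> : shell_weight a c t r m `^ (q - 1) * (C * (dyadic R m `^ a) `^ b) = K1 * r `^ b.
      rewrite /shell_weight -powRrM [t * _]mulrC -/b -/k dyadicS powRM ?invr_ge0 ?(ltW D0)//.
      rewrite !powRN powRM ?(ltW r0)//; last by rewrite !mulr_ge0 ?invr_ge0 ?powR_ge0 ?(ltW k0).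
      have -> : k * ((dyadic R m `^ a)^-1 * (2^-1 `^ a)^-1) = k * 2 `^ a * (dyadic R m `^ a)^-1.
        have -> : (2^-1 `^ a)^-1 = 2 `^ a :> R.
          have h : 2^-1 `^ a * 2 `^ a = 1 :> R by rewrite -powRM ?invr_ge0// mulVf ?pnatr_eq0// powR1.
          have x0 : 2^-1 `^ a != 0 :> R by rewrite gt_eqF// powR_gt0// invr_gt0.
          by apply: (mulfI x0); rewrite h mulfV.
        by ring.
      rewrite (@powRM _ (k * 2 `^ a) (dyadic R m `^ a)^-1 b) ?invr_ge0 ?powR_ge0 ?mulr_ge0 ?powR_ge0 ?(ltW k0)//.
      have h : (dyadic R m `^ a)^-1 `^ b * (dyadic R m `^ a) `^ b = 1.
        by rewrite -powRM ?invr_ge0 ?powR_ge0// mulVf ?powR1// gt_eqF.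
      rewrite [LHS](_ : _ = K1 * r `^ b * ((dyadic R m `^ a)^-1 `^ b * (dyadic R m `^ a) `^ b)); last first.
        by rewrite /K1; ring.
      by rewrite h mulr1.
    by apply: ler_wpM2r => //; rewrite -addrA lerDl addr_ge0.
  rewrite powR1 mul1r; have -> : m = M by apply/eqP; rewrite eqn_leq mM mM'.
  apply: (@le_trans _ _ (C * r `^ b)); first by apply: ler_wpM2l => //; apply: ler_powR2 => //; exact: powR_ge0.
  by apply: ler_wpM2r => //; rewrite addrAC lerDr addr_ge0.
have tq0 m z : (0 <= (tau z m `^ (q - 1))%:E)%E by rewrite lee_fin powR_ge0.
apply: (@le_trans _ _ (\int[mu]_z ((M.+2%:R `^ (q - 1))%:E * \sum_(m <- iota 0 M.+2) (tau z m `^ (q - 1))%:E))%E).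
  apply: ge0_le_integral => //.
  - by move=> z _; rewrite lee_fin powR_ge0.
  - apply/measurable_EFinP; apply: (measurableT_comp (measurable_powR (q - 1))).
    exact: measurable_potential.
  - by apply: emeasurable_funM => //; apply: emeasurable_sum => m.
  - by move=> z _; rewrite sumEFin -EFinM lee_fin.
rewrite ge0_integralZl//; last 2 first.
- by apply: emeasurable_sum.
- by move=> z _; apply: sume_ge0 => m _.
rewrite ge0_integral_sum//.
apply: (@le_trans _ _ ((M.+2%:R `^ (q - 1))%:E * \sum_(m <- iota 0 M.+2) ((K1 + C + K3) * r `^ b)%:E)%E).
  by apply: lee_wpmul2l; [rewrite lee_fin powR_ge0|apply: lee_sum => m _; exact: itau].
rewrite sumEFin -EFinM lee_fin big_const_seq count_predT size_iota iter_addr addr0 -[_ * _ *+ M.+2]mulr_natr.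
rewrite -(@mulr_powRB1 _ M.+2%:R q)//; last exact: lt_trans hq.
by rewrite le_eqVlt; apply/orP; left; apply/eqP; rewrite -/b; ring.
Qed.

End PotentialMoment.

Lemma seq_argmin (R : realType) (I : eqType) (f : I -> R) (zs : seq I) : zs != [::] ->
  exists2 z, z \in zs & forall z', z' \in zs -> f z <= f z'.
Proof.
elim: zs => //= z zs IH _; have [->|zs0] := eqVneq zs [::].
  by exists z; rewrite ?inE// => z'; rewrite inE => /eqP ->.
have [y yzs hy] := IH zs0; have [fzy|fyz] := leP (f z) (f y).
  exists z; rewrite ?inE ?eqxx// => z'; rewrite inE => /orP[/eqP->//|/hy]; exact: le_trans.
exists y; rewrite ?inE ?yzs ?orbT// => z'; rewrite inE => /orP[/eqP->|/hy//]; exact: ltW.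
Qed.

(** * Power bounds for psi from its indices *)

Section Indices.
Context (R : realType) (psi : R -> R).

Lemma psi_ge_of_upper_index (a : R) : (upper_index psi < a%:E)%E ->
  exists2 e : R, 0 < e & forall r, 0 < r < e -> r `^ (2 * a) <= psi r.
Proof.
move=> /ereal_inf_lt[_ [b [b0 /cvgryPge hb] <-]]; rewrite lte_fin => ba.
have [e /= e0 he] := hb 1.
exists (Num.min e 1); first by rewrite lt_min e0/=.
move=> r /andP[r0]; rewrite lt_min => /andP[re r1].
have : 1 <= psi r / r `^ (2 * b) by apply: he => //=; rewrite sub0r normrN gtr0_norm.
rewrite ler_pdivlMr ?powR_gt0// mul1r; apply: le_trans.
by apply: powR_antitone => //; [exact: ltW|rewrite ler_pM2l// ltW].
Qed.

Lemma psi_le_of_lower_index (a : R) : (a%:E < lower_index psi)%E ->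
  exists2 e : R, 0 < e & forall r, 0 < r < e -> psi r <= r `^ (2 * a).
Proof.
move=> /ereal_sup_gt[_ [b [b0 /cvgr_lt hb] <-]]; rewrite lte_fin => ba.
have [e /= e0 he] := hb 1 ltr01.
exists (Num.min e 1); first by rewrite lt_min e0/=.
move=> r /andP[r0]; rewrite lt_min => /andP[re r1].
have : psi r / r `^ (2 * b) < 1 by apply: he => //=; rewrite sub0r normrN gtr0_norm.
rewrite ltr_pdivrMr ?powR_gt0// mul1r => /ltW/le_trans; apply.
by apply: powR_antitone => //; [exact: ltW|rewrite ler_pM2l// ltW].
Qed.

(** Below the upper index the quotient fails to diverge to infinity, which gives some bound A along
    arbitrarily small scales and nothing at the others. *)
Lemma psi_le_of_upper_index (a : R) : 0 <= a -> (a%:E < upper_index psi)%E ->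
  exists2 A : R, 0 < A & forall e, 0 < e -> exists2 r, 0 < r < e & psi r <= A * r `^ (2 * a).
Proof.
move=> a0 h; have : ~ (psi r / r `^ (2 * a) @[r --> 0^'+] --> +oo).
  move=> h'; move: h; rewrite ltNge => /negP; apply.
  by apply: ereal_inf_lbound; exists a.
move=> /cvgryPge/existsNP[A hA]; exists (`|A| + 1); first by rewrite ltr_wpDl.
move=> e e0; apply: contrapT => /forall2NP nx; apply: hA.
near=> r.
have r0 : 0 < r by near: r; exact: nbhs_right_gt.
have re : r < e by near: r; exact: nbhs_right_lt.
have [|/negP] := nx r; first by rewrite r0 re.
rewrite -ltNge => hr; rewrite ler_pdivlMr ?powR_gt0//; apply: le_trans (ltW hr).
apply: ler_wpM2r; first exact: powR_ge0.
by rewrite (le_trans (ler_norm A))// lerDl.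
Unshelve. all: by end_near. Qed.

End Indices.

Lemma poly_dyadic_bounded (R : realType) (e : R) (p : nat) : 0 < e ->
  exists2 C : R, 0 <= C & forall n, n%:R ^+ p * dyadic R n `^ e <= C.
Proof.
move=> e0; pose l := e * ln (2 : R); have l0 : 0 < l by rewrite mulr_gt0// ln_gt0// ltr1n.
exists (p`!%:R * l ^- p + 1); first by rewrite addr_ge0// mulr_ge0// invr_ge0 exprn_ge0// ltW.
case=> [|n].
  rewrite /dyadic expr0 powR1 mulr1; case: p => [|p]; first by rewrite expr0 ler_wpDl// mulr_ge0// invr_ge0 exprn_ge0// ltW.
  by rewrite expr0n /= addr_ge0// mulr_ge0// invr_ge0 exprn_ge0// ltW.
have y0 : 0 < n.+1%:R * l by rewrite mulr_gt0.
have -> : dyadic R n.+1 `^ e = expR (- (n.+1%:R * l)).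
  rewrite /powR gt_eqF ?dyadic_gt0//; congr expR.
  by rewrite /dyadic lnXn ?invr_gt0// lnV ?posrE// -[(- ln 2) *+ _]mulr_natl /l; ring.
apply: ler_wpDr => //.
apply: le_trans (ler_wpM2l _ (expRN_le_fact p y0)) _; first exact: exprn_ge0.
rewrite exprMn invfM mulrCA; apply: ler_wpM2l => //.
by rewrite mulVKf// expf_neq0// pnatr_eq0.
Qed.

Section NondetRiesz.
Context (R : realType) (N : nat)
    (dd0 : measure_display) (Omega0 : measurableType dd0)
    (P0 : probability Omega0 R) (X0 : 'rV[R]_N -> {RV P0 >-> R})
    (X0_gauss : gaussian_process X0)
    (X0_centered : forall x, ('E_P0[X0 x] = 0)%E).

Lemma enorm_sq (x y : 'rV[R]_N) : enorm (x - y) = Num.sqrt (sq_dist x y).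
Proof. by rewrite /enorm /sq_dist; congr Num.sqrt; apply: eq_bigr => j _; rewrite !mxE. Qed.

(** For z nearest to y among the zs and r = |y - z|, every point of zs lies in the shell r <= |y -
    z'| <= r0, so that L is measurable for the conditioning sigma-algebra. Nondeterminism at y asks
    for r <= |y|; the hypothesis on the distances within S is there to ensure it. *)
Lemma nondet_riesz (psi : R -> R) (tt C3 r0 e a : R) (S : set 'rV[R]_N) :
  0 < C3 -> 0 < a ->
  (forall (x : 'rV[R]_N) (r : R), closed_cube tt x -> 0 < r -> r <= Num.min (enorm x) r0 ->
     exists V : Omega0 -> R,
       cond_var_version P0 (sigma_gen [set y | closed_cube tt y /\ r <= enorm (x - y) <= r0] X0) (X0 x) V
       /\ {ae P0, forall w, C3 * psi r <= V w}) ->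
  (forall r, 0 < r < e -> r `^ (2 * a) <= psi r) ->
  S `<=` closed_cube tt ->
  (forall x y, S x -> S y -> [/\ enorm (x - y) <= enorm x, enorm (x - y) <= r0 & enorm (x - y) < e]) ->
  nondet_on X0 S (riesz a C3).
Proof.
move=> C30 a0 slnd hpsi Scube Sdist y zs Sy Szs zs0.
have [z zzs hz] := seq_argmin (fun z => enorm (y - z)) zs0.
exists z => // L hL.
have [e1 e2 e3] := Sdist y z Sy (Szs z zzs).
(* If y is itself among the zs the kernel is 0, because 0 to the positive power a is 0. *)
have [r0'|r0'] := leP (enorm (y - z)) 0.
  have sq0 : sq_dist y z = 0.
    have := sq_dist_ge0 y z; rewrite le_eqVlt => /predU1P[<-//|h].
    by move: r0'; rewrite enorm_sq leNgt sqrtr_gt0 h.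
  rewrite /riesz sq0 powR0 ?gt_eqF// mulr0; apply: integral_ge0 => w _.
  by rewrite lee_fin sqr_ge0.
set r := enorm (y - z) in hz e1 e2 e3 r0'.
have [|V [cV vV]] := slnd y r (Scube _ Sy) r0'; first by rewrite le_min e1 e2.
have hp := hpsi r; rewrite r0' e3 in hp; have {}hp := hp isT.
have p0 : 0 <= psi r by apply: le_trans hp; exact: powR_ge0.
have hL' : lin_span X0 [set y0 | closed_cube tt y0 /\ r <= enorm (y - y0) <= r0] L.
  apply: (lin_span_sub _ hL) => z' /= z'zs; split; first exact/Scube/Szs.
  by rewrite hz//=; have [_ -> _] := Sdist y z' Sy (Szs z' z'zs).
apply: le_trans (cond_var_lower X0_gauss X0_centered (mulr_ge0 (ltW C30) p0) hL' cV vV).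
rewrite lee_fin /riesz; apply: ler_wpM2l; first exact: ltW.
apply: le_trans hp; rewrite powRrM (@powR_mulrn _ r 2 (ltW r0')) /r enorm_sq sqr_sqrtr//.
exact: sq_dist_ge0.
Qed.

End NondetRiesz.

Section EnergyOfSets.
Context (R : realType) (d : measure_display) (T : measurableType d)
  (mu : probability T R) (n : nat) (f : T -> 'rV[R]_n) (q : R).
Hypothesis mf : forall j, measurable_fun setT (fun x => f x 0 j).
Hypothesis hq : 1 < q.
Variable A : set T.
Hypothesis mA : measurable A.

Let q1 : 0 < q - 1. Proof. by rewrite subr_gt0. Qed.
Let q0 : 0 < q. Proof. exact: lt_trans hq. Qed.

Let muA : mu A = (fine (mu A))%:E. Proof. by rewrite fineK// fin_num_measure. Qed.

Let mass_powRE : ((fine (mu A) `^ q)%:E = (fine (mu A) `^ (q - 1))%:E * mu A)%E.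
Proof. by rewrite [in RHS]muA -EFinM mulrC mulr_powRB1// fine_ge0. Qed.

Lemma ball_energy_le_mass_powR r : (ball_energy mu f q A r <= (fine (mu A) `^ q)%:E)%E.
Proof.
have m0 : 0 <= fine (mu A) by exact: fine_ge0.
rewrite mass_powRE -(integral_cst mu mA).
apply: ge0_le_integral => //.
- by move=> x _; rewrite lee_fin powR_ge0.
- by apply: measurable_funTS; exact: measurable_near_mass_powR.
move=> x _; rewrite lee_fin; apply: ler_powR2 => //; first exact: near_mass_ge0.
apply: fine_le; rewrite ?fin_num_measure//; first exact: measurable_near_set.
by apply: le_measure; rewrite ?inE//; [exact: measurable_near_set|move=> y []].
Qed.

Lemma mass_powR_le_ball_energy r : (forall x y, A x -> A y -> forall j, `|f y 0 j - f x 0 j| < r) ->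
  ((fine (mu A) `^ q)%:E <= ball_energy mu f q setT r)%E.
Proof.
move=> dA; have m0 : 0 <= fine (mu A) by exact: fine_ge0.
have mN : measurable_fun setT (fun x => (near_mass mu f setT r x `^ (q - 1))%:E).
  exact: measurable_near_mass_powR.
rewrite mass_powRE -(integral_cst mu mA).
apply: (@le_trans _ _ (\int[mu]_(x in A) (near_mass mu f setT r x `^ (q - 1))%:E)%E).
  apply: ge0_le_integral => //.
  - by move=> x _; rewrite lee_fin powR_ge0.
  - exact: measurable_funTS.
  move=> x Ax; rewrite lee_fin; apply: ler_powR2 => //.
  apply: fine_le; rewrite ?fin_num_measure//; first exact: measurable_near_set.
  apply: le_measure; rewrite ?inE//; first exact: measurable_near_set.
  by move=> y Ay; split => // j; exact: dA.
apply: ge0_subset_integral => //.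
by move=> x _; rewrite lee_fin powR_ge0.
Qed.

End EnergyOfSets.

(** * Whitney cells around the origin *)

Section Cells.
Context (R : realType) (N m : nat) (W eta : R).
Hypotheses (W0 : 0 < W) (eta0 : 0 < eta) (mW : W < m%:R * eta).
Notation T := (borel_rV R N).

Definition box (b : R) : set T := [set x | forall j, `|(x : 'rV[R]_N) 0 j| <= b].

(** The part of a cube of side eta 2^-k in the shell of points of sup norm between W 2^-(k+1) and W
    2^-k. The side is proportional to the distance from the origin, so that the number of cubes per
    shell does not depend on k. *)
Definition cell (k : nat) (e : {ffun 'I_N -> 'I_(2 * m).+1}) : set T :=
  (box (W * dyadic R k) `\` box (W * dyadic R k.+1)) `&` mesh_cube (eta * dyadic R k) (cell_shift 0 e).

Lemma measurable_cell_set k e : measurable (cell k e).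
Proof.
apply: measurableI; last exact: measurable_mesh_cube.
by apply: measurableD; exact: measurable_box.
Qed.

Lemma cell_cover (K : nat) (x : T) : box W x ->
  box (W * dyadic R K) x \/ exists k : 'I_K, exists e, cell k e x.
Proof.
move=> xW; elim: K => [|K [IH|[k [e IH]]]].
- by left => j; rewrite /dyadic expr0 mulr1; exact: xW.
- have [h|h] := pselect (box (W * dyadic R K.+1) x); first by left.
  right; exists ord_max => /=.
  have [||e he] := @box_mesh_cover R N m (W * dyadic R K) (eta * dyadic R K) x _ _ IH.
  + by rewrite mulr_gt0// dyadic_gt0.
  + by rewrite mulrA ltr_pM2r// dyadic_gt0.
  by exists e; split.
- by right; exists (widen_ord (leqnSn K) k), e.
Qed.

Lemma coord_le_enorm (x : 'rV[R]_N) j : `|x 0 j| <= enorm x.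
Proof.
rewrite /enorm -sqrtr_sqr; apply: ler_wsqrtr.
by rewrite (bigD1 j)//= lerDl; apply: sumr_ge0 => i _; exact: sqr_ge0.
Qed.

(** The diameter of the cell is at most sqrt N eta 2^-k, hence at most W 2^-(k+1), and outside the
    inner box some coordinate of x exceeds this. *)
Lemma cell_dist k e (x y : T) : Num.sqrt N%:R * eta <= W / 2 -> cell k e x -> cell k e y ->
  enorm ((x : 'rV[R]_N) - y) <= enorm (x : 'rV[R]_N) /\
  enorm ((x : 'rV[R]_N) - y) <= Num.sqrt N%:R * eta.
Proof.
move=> eW [[_ nbx] xc] [_ yc]; have D0 := dyadic_gt0 R k.
have h : enorm ((x : 'rV[R]_N) - y) <= Num.sqrt N%:R * (eta * dyadic R k).
  apply: enorm_le_sup; first by rewrite mulr_ge0// ltW.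
  move=> j; rewrite !mxE; apply: ltW.
  exact: (mesh_cube_near (f := fun x : T => (x : 'rV[R]_N)) yc xc).
split; apply: (le_trans h); last first.
  by rewrite ler_wpM2l// ler_piMr ?dyadic_le1// ltW.
have [j hj] : exists j, W * dyadic R k.+1 < `|(x : 'rV[R]_N) 0 j|.
  apply: contrapT => /forallNP h'; apply: nbx => j; rewrite leNgt; apply/negP; exact: h'.
apply: le_trans (coord_le_enorm _ j); apply: le_trans (ltW hj).
by rewrite dyadicS; have := ler_wpM2r (ltW D0) eW; lra.
Qed.

Lemma cell_cube k e : cell k e `<=` closed_cube W.
Proof.
move=> x [[xb _] _] j; rewrite -ler_norml; apply: le_trans (xb j) _.
by rewrite ler_piMr ?dyadic_le1// ltW.
Qed.

End Cells.

Section LabelEnergy.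
Context (R : realType) (N d : nat)
    (dd0 : measure_display) (Omega0 : measurableType dd0)
    (P0 : probability Omega0 R) (X0 : 'rV[R]_N -> {RV P0 >-> R})
    (dd : measure_display) (Omega : measurableType dd)
    (P : probability Omega R) (X : 'I_d -> 'rV[R]_N -> {RV P >-> R})
    (X0_gauss : gaussian_process X0)
    (X0_centered : forall x, ('E_P0[X0 x] = 0)%E)
    (X_cont : forall w, continuous (sample_path X w))
    (X_indep : independent_processes X)
    (X_copies : forall i, same_law (X i) X0)
    (q : R) (hq : 1 < q)
    (mu : probability (borel_rV R N) R).
Notation T := (borel_rV R N).
Notation idT := (fun x : T => (x : 'rV[R]_N)).
Variables (a c t s C W eta : R) (m : nat).
Hypotheses (a0 : 0 < a) (c0 : 0 < c) (t0 : 0 < t) (td : t <= d%:R) (C0 : 0 <= C).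
Hypotheses (ats : a * t <= s) (W0 : 0 < W) (eta0 : 0 < eta) (mW : W < m%:R * eta).
Hypothesis energyC : forall r, 0 < r ->
  (ball_energy mu idT q setT r <= (C * r `^ ((q - 1) * s))%:E)%E.
Hypothesis muW : mu (box W) = 1%E.
Hypothesis nd : forall k e, nondet_on X0 (cell (m := m) W eta k e) (riesz a c).

Let q1 : 0 < q - 1. Proof. by rewrite subr_gt0. Qed.
Let q0 : 0 < q. Proof. exact: lt_trans hq. Qed.

Notation pot r := (potential d mu a c r).

(** The last level J has no lower bound, so that finitely many levels exhaust the values of the
    potential, which is at most 1. *)
Definition level (J : nat) (r : R) (j : nat) : set T :=
  [set z | pot r z <= dyadic R j /\ ((j < J)%N -> dyadic R j.+1 < pot r z)].

Definition label (K J : nat) : finType :=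
  option (option ('I_K * {ffun 'I_N -> 'I_(2 * m).+1} * 'I_J.+1)).

(* Nondeterminism at x only holds at distances at most |x|, hence the Whitney cells
   around the origin; the moment bound needs a uniform bound on the potential,
   hence the dyadic levels. *)
Definition label_set (K J : nat) (r : R) (l : label K J) : set T :=
  match l with
  | None => ~` box W
  | Some None => box (W * dyadic R K)
  | Some (Some (k, e, j)) => cell W eta k e `&` level J r j
  end.

Lemma measurable_level J r j : measurable (level J r j).
Proof.
have mp := measurable_potential d mu a c r.
have m1 := measurable_le_cst mp (dyadic R j).
have m2 := measurable_gt_cst mp (dyadic R j.+1).
have [jJ|jJ] := ltnP j J; last first.
  by rewrite (_ : level J r j = [set z : T | pot r z <= dyadic R j])//;
     apply/seteqP; split => z; rewrite /level /= ltnNge jJ => //= -[].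
rewrite (_ : level J r j = [set z : T | pot r z <= dyadic R j] `&` [set z : T | dyadic R j.+1 < pot r z]).
  exact: measurableI.
by apply/seteqP; split => z; rewrite /level /= jJ => -[h1 h2]; split => //; exact: h2.
Qed.

Lemma level_cover (J : nat) r (z : T) : exists j : 'I_J.+1, level J r j z.
Proof.
suff : forall J', (J' <= J)%N -> pot r z <= dyadic R J' \/ exists j : 'I_J.+1, level J r j z.
  move=> /(_ J (leqnn J))[h|//]; exists ord_max; split => //=; by rewrite ltnn.
elim=> [_|j IH jJ]; first by left; rewrite /dyadic expr0; exact: potential_le1.
have [h|] := IH (ltnW jJ); last by right.
have [h'|h'] := leP (pot r z) (dyadic R j.+1); first by left.
right; exists (Ordinal (leqW jJ)); split => //=.
Qed.

Lemma label_cover (K J : nat) r (x : T) : exists l : label K J, label_set r l x.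
Proof.
have [xW|nxW] := pselect (box W x); last by exists None.
have [h|[k [e h]]] := cell_cover eta0 mW K xW; first by exists (Some None).
have [j hj] := level_cover J r x.
by exists (Some (Some (k, e, j))).
Qed.

Lemma measurable_label_set (K J : nat) r (l : label K J) : measurable (label_set r l).
Proof.
case: l => [[[[k e] j]|]|] /=; last by apply: measurableC; exact: measurable_box.
  by apply: measurableI; [exact: measurable_cell_set|exact: measurable_level].
exact: measurable_box.
Qed.

Lemma nondet_on_sub (S S' : set 'rV[R]_N) kap : S' `<=` S -> nondet_on X0 S kap -> nondet_on X0 S' kap.
Proof. by move=> SS nS y zs /SS Sy zsS zs0; apply: nS => // z /zsS/SS. Qed.

(** The uniform bound G = 2^-j is at most twice the potential at each point of a level j < J, so
    that G^(q-1) mu(A) returns to the integral of the (q-1)-th power of the potential. On the last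
    level G = 2^-J is kept as an error term. *)
Lemma level_cell_energy (k : nat) (e : {ffun 'I_N -> 'I_(2 * m).+1}) (J j : nat) (r : R) :
  0 < r -> (j <= J)%N ->
  (\int[P]_w ball_energy mu (sample_path X w) q (cell W eta k e `&` level J r j) r <=
   (moment_const d q)%:E * ((2 `^ (q - 1))%:E * (\int[mu]_z (pot r z `^ (q - 1))%:E)
      + (dyadic R J `^ (q - 1))%:E))%E.
Proof.
move=> r0 jJ; set A := _ `&` _.
have mA : measurable A by apply: measurableI; [exact: measurable_cell_set|exact: measurable_level].
have sA : A `<=` cell W eta k e by move=> x [].
have nA : nondet_on X0 A (riesz a c) := nondet_on_sub sA (@nd k e).
have mk z : measurable_fun setT (fun y : T => ball_kernel d (riesz a c) r y z).
  exact: measurable_kernel_l.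
have mc0 : 0 <= moment_const d q.
  by rewrite addr_ge0// mulr_ge0// exprn_ge0// expR_ge0.
have kA z : A z -> (\int[mu]_(y in A) (ball_kernel d (riesz a c) r y z)%:E <= (dyadic R j)%:E)%E.
  move=> [_ [hz _]]; apply: (@le_trans _ _ (pot r z)%:E); last by rewrite lee_fin.
  rewrite -potentialE; apply: ge0_subset_integral => //.
  - by apply/measurable_EFinP; exact: mk.
  - by move=> y _; rewrite lee_fin kernel_ge0.
apply: le_trans (expected_ball_energy X0_gauss X0_centered X_cont X_indep X_copies hq mA r0 nA mk (dyadic_gt0 _ _) kA) _.
have pq z : (0 <= (pot r z `^ (q - 1))%:E)%E by rewrite lee_fin powR_ge0.
have mpq : measurable_fun setT (fun z => (pot r z `^ (q - 1))%:E).
  apply/measurable_EFinP; apply: (measurableT_comp (measurable_powR (q - 1))).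
  exact: measurable_potential.
rewrite EFinM -muleA; apply: lee_wpmul2l; first by rewrite lee_fin.
have i0 : (0 <= (2 `^ (q - 1))%:E * \int[mu]_z (pot r z `^ (q - 1))%:E)%E.
  by rewrite mule_ge0 ?lee_fin ?powR_ge0// integral_ge0.
move: jJ; rewrite leq_eqVlt => /predU1P[jJ|jJ].
  rewrite jJ -[leLHS]add0e; apply: leeD => //; rewrite -[leRHS]mule1; apply: lee_wpmul2l.
    by rewrite lee_fin powR_ge0.
  exact: probability_le1.
rewrite -[leLHS]adde0; apply: leeD; last by rewrite lee_fin powR_ge0.
rewrite -integral_cst//; apply: (@le_trans _ _ (\int[mu]_(z in A) ((2 `^ (q - 1))%:E * (pot r z `^ (q - 1))%:E))%E).
  apply: ge0_le_integral => //.
  - by move=> z _; rewrite lee_fin powR_ge0.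
  - by apply: measurable_funTS; apply: emeasurable_funM.
  move=> z [_ [_ /(_ jJ)]]; rewrite dyadicS -EFinM lee_fin => hz.
  rewrite -powRM ?potential_ge0//; apply: ler_powR2 => //; first exact/ltW/dyadic_gt0.
  by lra.
rewrite -ge0_integralZl//.
apply: ge0_subset_integral => //.
- by apply: emeasurable_funM.
- by move=> z _; rewrite mule_ge0 ?lee_fin ?powR_ge0.
Qed.

(** Whatever the path does on the small box, the energy there is at most the q-th power of the mass
    of the box, and this is at most the energy of mu at a radius above the diameter 2 W 2^-K. *)
Lemma origin_box_energy (K : nat) (f : T -> 'rV[R]_d) (r : R) :
  (forall j, measurable_fun setT (fun x => f x 0 j)) ->
  (ball_energy mu f q (box (W * dyadic R K)) r <= (C * (4 * W * dyadic R K) `^ ((q - 1) * s))%:E)%E.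
Proof.
move=> mf; have D0 := dyadic_gt0 R K.
have mB : measurable (box (W * dyadic R K) : set T) by exact: measurable_box.
apply: le_trans (ball_energy_le_mass_powR mu mf hq mB r) _.
apply: le_trans (energyC _); last by rewrite !mulr_gt0.
apply: (mass_powR_le_ball_energy _ (@measurable_id_coord R N) hq mB) => x y xB yB j.
have := xB j; have := yB j; rewrite !ler_norml ltr_norml => /andP[h1 h2] /andP[h3 h4].
have h5 : 0 < W * dyadic R K by exact: mulr_gt0.
by apply/andP; split; lra.
Qed.

(** The three conditions make the innermost ball of the potential, the last level and the remaining
    box at the origin contribute no more than r^((q-1) t); they are met by K, J and M of order log
    (1 / r). *)
Lemma label_energy : exists2 K1 : R, 0 <= K1 & forall (r : R) (K J M : nat), 0 < r ->
  dyadic R M `^ a <= r -> dyadic R J <= r `^ t -> dyadic R K `^ s <= r `^ t ->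
  forall l : label K J,
  (\int[P]_w ball_energy mu (sample_path X w) q (label_set r l) r <=
    (K1 * M.+2%:R `^ q * r `^ ((q - 1) * t))%:E)%E.
Proof.
have [Kp Kp0 hKp] := potential_moment hq a0 c0 t0 td C0 ats (fun r h => energyC (proj1 (andP h))).
pose m0 := moment_const d q.
have m00 : 0 <= m0 by rewrite addr_ge0// mulr_ge0// exprn_ge0// expR_ge0.
pose Kc := m0 * (2 `^ (q - 1) * Kp + 1); pose Ko := C * (4 * W) `^ ((q - 1) * s).
have Kc0 : 0 <= Kc by rewrite mulr_ge0// addr_ge0// mulr_ge0// powR_ge0.
have Ko0 : 0 <= Ko by rewrite mulr_ge0// powR_ge0.
exists (Kc + Ko); first exact: addr_ge0.
move=> r K J M r0 hM hJ hK l.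
have rt0 : 0 <= r `^ ((q - 1) * t) by exact: powR_ge0.
have M1 : 1 <= M.+2%:R `^ q :> R.
  by have := @ler_powR2 R q 1 M.+2%:R q0 ler01; rewrite powR1 ler1n; apply.
have mX w := measurable_sample_path X_cont w.
case: l => [[[[k e] j]|]|] /=.
- apply: le_trans (level_cell_energy _ _ r0 (leq_ord j)) _.
  apply: (@le_trans _ _ (m0%:E * ((2 `^ (q - 1))%:E * (Kp * M.+2%:R `^ q * r `^ ((q - 1) * t))%:E + (r `^ ((q - 1) * t))%:E))%E).
    apply: lee_wpmul2l; first by rewrite lee_fin.
    apply: leeD; first by apply: lee_wpmul2l; [rewrite lee_fin powR_ge0|exact: hKp].
    rewrite lee_fin [(q - 1) * t]mulrC powRrM; apply: ler_powR2 => //; exact/ltW/dyadic_gt0.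
  rewrite -[leLHS]/((m0 * (2 `^ (q - 1) * (Kp * M.+2%:R `^ q * r `^ ((q - 1) * t)) + r `^ ((q - 1) * t)))%:E) lee_fin.
  apply: (@le_trans _ _ (Kc * M.+2%:R `^ q * r `^ ((q - 1) * t))); last first.
    by apply: ler_wpM2r => //; apply: ler_wpM2r; [exact: powR_ge0|rewrite lerDl].
  rewrite /Kc -!mulrA; apply: ler_wpM2l => //; rewrite [leRHS]mulrDl mul1r -!mulrA lerD2l.
  by rewrite -[leLHS]mul1r; apply: ler_wpM2r.
- apply: (@le_trans _ _ (\int[P]_w (cst (Ko * r `^ ((q - 1) * t))%:E w))%E); last first.
    rewrite integral_cst// -[leRHS]mule1; apply: lee_pmul => //.
    + by rewrite lee_fin mulr_ge0.
    + rewrite lee_fin; apply: ler_wpM2r => //; rewrite -[leLHS]mulr1; apply: ler_pM => //.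
      by rewrite lerDr.
    + exact: probability_le1.
  apply: ge0_le_integral => //.
  + by move=> w _; apply: integral_ge0 => x _; rewrite lee_fin powR_ge0.
  + by apply: measurable_ball_energy => //; exact: measurable_box.
  move=> w _; apply: le_trans (origin_box_energy K r (mX w)) _.
  rewrite lee_fin /Ko powRM ?mulr_ge0 ?(ltW W0)//; last exact/ltW/dyadic_gt0.
  rewrite mulrA; apply: ler_wpM2l => //.
  rewrite ![(q - 1) * _]mulrC !powRrM.
  by apply: ler_powR2 => //; exact: powR_ge0.
- rewrite (_ : (fun w => _) = cst 0%E).
    by rewrite integral0 lee_fin !mulr_ge0 ?addr_ge0 ?powR_ge0.
  apply/funext => w; apply/eqP; rewrite eq_le; apply/andP; split; last first.
    by apply: integral_ge0 => x _; rewrite lee_fin powR_ge0.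
  have mB : measurable (~` box W : set T) by apply: measurableC; exact: measurable_box.
  apply: le_trans (ball_energy_le_mass_powR mu (mX w) hq mB r) _.
  rewrite (_ : mu (~` box W) = 0%E) ?powR0 ?gt_eqF//.
  by rewrite probability_setC ?muW ?subee//; exact: measurable_box.
Qed.

End LabelEnergy.

(** * Summation over the dyadic scales *)

Lemma dyadic_mul (R : realType) (k n : nat) : dyadic R (k * n) = dyadic R n ^+ k.
Proof. by rewrite /dyadic mulnC exprM. Qed.

Lemma dyadic_mul_powR_le (R : realType) (k n : nat) (s t : R) : t <= k%:R * s ->
  dyadic R (k * n) `^ s <= dyadic R n `^ t.
Proof.
move=> h; have D0 := dyadic_gt0 R n.
rewrite dyadic_mul -powR_mulrn ?(ltW D0)// -powRrM.
by apply: powR_antitone => //; exact: dyadic_le1.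
Qed.

Lemma card_label (N m k : nat) : exists Z : nat, forall n,
  (#|label N m (k * n) (k * n)| <= Z * n.+1 ^ 2)%N.
Proof.
exists ((k.+1 ^ 2 * #|{ffun 'I_N -> 'I_(2 * m).+1}|).+2) => j.
rewrite /label !card_option !card_prod !card_ord.
set E := #|_|; nia.
Qed.

Lemma sample_path_bounded (R : realType) (N d : nat) (dd : measure_display)
  (Omega : measurableType dd) (P : probability Omega R) (X : 'I_d -> 'rV[R]_N -> {RV P >-> R})
  (mu : probability (borel_rV R N) R) (B : R) (w : Omega) :
  continuous (sample_path X w) -> mu (box B) = 1%E ->
  exists2 B' : R, 0 <= B' &
    mu [set x : borel_rV R N | forall j, `|sample_path X w x 0 j| <= B'] = 1%E.
Proof.
move=> cX muB; have [B' B'0 hB'] := compact_coord_bounded (@compact_box R N B) cX.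
exists B' => //.
have mA : measurable [set x : borel_rV R N | forall j, `|sample_path X w x 0 j| <= B'].
  apply: measurable_forall_ord => j; apply: measurable_le_cst.
  apply: measurableT_comp => //; apply: continuous_borel => x.
  exact: (cvg_comp (sample_path X w) (fun v : 'rV[R]_d => v 0 j : R) (cX x) (@coord_continuous _ _ _ 0 j _)).
apply/eqP; rewrite eq_le; apply/andP; split; first exact: probability_le1.
rewrite -muB; apply: le_measure; rewrite ?inE//; exact: measurable_box.
Qed.

Section LowerBound.
Context (R : realType) (N d : nat)
    (dd0 : measure_display) (Omega0 : measurableType dd0)
    (P0 : probability Omega0 R) (X0 : 'rV[R]_N -> {RV P0 >-> R})
    (dd : measure_display) (Omega : measurableType dd)
    (P : probability Omega R) (X : 'I_d -> 'rV[R]_N -> {RV P >-> R})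
    (X0_gauss : gaussian_process X0)
    (X0_centered : forall x, ('E_P0[X0 x] = 0)%E)
    (X_cont : forall w, continuous (sample_path X w))
    (X_indep : independent_processes X)
    (X_copies : forall i, same_law (X i) X0)
    (q : R) (hq : 1 < q)
    (mu : probability (borel_rV R N) R).
Notation T := (borel_rV R N).
Notation idT := (fun x : T => (x : 'rV[R]_N)).
Let q1 : 0 < q - 1. Proof. by rewrite subr_gt0. Qed.
Let q0 : 0 < q. Proof. exact: lt_trans hq. Qed.

(** The gap between t' and t gives a positive power of the scale, which pays for the number of
    labels and for the polynomial factor of the moment bound and still leaves a summable series. *)
Lemma ae_lower_dim_ge_cells (a c t t' s C W eta : R) (m : nat) :
  0 < a -> 0 < c -> t <= d%:R -> 0 < s -> 0 <= C -> a * t <= s -> 0 < t' -> t' < t ->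
  0 < W -> 0 < eta -> W < m%:R * eta ->
  (forall r, 0 < r -> (ball_energy mu idT q setT r <= (C * r `^ ((q - 1) * s))%:E)%E) ->
  mu (box W) = 1%E ->
  (forall k e, nondet_on X0 (cell (m := m) W eta k e) (riesz a c)) ->
  {ae P, forall w, (t'%:E <= lower_gen_dim (image_measure X mu w) q)%E}.
Proof.
move=> a0 c0 td s0 C0 ats t'0 t't W0 eta0 mW energyC muW nd.
have t0 : 0 < t by exact: lt_trans t't.
have [K1 K10 hK1] := label_energy X0_gauss X0_centered X_cont X_indep X_copies hq
  a0 c0 t0 td C0 ats W0 energyC muW nd.
(* At the scale r = 2^-n the depths K = J = M = k n are used; k a >= 1, k >= t and k s >= t are the
   three conditions of [label_energy]. *)
pose k := Num.bound (t / s + t + a^-1).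
have hk : t / s + t + a^-1 < k%:R by apply: archi_boundP; rewrite !addr_ge0 ?divr_ge0 ?invr_ge0 ?ltW.
have ts0 : 0 < t / s by exact: divr_gt0.
have aV0 : 0 < a^-1 by rewrite invr_gt0.
have k1 : 1 <= k%:R * a by rewrite -ler_pdivrMr// div1r; lra.
have k2 : t <= k%:R * 1 by lra.
have k3 : t <= k%:R * s by rewrite -ler_pdivrMr//; lra.
pose D n := dyadic R n; have D0 n : 0 < D n by exact: dyadic_gt0.
have hM n : dyadic R (k * n) `^ a <= D n.
  by rewrite -[leRHS](powRr1 (ltW (D0 n))); exact: dyadic_mul_powR_le.
have hJ n : dyadic R (k * n) <= D n `^ t.
  by rewrite -[leLHS](powRr1 (ltW (dyadic_gt0 _ _))); exact: dyadic_mul_powR_le.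
have hK n : dyadic R (k * n) `^ s <= D n `^ t by exact: dyadic_mul_powR_le.
have [Z hZ] := card_label N m k.
pose L n := label N m (k * n) (k * n).
pose A n (l : L n) := label_set d mu a c W eta (D n) l.
pose S n w : \bar R := (\sum_(l : L n) ball_energy mu (sample_path X w) q (A n l) (D n))%E.
pose b := (q - 1) * t'.
pose cn n := #|L n|%:R `^ q / D n `^ b.
have cn0 n : 0 <= cn n by rewrite divr_ge0// powR_ge0.
pose F n w := ((cn n)%:E * S n w)%E.
have mA n l : measurable (A n l) by exact: measurable_label_set.
have mS n : measurable_fun setT (S n).
  by apply: emeasurable_sum => l; apply: measurable_ball_energy.
have e0 n l w : (0 <= ball_energy mu (sample_path X w) q (A n l) (D n))%E.
  by apply: integral_ge0 => x _; rewrite lee_fin powR_ge0.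
have S0 n w : (0 <= S n w)%E by apply: sume_ge0 => l _; exact: e0.
have mF n : measurable_fun setT (F n) by apply: emeasurable_funM.
have F0 n w : (0 <= F n w)%E by rewrite mule_ge0// lee_fin.
(* Half of the gain in the exponent absorbs the powers of n, the other half is the geometric decay
   x^n. *)
pose e := (q - 1) * (t - t') / 2.
have ee0 : 0 < e by rewrite divr_gt0// mulr_gt0// subr_gt0.
pose p := Num.bound (q + 1).
have hp : q + 1 <= p%:R by rewrite ltW//; apply: archi_boundP; rewrite addr_ge0// ltW.
(* The number of labels contributes the power 2 p of n + 1 and the moment bound the power p. *)
have [Cp Cp0 hCp] := poly_dyadic_bounded (3 * p) ee0.
pose x : R := 2^-1 `^ e.
have x0 : 0 <= x by exact: powR_ge0.
have x1 : x < 1.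
  have : (2^-1 : R) < 1 by rewrite invf_lt1// ltr1n.
  by move=> /(gt0_ltr_powR ee0); rewrite powR1; apply; rewrite nnegrE ?invr_ge0.
have Dx n : D n `^ e = x ^+ n.
  have half0 : 0 <= (2^-1 : R) by rewrite invr_ge0.
  rewrite /D /dyadic /x -(powR_mulrn n half0) -powRrM [n%:R * e]mulrC powRrM.
  by rewrite (powR_mulrn n (powR_ge0 _ _)).
pose Cf := K1 * (Z%:R * k.+2%:R) ^+ p * (2 `^ e * Cp).
have FC n : (\int[P]_w F n w <= (Cf * x ^+ n)%:E)%E.
  pose l : R := #|L n|%:R; pose u : R := Z%:R * n.+1%:R ^+ 2; pose v : R := k.+2%:R * n.+1%:R.
  have l1 : 1 <= l by rewrite ler1n; apply/card_gt0P; exists None.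
  have lu : l <= u by rewrite /l /u -natrX -natrM ler_nat; exact: hZ.
  have v1 : 1 <= v by rewrite /v -natrM ler1n.
  have lq : l `^ q * l <= u ^+ p.
    have l0 : 0 <= l by rewrite (le_trans ler01).
    rewrite -{2}(powRr1 l0) -powRD; last by rewrite (gt_eqF (lt_le_trans ltr01 l1)) implybT.
    apply: (@le_trans _ _ (u `^ (q + 1))); first by apply: ler_powR2 => //; rewrite addr_gt0.
    rewrite -powR_mulrn; last exact: le_trans lu.
    by apply: ler_powR => //; exact: le_trans lu.
  have Mv : (k * n).+2%:R `^ q <= v ^+ p.
    apply: (@le_trans _ _ (v `^ q)).
      have kn : ((k * n).+2 <= k.+2 * n.+1)%N.
        by clear; rewrite mulnS !mulSn; lia.
      by apply: (ler_powR2 q0 (ler0n _ _)); rewrite /v -natrM ler_nat.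
    rewrite -powR_mulrn; last exact: le_trans v1.
    by apply: ler_powR => //; lra.
  have DD : D n `^ ((q - 1) * t) / D n `^ b = D n.+1 `^ e * 2 `^ e * x ^+ n.
    have De : D n.+1 `^ e * 2 `^ e = D n `^ e.
      by rewrite -powRM ?(ltW (D0 _))// /D dyadicS divfK.
    rewrite De -Dx -powRN -!powRD ?(gt_eqF (D0 n)) ?implybT//.
    by congr (_ `^ _); rewrite /e /b; field.
  rewrite ge0_integralZl//; last by rewrite lee_fin.
  rewrite ge0_integral_sum//; last by move=> l'; exact: measurable_ball_energy.
  apply: (@le_trans _ _ ((cn n)%:E * \sum_(l' : L n) (K1 * (k * n).+2%:R `^ q * D n `^ ((q - 1) * t))%:E)%E).
    by apply: lee_wpmul2l; [rewrite lee_fin|apply: lee_sum => l' _; exact: hK1].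
  rewrite sumEFin -EFinM lee_fin sumr_const -/l.
  apply: (@le_trans _ _ (K1 * ((l `^ q * l) * ((k * n).+2%:R `^ q * (D n `^ ((q - 1) * t) / D n `^ b))))).
    rewrite /cn -/l -[_ * _ *+ _]mulr_natr -/l le_eqVlt; apply/orP; left; apply/eqP; ring.
  have -> : Cf * x ^+ n = K1 * ((Z%:R * k.+2%:R) ^+ p * (2 `^ e * (Cp * x ^+ n))) by rewrite /Cf; ring.
  apply: ler_wpM2l => //.
  apply: (@le_trans _ _ (u ^+ p * (v ^+ p * (D n `^ ((q - 1) * t) / D n `^ b)))).
    have d0 : 0 <= D n `^ ((q - 1) * t) / D n `^ b by rewrite divr_ge0// powR_ge0.
    apply: ler_pM => //.
    - by rewrite mulr_ge0 ?powR_ge0// (le_trans ler01).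
    - by rewrite mulr_ge0 ?powR_ge0.
    - exact: ler_wpM2r.
  rewrite DD [leLHS](_ : _ = (Z%:R * k.+2%:R) ^+ p * (2 `^ e * ((n.+1%:R ^+ (3 * p) * D n.+1 `^ e) * x ^+ n))); last first.
    have -> : n.+1%:R ^+ (3 * p) = (n.+1%:R ^+ 2) ^+ p * n.+1%:R ^+ p :> R.
      by rewrite -exprM -exprD; congr (_ ^+ _); clear; lia.
    rewrite /u /v; clear.
    move: (n.+1%:R : R) (k.+2%:R : R) (Z%:R : R) (D n.+1 `^ e) (2 `^ e) (x ^+ n) => y1 y2 y3 y4 y5 y6.
    by rewrite !exprMn; ring.
  apply: ler_wpM2l; first by rewrite exprn_ge0// mulr_ge0.
  apply: ler_wpM2l; first exact: powR_ge0.
  by apply: ler_wpM2r; [exact: exprn_ge0|exact: hCp].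
apply: filterS (ae_bounded_of_summable x0 x1 mF F0 FC) => w [B hB].
have [B' B'0 muB'] := sample_path_bounded (@X_cont w) muW.
have B0 : 0 <= B by rewrite -lee_fin; exact: le_trans (F0 0%N w) (hB 0%N).
apply: (lower_dim_ge_dyadic (n0 := 0) (measurable_sample_path X_cont w) hq B'0 muB' t'0 B0) => n _.
have cov y : exists l : L n, A n l y by exact: label_cover.
apply: le_trans (@mesh_le_ball_energies _ _ _ mu d (sample_path X w) q (measurable_sample_path X_cont w) hq
  (L n) (A n) (D n) (D0 n) (mA n) cov) _.
have := hB n; rewrite /F /cn mulrC EFinM -muleA muleC lee_pdivrMr ?powR_gt0//.
Qed.

End LowerBound.

(** * Almost sure dimensions *)

Section Assembly.
Context (R : realType) (N d : nat) (hN : (0 < N)%N)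
    (dd0 : measure_display) (Omega0 : measurableType dd0)
    (P0 : probability Omega0 R) (X0 : 'rV[R]_N -> {RV P0 >-> R})
    (dd : measure_display) (Omega : measurableType dd)
    (P : probability Omega R) (X : 'I_d -> 'rV[R]_N -> {RV P >-> R})
    (X0_gauss : gaussian_process X0)
    (X0_centered : forall x, ('E_P0[X0 x] = 0)%E)
    (X_cont : forall w, continuous (sample_path X w))
    (X_indep : independent_processes X)
    (X_copies : forall i, same_law (X i) X0)
    (psi : R -> R) (X0_C : condition_C X0 psi)
    (q : R) (hq : 1 < q)
    (mu : probability (borel_rV R N) R) (mu_supp : compact (msupport mu)).
Notation T := (borel_rV R N).
Notation idT := (fun x : T => (x : 'rV[R]_N)).
Notation muX w := (image_measure X mu w).

Let q1 : 0 < q - 1. Proof. by rewrite subr_gt0. Qed.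

Lemma ae_lower_dim_ge (a t t' s : R) : (upper_index psi < a%:E)%E -> 0 < a ->
  (s%:E < lower_gen_dim mu q)%E -> 0 < s -> t <= d%:R -> a * t <= s -> 0 < t' -> t' < t ->
  {ae P, forall w, (t'%:E <= lower_gen_dim (muX w) q)%E}.
Proof.
move=> ua a0 sl s0 td ats t'0 t't.
have [B B0 muB] := msupport_box mu_supp.
(* B may be 0, while the shells need a box of positive size. *)
pose W := B + 1; have W0 : 0 < W by rewrite ltr_wpDl.
have muW : mu (box W) = 1%E.
  apply/eqP; rewrite eq_le; apply/andP; split; first by apply: probability_le1; exact: measurable_box.
  rewrite -muB; apply: le_measure; rewrite ?inE; try exact: measurable_box.
  by move=> x xB j; rewrite (le_trans (xB j))// lerDl.
have [delta0 _ [_ _ /(_ W W0)[C3 [r0 [C30 r00 _ slnd]]]]] := X0_C.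
have [e e0 hpsi] := psi_ge_of_upper_index ua.
(* The bound for the diameters of cells: W / 2 keeps them below the distance from the origin, r0
   within the range of nondeterminism, e / 2 within the range where psi(r) >= r^(2 a). *)
pose M := Num.min (W / 2) (Num.min r0 (e / 2)).
have M0 : 0 < M by rewrite !lt_min r00 !divr_gt0.
have sN : 0 <= Num.sqrt N%:R :> R by exact: sqrtr_ge0.
pose eta := M / (Num.sqrt N%:R + 1); have eta0 : 0 < eta by rewrite divr_gt0// ltr_wpDl.
have etaM : Num.sqrt N%:R * eta <= M.
  by rewrite /eta mulrA ler_pdivrMr ?ltr_wpDl// mulrC; apply: ler_wpM2l; [exact: ltW|rewrite lerDl].
have [etaW [etar etae]] : Num.sqrt N%:R * eta <= W / 2 /\ Num.sqrt N%:R * eta <= r0 /\ Num.sqrt N%:R * eta <= e / 2.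
  by move: etaM; rewrite /M !le_min => /andP[-> /andP[-> ->]].
pose m := Num.bound (W / eta).
have mW : W < m%:R * eta by rewrite -ltr_pdivrMr//; apply: archi_boundP; rewrite divr_ge0// ltW.
have [C C0 hC] := energy_upper (@measurable_id_coord R N) hq B0 muB sl.
have energyC r : 0 < r -> (ball_energy mu idT q setT r <= ((C + 1) * r `^ ((q - 1) * s))%:E)%E.
  move=> r0'; have [r1|r1] := leP r 1.
    apply: le_trans (hC r _) _; first by rewrite r0'.
    by rewrite lee_fin; apply: ler_wpM2r; [exact: powR_ge0|rewrite lerDl].
  apply: le_trans (ball_energy_le1 mu (@measurable_id_coord R N) hq r) _.
  have h := @ler_powR2 R ((q - 1) * s) 1 r (mulr_gt0 q1 s0) ler01 (ltW r1).
  by rewrite lee_fin mulrDl mul1r; rewrite powR1 in h; apply: ler_wpDl => //; rewrite mulr_ge0 ?powR_ge0// ltW.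
apply: (ae_lower_dim_ge_cells X0_gauss X0_centered X_cont X_indep X_copies hq a0 C30 td s0 _ ats t'0 t't
  W0 eta0 mW energyC muW); first by rewrite addr_ge0// ltW.
move=> k f; apply: (nondet_riesz X0_gauss X0_centered C30 a0 slnd hpsi).
  exact: cell_cube.
move=> x y xc yc; have [h1 h2] := cell_dist eta0 etaW xc yc.
by split => //; [exact: le_trans etar|apply: (le_lt_trans h2); apply: (le_lt_trans etae); lra].
Qed.

(** The factor sqrt N passes from the sup norm of the energies to the Euclidean norm of (C1). *)
Lemma increments_psi : exists C2 delta0 : R, [/\ 0 < C2, 0 < delta0,
   forall r s, 0 <= r -> r <= s -> s < delta0 -> psi r <= psi s &
   forall r : R, 0 <= r -> Num.sqrt N%:R * r < delta0 ->
     increments_le X0 r (C2 * psi (Num.sqrt N%:R * r))].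
Proof.
have [delta0 d0 [[_ psi_mono _ _ _] [C2 C20 hC2] _]] := X0_C.
exists C2, delta0; split => // r r0 rd x y xy.
have h : enorm (y - x) <= Num.sqrt N%:R * r.
  by apply: enorm_le_sup => // j; rewrite !mxE; apply/ltW/xy.
have := hC2 x (y - x) (le_lt_trans h rd); rewrite unlock addrC subrK => /le_trans; apply.
rewrite lee_fin; apply: ler_wpM2l; first exact: ltW.
by apply: psi_mono => //; exact: sqrtr_ge0.
Qed.

Let sN : 0 < Num.sqrt N%:R :> R. Proof. by rewrite sqrtr_gt0 ltr0n. Qed.

(* A sequence of exponents increasing to al. *)
Definition subindex (al : R) (k : nat) : R := al * k.+1%:R / k.+2%:R.

Lemma subindex_gt0 al k : 0 < al -> 0 < subindex al k.
Proof. by move=> al0; rewrite !mulr_gt0// invr_gt0. Qed.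

Lemma subindex_lt al k : 0 < al -> subindex al k < al.
Proof. by move=> al0; rewrite /subindex ltr_pdivrMr// ltr_pM2l// ltr_nat. Qed.

Lemma ae_holder_lower_index (al : R) : lower_index psi = al%:E -> 0 < al ->
  {ae P, forall w, forall k, exists n0, forall n, (n0 <= n)%N ->
    holder_scale mu idT (sample_path X w) q (subindex al k) (2 `^ (- q)) n}.
Proof.
move=> lal al0; apply: ae_foralln => k.
have b'0 := subindex_gt0 k al0; have b'al := subindex_lt k al0.
(* An exponent strictly between: b < al bounds psi by r^(2 b) at all small scales, and b' < b makes
   the split mass negligible. *)
set b' := subindex al k in b'0 b'al *; pose b := (b' + al) / 2.
have b'b : b' < b by rewrite /b; lra.
have bal : (b%:E < lower_index psi)%E by rewrite lal lte_fin /b; lra.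
have [e e0 hpsi] := psi_le_of_lower_index bal.
have [C2 [delta0 [C20 d0 _ inc]]] := increments_psi.
have V0 : 0 < C2 * Num.sqrt N%:R `^ (2 * b) by rewrite mulr_gt0// powR_gt0.
have [n1 hn1] : exists n, forall m, (n <= m)%N -> dyadic R m < Num.min e delta0 / Num.sqrt N%:R.
  by apply: dyadic_small; rewrite divr_gt0// lt_min e0.
have [B B0 muB] := msupport_box mu_supp.
have hs := ae_holder_scales X0_gauss X0_centered X_cont X_copies hq b'b V0 B0 muB.
apply: filterS hs => w [n0 hn0].
exists (maxn n0 n1) => n; rewrite geq_max => /andP[nn0 nn1]; apply: hn0 => // x y xy.
have := hn1 n nn1; rewrite ltr_pdivlMr// mulrC lt_min => /andP[De Dd].
have D0 := dyadic_gt0 R n.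
apply: le_trans (inc _ (ltW D0) Dd x y xy) _; rewrite lee_fin -mulrA; apply: ler_wpM2l; first exact: ltW.
by rewrite -powRM ?(ltW sN) ?(ltW D0)//; apply: hpsi; rewrite mulr_gt0.
Qed.

(** The scales r at which psi is small need not be dyadic. The dyadic scale D with sqrt N D <= r < 2
    sqrt N D inherits the bound, because psi is non-decreasing and the lost constant (2 sqrt N)^(2
    b) goes into V. *)
Lemma ae_holder_upper_index (au : R) : upper_index psi = au%:E -> 0 < au ->
  {ae P, forall w, forall k, forall n0, exists2 n, (n0 <= n)%N &
    holder_scale mu idT (sample_path X w) q (subindex au k) (2 `^ (- q)) n}.
Proof.
move=> uau au0; apply: ae_foralln => k.
have b'0 := subindex_gt0 k au0; have b'au := subindex_lt k au0.
set b' := subindex au k in b'0 b'au *; pose b := (b' + au) / 2.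
have b'b : b' < b by rewrite /b; lra.
have bau : (b%:E < upper_index psi)%E by rewrite uau lte_fin /b; lra.
have b0 : 0 < b by exact: lt_trans b'b.
have [A A0 hpsi] := psi_le_of_upper_index (ltW b0) bau.
have [C2 [delta0 [C20 d0 psi_mono inc]]] := increments_psi.
have V0 : 0 < C2 * (A * (Num.sqrt N%:R * 2) `^ (2 * b)) by rewrite !mulr_gt0// powR_gt0// mulr_gt0.
have [B B0 muB] := msupport_box mu_supp.
have hs := ae_holder_scales X0_gauss X0_centered X_cont X_copies hq b'b V0 B0 muB.
apply: filterS hs => w [n1 hn1] n0.
have [|r /andP[r0]] := hpsi (Num.min delta0 (Num.sqrt N%:R * dyadic R (maxn n0 n1))).
  by rewrite lt_min d0 mulr_gt0// dyadic_gt0.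
rewrite lt_min => /andP[rd rD] hr.
have [||n nn /andP[Dr rn]] := @dyadic_scale R (r / Num.sqrt N%:R) (maxn n0 n1).
- exact: divr_gt0.
- by rewrite ltr_pdivrMr// mulrC.
move: nn; rewrite geq_max => /andP[nn0 nn1].
exists n.+1; first exact: leqW.
apply: hn1; first exact: leqW.
move=> x y xy; have D0 := dyadic_gt0 R n.+1.
have sr : Num.sqrt N%:R * dyadic R n.+1 <= r by rewrite mulrC -ler_pdivlMr.
apply: le_trans (inc _ (ltW D0) (le_lt_trans sr rd) x y xy) _; rewrite lee_fin -mulrA; apply: ler_wpM2l; first exact: ltW.
apply: le_trans (psi_mono _ _ _ sr rd) _; first by rewrite mulr_ge0// ltW.
apply: (le_trans hr); rewrite -mulrA; apply: ler_wpM2l; first exact: ltW.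
rewrite -powRM ?(ltW D0) ?mulr_ge0 ?(ltW sN)//; apply: ler_powR2; [by rewrite mulr_gt0|exact: ltW|].
by move: rn; rewrite ltr_pdivrMr// dyadicS => /ltW; lra.
Qed.

Let mi := @measurable_id_coord R N.
Let mX w := measurable_sample_path X_cont w.

Let img_bounded w : exists2 B : R, 0 <= B &
  mu [set x : T | forall j, `|sample_path X w x 0 j| <= B] = 1%E.
Proof.
by have [B B0 muB] := msupport_box mu_supp; apply: sample_path_bounded muB; exact: X_cont.
Qed.

Lemma lower_dim_image_ge0 w : (0 <= lower_gen_dim (muX w) q)%E.
Proof. by have [B B0 muB] := img_bounded w; exact: (lower_dim_ge0 (mX w) hq B0 muB). Qed.

Lemma upper_dim_image_le w : (upper_gen_dim (muX w) q <= d%:R%:E)%E.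
Proof. by have [B B0 muB] := img_bounded w; exact: (upper_dim_le_dim (mX w) hq B0 muB). Qed.

Lemma lower_dim_image_le_upper w : (lower_gen_dim (muX w) q <= upper_gen_dim (muX w) q)%E.
Proof. exact: limf_einf_le_esup. Qed.

Lemma lower_dim_fin : exists2 x : R, 0 <= x & lower_gen_dim mu q = x%:E.
Proof.
have [B B0 muB] := msupport_box mu_supp.
have l0 : (0 <= lower_gen_dim mu q)%E := lower_dim_ge0 mi hq B0 muB.
have u1 : (upper_gen_dim mu q <= N%:R%:E)%E := upper_dim_le_dim mi hq B0 muB.
have := le_trans (limf_einf_le_esup _ : lower_gen_dim mu q <= upper_gen_dim mu q)%E u1.
by move: l0; case: lower_gen_dim => // x; rewrite lee_fin => x0 _; exists x.
Qed.

Lemma upper_dim_fin : exists2 x : R, 0 <= x & upper_gen_dim mu q = x%:E.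
Proof.
have [x x0 lx] := lower_dim_fin.
have [B B0 muB] := msupport_box mu_supp.
have u1 : (upper_gen_dim mu q <= N%:R%:E)%E := upper_dim_le_dim mi hq B0 muB.
have : (lower_gen_dim mu q <= upper_gen_dim mu q)%E := limf_einf_le_esup _.
move: u1; rewrite lx; case: upper_gen_dim => // y _; rewrite lee_fin => xy.
by exists y => //; exact: le_trans xy.
Qed.

Lemma ae_lower_dim_ge_min (au : R) : upper_index psi = au%:E -> 0 < au ->
  {ae P, forall w, (Order.min (d%:R)%:E ((au^-1)%:E * lower_gen_dim mu q) <= lower_gen_dim (muX w) q)%E}.
Proof.
move=> uau au0; have [x x0 lx] := lower_dim_fin.
pose v : R := Num.min d%:R (au^-1 * x).
have -> : Order.min (d%:R)%:E ((au^-1)%:E * lower_gen_dim mu q)%E = v%:E.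
  by rewrite lx -EFinM EFin_min.
have hk k : {ae P, forall w, ((v - k.+1%:R^-1)%:E <= lower_gen_dim (muX w) q)%E}.
  have : 0 < k.+1%:R^-1 :> R by rewrite invr_gt0.
  move: (k.+1%:R^-1) => u u0; have [t'0|t'0] := leP (v - u) 0.
    by apply: aeW => w; apply: le_trans (lower_dim_image_ge0 w); rewrite lee_fin.
  (* Room is made twice: t' < t < v pays for the polynomial factors, and t au < s < x makes the
     exponent a = s / t exceed the upper index while s stays below the lower dimension of mu. *)
  set t' := v - _ in t'0 *; pose t := (t' + v) / 2.
  have t't : t' < t by rewrite /t /t'; lra.
  have tv : t < v by rewrite /t /t'; lra.
  have t0 : 0 < t by exact: lt_trans t't.
  have [td tx] : t < d%:R /\ t < au^-1 * x by move: tv; rewrite /v lt_min => /andP[].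
  have tax : t * au < x by move: tx; rewrite mulrC ltr_pdivlMr.
  pose s := (t * au + x) / 2; have ta0 : 0 < t * au by exact: mulr_gt0.
  have s0 : 0 < s by rewrite /s; lra.
  apply: (@ae_lower_dim_ge (s / t) t t' s) => //.
  - by rewrite uau lte_fin ltr_pdivlMr// mulrC /s; lra.
  - exact: divr_gt0.
  - by rewrite lx lte_fin /s; lra.
  - exact: ltW.
  - by rewrite divfK// gt_eqF.
apply: filterS (ae_foralln hk) => w hw.
apply/lee_addgt0Pr => e e0.
have [k _ /(_ k (leqnn k))] := cvgr_lt 0 (cvg_inv_nat (1 : R)) e e0.
rewrite /= div1r => ke; have := hw k; rewrite EFinB leeBlDr// => /le_trans; apply.
by rewrite leeD2l// lee_fin ltW.
Qed.

Lemma le_of_subindex (y : \bar R) (x al : R) : 0 < al -> 0 <= x ->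
  (forall k s, x < s -> (y <= (s / subindex al k)%:E)%E) -> (y <= (al^-1 * x)%:E)%E.
Proof.
move=> al0 x0 h; apply/lee_addgt0Pr => e e0.
have ae0 : 0 < al * e by exact: mulr_gt0.
have [k _ /(_ k (leqnn k))] := cvgr_lt 0 (cvg_inv_nat x) (al * e / 4) (divr_gt0 ae0 (ltr0Sn _ _)).
rewrite /= => ke.
(* Both s = x + al e / 4 and the loss x / (k + 2) from the subindex are paid for by al e, of which
   the factor 1 - 1 / (k + 2) keeps at least half. *)
apply: le_trans (h k (x + al * e / 4) _) _; first by rewrite ltrDl divr_gt0.
rewrite -EFinD lee_fin ler_pdivrMr ?subindex_gt0// /subindex.
have -> : (al^-1 * x + e) * (al * k.+1%:R / k.+2%:R) = (x + al * e) * (1 - k.+2%:R^-1).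
  rewrite -[k.+2%:R]natr1; have k0 : (k.+1%:R + 1 : R) != 0 by rewrite gt_eqF// ltr_wpDl.
  by move: (k.+1%:R) k0 => z z0; field; rewrite z0 gt_eqF.
have k2 : k.+2%:R^-1 <= 2^-1 :> R by rewrite lef_pV2 ?posrE// ler_nat.
have kx : x * k.+2%:R^-1 <= al * e / 4.
  apply: le_trans (ltW ke); apply: ler_wpM2l => //.
  by rewrite lef_pV2 ?posrE// ler_nat.
by have := ler_wpM2l (ltW ae0) k2; move: (k.+2%:R^-1) kx => z; lra.
Qed.

Lemma ae_upper_dim_le (al x : R) : lower_index psi = al%:E -> 0 < al -> upper_gen_dim mu q = x%:E ->
  {ae P, forall w, (upper_gen_dim (muX w) q <= (al^-1 * x)%:E)%E}.
Proof.
move=> lal al0 ux; have [x' x'0 ux'] := upper_dim_fin.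
have x0 : 0 <= x by move: ux'; rewrite ux => -[->].
have [B B0 muB] := msupport_box mu_supp.
apply: filterS (ae_holder_lower_index lal al0) => w hw.
have [B' B'0 muB'] := img_bounded w.
apply: (le_of_subindex al0 x0) => k s xs; have [n0 hn0] := hw k.
apply: (upper_dim_transfer mi (mX w) hq B0 muB B'0 muB' (subindex_gt0 k al0) (powR_gt0 _ (ltr0Sn _ _)) hn0).
by change (upper_gen_dim mu q < s%:E)%E; rewrite ux lte_fin.
Qed.

Lemma ae_lower_dim_le (al x : R) : lower_index psi = al%:E -> 0 < al -> lower_gen_dim mu q = x%:E ->
  {ae P, forall w, (lower_gen_dim (muX w) q <= (al^-1 * x)%:E)%E}.
Proof.
move=> lal al0 lx; have [x' x'0 lx'] := lower_dim_fin.
have x0 : 0 <= x by move: lx'; rewrite lx => -[->].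
have [B B0 muB] := msupport_box mu_supp.
apply: filterS (ae_holder_lower_index lal al0) => w hw.
have [B' B'0 muB'] := img_bounded w.
apply: (le_of_subindex al0 x0) => k s xs; have [n0 hn0] := hw k.
apply: (lower_dim_transfer mi (mX w) hq B0 muB B'0 muB' (subindex_gt0 k al0) (powR_gt0 _ (ltr0Sn _ _)) hn0).
by change (lower_gen_dim mu q < s%:E)%E; rewrite lx lte_fin.
Qed.

Lemma ae_lower_dim_le_upper (au x : R) : upper_index psi = au%:E -> 0 < au -> upper_gen_dim mu q = x%:E ->
  {ae P, forall w, (lower_gen_dim (muX w) q <= (au^-1 * x)%:E)%E}.
Proof.
move=> uau au0 ux; have [x' x'0 ux'] := upper_dim_fin.
have x0 : 0 <= x by move: ux'; rewrite ux => -[->].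
have [B B0 muB] := msupport_box mu_supp.
apply: filterS (ae_holder_upper_index uau au0) => w hw.
have [B' B'0 muB'] := img_bounded w.
apply: (le_of_subindex au0 x0) => k s xs.
apply: (lower_dim_transfer_freq mi (mX w) hq B0 muB B'0 muB' (subindex_gt0 k au0) (powR_gt0 _ (ltr0Sn _ _)) (hw k)).
by change (upper_gen_dim mu q < s%:E)%E; rewrite ux lte_fin.
Qed.

Lemma ae_lower_dim_eq (au x : R) : upper_index psi = au%:E -> 0 < au -> lower_gen_dim mu q = x%:E ->
  {ae P, forall w, (lower_gen_dim (muX w) q <= (au^-1 * x)%:E)%E} ->
  {ae P, forall w, lower_gen_dim (muX w) q = Order.min (d%:R)%:E ((au^-1)%:E * x%:E)%E}.
Proof.
move=> uau au0 lx; apply: filterS2 (ae_lower_dim_ge_min uau au0) => w; rewrite lx => hge hle.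
apply/eqP; rewrite eq_le hge andbT le_min -EFinM hle andbT.
exact: le_trans (lower_dim_image_le_upper w) (upper_dim_image_le w).
Qed.

End Assembly.

Theorem theorem1 (R : realType) (N d : nat) (hN : (0 < N)%N) (hd : (0 < d)%N)
    (dd0 : measure_display) (Omega0 : measurableType dd0)
    (P0 : probability Omega0 R) (X0 : 'rV[R]_N -> {RV P0 >-> R})
    (dd : measure_display) (Omega : measurableType dd)
    (P : probability Omega R) (X : 'I_d -> 'rV[R]_N -> {RV P >-> R})
    (X0_gauss : gaussian_process X0)
    (X0_centered : forall x, ('E_P0[X0 x] = 0)%E)
    (X0_origin : {ae P0, forall w, X0 0 w = 0})
    (X_gauss : gaussian_process (fun p : 'I_d * 'rV[R]_N => X p.1 p.2))
    (X_cont : forall w, continuous (sample_path X w))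
    (X_indep : independent_processes X)
    (X_copies : forall i, same_law (X i) X0)
    (psi : R -> R) (X0_C : condition_C X0 psi)
    (q : R) (hq : 1 < q)
    (mu : probability (borel_rV R N) R) (mu_supp : compact (msupport mu)) :
  [/\ forall alpha : R,
        lower_index psi = alpha%:E -> upper_index psi = alpha%:E ->
        0 < alpha -> alpha < 1 ->
        {ae P, forall w,
          lower_gen_dim (image_measure X mu w) q
          = Order.min (d%:R)%:E ((alpha^-1)%:E * lower_gen_dim mu q)%E},
      forall (D : \bar R) (alow aupp : R),
        has_gen_dim mu q D ->
        lower_index psi = alow%:E -> upper_index psi = aupp%:E ->
        0 < alow -> alow <= aupp -> aupp < 1 ->
        {ae P, forall w,
          [/\ Order.min (d%:R)%:E ((aupp^-1)%:E * D)%E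
              = lower_gen_dim (image_measure X mu w) q,
              (lower_gen_dim (image_measure X mu w) q
               <= upper_gen_dim (image_measure X mu w) q)%E
            & (upper_gen_dim (image_measure X mu w) q
               <= Order.min (d%:R)%:E ((alow^-1)%:E * D))%E]}
    & forall (D : \bar R) (alpha : R),
        has_gen_dim mu q D ->
        lower_index psi = alpha%:E -> upper_index psi = alpha%:E ->
        0 < alpha -> alpha < 1 ->
        {ae P, forall w,
          has_gen_dim (image_measure X mu w) q
            (Order.min (d%:R)%:E ((alpha^-1)%:E * D)%E)}].
Proof.
have low_eq := ae_lower_dim_eq X0_gauss X0_centered X_cont X_indep X_copies X0_C hq mu_supp.
have low_le := ae_lower_dim_le hN X0_gauss X0_centered X_cont X_copies X0_C hq mu_supp.
have low_up := ae_lower_dim_le_upper hN X0_gauss X0_centered X_cont X_copies X0_C hq mu_supp.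
have up_le := ae_upper_dim_le hN X0_gauss X0_centered X_cont X_copies X0_C hq mu_supp.
have [x x0 lx] := lower_dim_fin hq mu_supp.
(* With both indices equal to alpha the two outer bounds coincide, so that the same statement yields
   (iii). *)
have two (D : \bar R) (alow aupp : R) : has_gen_dim mu q D ->
    lower_index psi = alow%:E -> upper_index psi = aupp%:E -> 0 < alow -> alow <= aupp ->
    {ae P, forall w,
      [/\ Order.min (d%:R)%:E ((aupp^-1)%:E * D)%E = lower_gen_dim (image_measure X mu w) q,
          (lower_gen_dim (image_measure X mu w) q <= upper_gen_dim (image_measure X mu w) q)%E
        & (upper_gen_dim (image_measure X mu w) q <= Order.min (d%:R)%:E ((alow^-1)%:E * D))%E]}.
  move=> [lD uD] lal uau al0 alau; have au0 : 0 < aupp by exact: lt_le_trans alau.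
  have Dx : D = x%:E by rewrite -lD.
  rewrite Dx in uD *.
  have h1 := low_eq _ _ uau au0 lx (low_up _ _ uau au0 uD).
  have h2 := up_le _ _ lal al0 uD.
  apply: filterS2 h1 h2 => w hl hw; split; first by rewrite hl.
    exact: limf_einf_le_esup.
  by rewrite le_min -EFinM hw andbT; exact: upper_dim_image_le.
split.
(* Here D need not exist: the lower index gives the transfer at all small scales, which can be
   matched with the scales where the energy of mu is large, and equality of the indices makes this
   bound meet the one from nondeterminism. *)
- move=> al lal ual al0 _; rewrite lx.
  exact: low_eq ual al0 lx (low_le _ _ lal al0 lx).
- by move=> D alow aupp hD lal uau al0 alau _; exact: two.
- move=> D al hD lal ual al0 _.
  have h := two D al al hD lal ual al0 (lexx al).
  apply: filterS h => w [h1 h2 h3]; split; first by [].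
  by apply/eqP; rewrite eq_le h3 h1.
Qed.
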